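(* Let $\rho_1,\sigma_1\in\mathcal{S}(\mathcal{H}_1)$ and $\rho_2,\sigma_2\in\mathcal{S}(\mathcal{H}_2)$ with $\mathrm{supp}(\rho_1)\subseteq\mathrm{supp}(\sigma_1)$ or $\mathrm{supp}(\rho_2)\subseteq\mathrm{supp}(\sigma_2)$, let $r>0$, and assume $\rho_2$ is a pure state. Then $$E^d_{sc}(\rho_1,\sigma_1,\rho_2,\sigma_2,r)=\sup_{\beta\ge1}\frac{\beta-1}{\beta}\Big\{rD_{1/\beta}(\rho_2\|\sigma_2)-D^*_\beta(\rho_1\|\sigma_1)\Big\}.$$
   Context: $\mathcal{S}(\mathcal{H})$ denotes the set of density operators on a finite-dimensional Hilbert space $\mathcal{H}$; logarithms are base 2. Fidelity $F(\rho,\sigma)=\|\sqrt\rho\sqrt\sigma\|_1$, trace distance $d(\rho,\sigma)=\frac12\|\rho-\sigma\|_1$. For rate $r>0$ (with $nr$ understood as an integer), $\epsilon^{d,r}(n)=\min\{d(\mathcal{E}_n(\rho_1^{\otimes n}),\rho_2^{\otimes nr}):\mathcal{E}_n \text{ a quantum channel with } \mathcal{E}_n(\sigma_1^{\otimes n})=\sigma_2^{\otimes nr}\}$ and $E^d_{sc}=\lim_{n\to\infty}-\frac1n\log(1-\epsilon^{d,r}(n))$ (existence of the limit is part of the claim). The sandwiched Rényi divergence is $D^*_\beta(\rho\|\sigma)=\frac{1}{\beta-1}\log\operatorname{Tr}(\sigma^{\frac{1-\beta}{2\beta}}\rho\sigma^{\frac{1-\beta}{2\beta}})^\beta$ (for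 $\beta>1$ and $\mathrm{supp}(\rho)\subseteq\mathrm{supp}(\sigma)$, otherwise $+\infty$), and the Petz Rényi divergence for $\alpha\in(0,1)$ is $D_\alpha(\rho\|\sigma)=\frac{1}{\alpha-1}\log\operatorname{Tr}\rho^\alpha\sigma^{1-\alpha}$ if $\mathrm{supp}(\rho)\not\perp\mathrm{supp}(\sigma)$, otherwise $+\infty$; at $\beta=1$ (order 1) both equal the Umegaki relative entropy $D(\rho\|\sigma)=\operatorname{Tr}\rho(\log\rho-\log\sigma)$. *)

(* Defs.v *)
From HB Require Import structures.
From mathcomp Require Import all_boot all_order all_algebra.
From mathcomp Require Import complex mxtens.
From mathcomp Require Import all_classical all_reals all_analysis.

Set Implicit Arguments.
Unset Strict Implicit.
Unset Printing Implicit Defensive.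

Import Order.TTheory GRing.Theory Num.Theory.
Local Open Scope ring_scope.
Local Open Scope classical_set_scope.

Definition dag (R : realType) (m n : nat) (A : 'M[R[i]]_(m, n)) : 'M[R[i]]_(n, m) :=
  map_mx Num.conj (A^T).

Definition hermitian (R : realType) (d : nat) (A : 'M[R[i]]_d) : Prop :=
  dag A = A.

Definition psd (R : realType) (d : nat) (A : 'M[R[i]]_d) : Prop :=
  hermitian A /\ forall x : 'cV[R[i]]_d, 0 <= (dag x *m A *m x) 0 0.

Definition density (R : realType) (d : nat) (A : 'M[R[i]]_d) : Prop :=
  psd A /\ \tr A = 1.

Definition pure (R : realType) (d : nat) (A : 'M[R[i]]_d) : Prop :=
  exists psi : 'cV[R[i]]_d, A = psi *m dag psi.

(* supp(A) = range (column space) of A. *)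
Definition supp_sub (R : realType) (d : nat) (A B : 'M[R[i]]_d) : bool :=
  (A^T <= B^T)%MS.

Definition supp_orth (R : realType) (d : nat) (A B : 'M[R[i]]_d) : Prop :=
  forall x y : 'cV[R[i]]_d, dag (A *m x) *m (B *m y) = 0.

(* Functional calculus for Hermitian (normal) matrices, via the spectral
   theorem of mathcomp: A = P^-1 diag(lambda) P with P unitary. *)
Definition mfun (R : realType) (d : nat) (f : R -> R) (A : 'M[R[i]]_d)
  : 'M[R[i]]_d :=
  invmx (spectralmx A)
  *m diag_mx (map_mx (fun z : R[i] => ((f (complex.Re z))%:C)%C) (spectral_diag A))
  *m spectralmx A.

Definition log2 (R : realType) (x : R) : R := ln x / ln 2.

Definition mpow (R : realType) (d : nat) (p : R) (A : 'M[R[i]]_d) :=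
  mfun (fun l : R => if 0 < l then powR l p else 0) A.

Definition mlog2 (R : realType) (d : nat) (A : 'M[R[i]]_d) :=
  mfun (fun l : R => if 0 < l then log2 l else 0) A.

Definition rtr (R : realType) (d : nat) (A : 'M[R[i]]_d) : R :=
  complex.Re (\tr A).

Definition trnorm (R : realType) (d : nat) (X : 'M[R[i]]_d) : R :=
  rtr (mfun (@Num.sqrt R) (dag X *m X)).

Definition tdist (R : realType) (d : nat) (A B : 'M[R[i]]_d) : R :=
  2^-1 * trnorm (A - B).

Definition umegaki (R : realType) (d : nat) (rho sigma : 'M[R[i]]_d) : \bar R :=
  if supp_sub rho sigma then (rtr (rho *m (mlog2 rho - mlog2 sigma)))%:E
  else +oo%E.

(* Petz Renyi divergence D_alpha, alpha in (0,1); order 1 = Umegaki *)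
Definition petz (R : realType) (d : nat) (alpha : R) (rho sigma : 'M[R[i]]_d)
  : \bar R :=
  if alpha == 1 then umegaki rho sigma
  else if `[< supp_orth rho sigma >] then +oo%E
  else ((alpha - 1)^-1 * log2 (rtr (mpow alpha rho *m mpow (1 - alpha) sigma)))%:E.

(* sandwiched Renyi divergence D*_beta, beta > 1; order 1 = Umegaki *)
Definition sandwiched (R : realType) (d : nat) (beta : R) (rho sigma : 'M[R[i]]_d)
  : \bar R :=
  if beta == 1 then umegaki rho sigma
  else if supp_sub rho sigma then
    let S := mpow ((1 - beta) / (2 * beta)) sigma in
    ((beta - 1)^-1 * log2 (rtr (mpow beta (S *m rho *m S))))%:E
  else +oo%E.

(* quantum channels M_m -> M_k, given by a Kraus representation *)
Definition is_channel (R : realType) (m k : nat)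
  (E : 'M[R[i]]_m -> 'M[R[i]]_k) : Prop :=
  exists s : seq 'M[R[i]]_(k, m),
    \sum_(K <- s) dag K *m K = 1%:M /\
    forall X, E X = \sum_(K <- s) K *m X *m dag K.

(* n r read as floor(n r) *)
Definition nr (R : realType) (r : R) (n : nat) : nat := Num.truncn (n%:R * r).

Definition eps_dr (R : realType) (d1 d2 : nat) (rho1 sigma1 : 'M[R[i]]_d1)
  (rho2 sigma2 : 'M[R[i]]_d2) (r : R) (n : nat) : R :=
  inf [set x : R | exists E : 'M[R[i]]_(d1 ^ n) -> 'M[R[i]]_(d2 ^ nr r n),
         [/\ is_channel E,
             E (ntensmx sigma1 n) = ntensmx sigma2 (nr r n) &
             x = tdist (E (ntensmx rho1 n)) (ntensmx rho2 (nr r n))]].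

Definition sc_rate (R : realType) (d1 d2 : nat) (rho1 sigma1 : 'M[R[i]]_d1)
  (rho2 sigma2 : 'M[R[i]]_d2) (r : R) (n : nat) : \bar R :=
  let e := eps_dr rho1 sigma1 rho2 sigma2 r n in
  if 0 < 1 - e then (- (n%:R^-1 * log2 (1 - e)))%:E else +oo%E.

Definition sc_formula (R : realType) (d1 d2 : nat) (rho1 sigma1 : 'M[R[i]]_d1)
  (rho2 sigma2 : 'M[R[i]]_d2) (r : R) : \bar R :=
  ereal_sup [set (((beta - 1) / beta)%:E *
                   (r%:E * petz (beta^-1) rho2 sigma2 - sandwiched beta rho1 sigma1))%E
            | beta in [set beta : R | 1 <= beta]].

(* Main.v *)
(* The paper's exponent, rewritten with s = (b - 1) / b and rho2 = |psi><psi|, is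
   sup_s { - r log <psi|sigma2^s|psi> - log || sigma1^(-s/2) rho1 sigma1^(-s/2) ||_b }.
   As rho2 is pure, 1 - d(E(rho1^n), rho2^m) equals, up to a factor 2, an overlap
   <psi^m| E(rho1^n) |psi^m>.

   Everything reduces to commuting operators by pinching: a tensor power has only
   polynomially many distinct eigenvalues, so rho1^n is dominated by a polynomial times its
   pinching with respect to sigma1^n, and psi^m by a polynomial times the mixture of its
   components psi_c in the eigenspaces of sigma2^m.

   Converse: the dual channel turns psi_c into a test on the input whose sigma1^n-probability
   is the eigenvalue of psi_c; its rho1^n-probability is bounded by a Hoelder type estimate
   for the commuting pair, and summing over c produces <psi|sigma2^s|psi>^m.

   Achievability: pinch blocks of k copies, measure the blocks and prepare, when a test
   succeeds, the projection of psi^m on eigenspaces of sigma2^m with eigenvalues above the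
   sigma1^n-probability of the test.  The test and the projection are typical sets of
   exponentially tilted distributions with a common parameter b.  The minimax theorem is
   replaced by the intermediate value theorem, which provides a b for which the two sides of
   the constraint balance, or a limit b -> 1 or b -> oo in which it becomes irrelevant. *)

Require Import Defs.
From HB Require Import structures.
From mathcomp Require Import all_boot all_order all_algebra.
From mathcomp Require Import complex mxtens.
From mathcomp Require Import all_classical all_reals all_analysis.
From mathcomp Require Import ring lra.
Import Order.TTheory GRing.Theory Num.Theory.
Set Implicit Arguments.
Unset Strict Implicit.
Unset Printing Implicit Defensive.
Local Open Scope ring_scope.
Local Open Scope classical_set_scope.
Local Notation "x %:C" := (real_complex _ x) (format "x %:C") : ring_scope.

(** * Hermitian matrices and functional calculus *)

(** With [s = 1 - 1 / b], the function [bal_fun] is the derivative in [s] of the classical exponent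
    [tilt_rate]. A zero of it is the stationarity condition, which is why an intermediate value
    argument can stand in for the minimax theorem. At a point where it has a value [h], shrinking
    the test to its budget costs [max 0 h] per copy and the exponent reached is off by
    [- s * h + max 0 h]. As [h] is bounded, this tends to 0 for [b -> 1] if [h < 0] and for
    [b -> oo] if [h > 0].

    Typical sets require one distribution that does not depend on n, whereas pinching all n copies
    gives one that changes with n. So a block length [k] is fixed first, large enough for the
    penalty [d1 * ln (k + 1)] to be a small fraction of [k], and only then does the number of blocks
    grow.

    Degenerate supports are treated apart. If an outcome is possible under [rho1] and impossible
    under [sigma1], it triggers the preparation of the whole target and the exponent is 0.
    Otherwise, if [psi] is orthogonal to the support of [sigma2], the converse bound is 0 and the
    exponent is infinite. *)

Lemma dagK (R : realType) m n (A : 'M[R[i]]_(m, n)) : dag (dag A) = A.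
Proof. by apply/matrixP=> i j; rewrite !mxE conjCK. Qed.

Lemma dagE (R : realType) m n (A : 'M[R[i]]_(m, n)) i j : dag A i j = Num.conj (A j i).
Proof. by rewrite !mxE. Qed.

Lemma dagM (R : realType) m n p (A : 'M[R[i]]_(m, n)) (B : 'M[R[i]]_(n, p)) :
  dag (A *m B) = dag B *m dag A.
Proof. by rewrite /dag trmx_mul map_mxM. Qed.

Lemma dagD (R : realType) m n (A B : 'M[R[i]]_(m, n)) : dag (A + B) = dag A + dag B.
Proof. by rewrite /dag linearD map_mxD. Qed.

Lemma dagN (R : realType) m n (A : 'M[R[i]]_(m, n)) : dag (- A) = - dag A.
Proof. by rewrite /dag linearN map_mxN. Qed.

Lemma dag0 (R : realType) m n : dag (0 : 'M[R[i]]_(m, n)) = 0.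
Proof. by rewrite /dag linear0 map_mx0. Qed.

Lemma dagZ (R : realType) m n (a : R[i]) (A : 'M[R[i]]_(m, n)) :
  dag (a *: A) = Num.conj a *: dag A.
Proof. by apply/matrixP=> i j; rewrite !mxE rmorphM. Qed.

Lemma dag1 (R : realType) n : dag (1%:M : 'M[R[i]]_n) = 1%:M.
Proof. by rewrite /dag trmx1 map_mx1. Qed.

Lemma dag_sum (R : realType) m n (I : Type) (s : seq I) (P : pred I)
  (F : I -> 'M[R[i]]_(m, n)) :
  dag (\sum_(i <- s | P i) F i) = \sum_(i <- s | P i) dag (F i).
Proof. by apply: (big_morph (@dag R m n) (@dagD R m n) (@dag0 R m n)). Qed.

Lemma conjRC (R : realType) (x : R) : Num.conj (x%:C) = x%:C :> R[i].
Proof. exact: conjc_real. Qed.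

Lemma ge0_ReK (R : realType) (z : R[i]) : 0 <= z -> (complex.Re z)%:C = z.
Proof. by move=> h; rewrite RRe_real // ger0_real. Qed.

Lemma sumRC (R : realType) (I : Type) (s : seq I) (P : pred I) (F : I -> R) :
  (\sum_(i <- s | P i) F i)%:C = \sum_(i <- s | P i) (F i)%:C :> R[i].
Proof. exact: (raddf_sum (real_complex R)). Qed.

Lemma prodRC (R : realType) (I : Type) (s : seq I) (P : pred I) (F : I -> R) :
  (\prod_(i <- s | P i) F i)%:C = \prod_(i <- s | P i) (F i)%:C :> R[i].
Proof. exact: (rmorph_prod (real_complex R)). Qed.

Definition qf (R : realType) n (A : 'M[R[i]]_n) (x : 'cV[R[i]]_n) : R[i] :=
  (dag x *m A *m x) 0 0.

Lemma qfD (R : realType) n (A B : 'M[R[i]]_n) x : qf (A + B) x = qf A x + qf B x.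
Proof. by rewrite /qf mulmxDr mulmxDl mxE. Qed.

Lemma qfN (R : realType) n (A : 'M[R[i]]_n) x : qf (- A) x = - qf A x.
Proof. by rewrite /qf mulmxN mulNmx mxE. Qed.

Lemma qfZ (R : realType) n a (A : 'M[R[i]]_n) x : qf (a *: A) x = a * qf A x.
Proof. by rewrite /qf -scalemxAr -scalemxAl mxE. Qed.

Lemma qf_conj (R : realType) m n (A : 'M[R[i]]_n) (B : 'M[R[i]]_(n, m)) x :
  qf (dag B *m A *m B) x = qf A (B *m x).
Proof. by rewrite /qf dagM !mulmxA. Qed.

Lemma qf1 (R : realType) n (x : 'cV[R[i]]_n) :
  qf 1%:M x = \sum_i `|x i 0| ^+ 2.
Proof.
rewrite /qf mulmx1 mxE; apply: eq_bigr => i _.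
by rewrite dagE mulrC -normCK.
Qed.

Lemma qf1_ge0 (R : realType) n (x : 'cV[R[i]]_n) : 0 <= qf 1%:M x.
Proof. by rewrite qf1 sumr_ge0 // => i _; rewrite exprn_ge0. Qed.

Lemma qf_gram (R : realType) m n (B : 'M[R[i]]_(m, n)) x :
  qf (dag B *m B) x = qf 1%:M (B *m x).
Proof. by rewrite -qf_conj mulmx1. Qed.

Lemma psd_gram (R : realType) m n (B : 'M[R[i]]_(m, n)) : psd (dag B *m B).
Proof.
split; first by rewrite /Defs.hermitian dagM dagK.
by move=> x; rewrite -/(qf _ _) qf_gram qf1_ge0.
Qed.

Lemma psd_cogram (R : realType) m n (B : 'M[R[i]]_(m, n)) : psd (B *m dag B).
Proof. by have := psd_gram (dag B); rewrite dagK. Qed.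

Lemma psd_qf (R : realType) n (A : 'M[R[i]]_n) x : psd A -> 0 <= qf A x.
Proof. by case=> _; apply. Qed.

Lemma psdD (R : realType) n (A B : 'M[R[i]]_n) : psd A -> psd B -> psd (A + B).
Proof.
move=> [hA pA] [hB pB]; split; first by rewrite /Defs.hermitian dagD hA hB.
by move=> x; rewrite -/(qf _ _) qfD addr_ge0 //; [exact: pA|exact: pB].
Qed.

Lemma psd0 (R : realType) n : psd (0 : 'M[R[i]]_n).
Proof.
split; first exact: dag0.
by move=> x; rewrite mulmx0 mul0mx mxE.
Qed.

Lemma psd1 (R : realType) n : psd (1%:M : 'M[R[i]]_n).
Proof. by have := psd_gram (1%:M : 'M[R[i]]_n); rewrite mulmx1 dag1. Qed.

Lemma psdZ (R : realType) n (a : R) (A : 'M[R[i]]_n) :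
  0 <= a -> psd A -> psd (a%:C *: A).
Proof.
move=> a0 [hA pA]; split; first by rewrite /Defs.hermitian dagZ hA conjRC.
by move=> x; rewrite -/(qf _ _) qfZ mulr_ge0 ?ler0c//; exact: pA.
Qed.

Lemma psd_sum (R : realType) n (I : Type) (s : seq I) (P : pred I)
  (F : I -> 'M[R[i]]_n) :
  (forall i, P i -> psd (F i)) -> psd (\sum_(i <- s | P i) F i).
Proof.
move=> h; apply: (big_ind (@psd R n)) => //; first exact: psd0.
by move=> A B; exact: psdD.
Qed.

Lemma psd_conj (R : realType) m n (A : 'M[R[i]]_n) (B : 'M[R[i]]_(n, m)) :
  psd A -> psd (dag B *m A *m B).
Proof.
move=> [hA pA]; split; first by rewrite /Defs.hermitian !dagM dagK hA mulmxA.
by move=> x; rewrite -/(qf _ _) qf_conj; exact: pA.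
Qed.

Definition cdiag (R : realType) n (l : 'I_n -> R) : 'M[R[i]]_n :=
  diag_mx (\row_i (l i)%:C).

(** The columns of [dag V] are the eigenvectors. Carrying [V] along, instead of [spectralmx], lets
    several operators share a basis. *)
Definition udiag (R : realType) n (V : 'M[R[i]]_n) (l : 'I_n -> R) : 'M[R[i]]_n :=
  dag V *m cdiag l *m V.

Lemma unitaryP (R : realType) n (V : 'M[R[i]]_n) :
  V \is unitarymx -> (V *m dag V = 1%:M) * (dag V *m V = 1%:M).
Proof.
move=> /unitarymxP h; split; first exact: h.
by apply: mulmx1C; exact: h.
Qed.

Lemma cdiagM (R : realType) n (f g : 'I_n -> R) :
  cdiag f *m cdiag g = cdiag (fun i => f i * g i).
Proof.
rewrite /cdiag mulmx_diag; congr diag_mx; apply/rowP=> i.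
by rewrite !mxE -rmorphM.
Qed.

Lemma dag_cdiag (R : realType) n (f : 'I_n -> R) : dag (cdiag f) = cdiag f.
Proof.
rewrite /dag /cdiag tr_diag_mx map_diag_mx; congr diag_mx; apply/rowP=> i.
by rewrite !mxE; exact: conjRC.
Qed.

Lemma cdiag1 (R : realType) n : cdiag (fun=> 1 : R) = 1%:M :> 'M[R[i]]_n.
Proof. by apply/matrixP=> i j; rewrite !mxE. Qed.

Lemma udiagM (R : realType) n (V : 'M[R[i]]_n) (f g : 'I_n -> R) :
  V \is unitarymx -> udiag V f *m udiag V g = udiag V (fun i => f i * g i).
Proof.
move=> /unitaryP hV; rewrite /udiag !mulmxA -(mulmxA _ V) hV mulmx1.
by rewrite -(mulmxA _ (cdiag f)) cdiagM.
Qed.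

Lemma udiag1 (R : realType) n (V : 'M[R[i]]_n) :
  V \is unitarymx -> udiag V (fun=> 1) = 1%:M.
Proof. by move=> /unitaryP hV; rewrite /udiag cdiag1 mulmx1 hV. Qed.

Lemma udiagB (R : realType) n (V : 'M[R[i]]_n) (f g : 'I_n -> R) :
  udiag V (fun i => f i - g i) = udiag V f - udiag V g.
Proof.
rewrite /udiag -mulmxBl -mulmxBr; congr (_ *m _ *m _).
by apply/matrixP=> i j; rewrite !mxE rmorphB mulrnBl.
Qed.

Lemma dag_udiag (R : realType) n (V : 'M[R[i]]_n) (f : 'I_n -> R) :
  dag (udiag V f) = udiag V f.
Proof. by rewrite /udiag !dagM dagK dag_cdiag mulmxA. Qed.

Lemma eq_udiag (R : realType) n (V : 'M[R[i]]_n) (f g : 'I_n -> R) :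
  f =1 g -> udiag V f = udiag V g.
Proof. by move=> h; congr udiag; apply/funext. Qed.

Lemma psd_udiag (R : realType) n (V : 'M[R[i]]_n) (f : 'I_n -> R) :
  (forall i, 0 <= f i) -> psd (udiag V f).
Proof.
move=> f0; apply: psd_conj.
have -> : cdiag f = dag (cdiag (fun i => Num.sqrt (f i))) *m cdiag (fun i => Num.sqrt (f i)).
  rewrite dag_cdiag cdiagM; congr cdiag; apply/funext => i.
  by rewrite -expr2 sqr_sqrtr.
exact: psd_gram.
Qed.

Lemma trace_udiag (R : realType) n (V : 'M[R[i]]_n) (f : 'I_n -> R) :
  V \is unitarymx -> \tr (udiag V f) = (\sum_i f i)%:C.
Proof.
move=> /unitaryP hV; rewrite /udiag mxtrace_mulC mulmxA hV mul1mx.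
by rewrite mxtrace_diag sumRC; apply: eq_bigr => i _; rewrite mxE.
Qed.

Lemma hermitian_normal (R : realType) n (A : 'M[R[i]]_n) :
  Defs.hermitian A -> A \is normalmx.
Proof. by move=> h; apply/normalmxP; rewrite -/(dag A) h. Qed.

Lemma spectral_udiag (R : realType) n (A : 'M[R[i]]_n) : Defs.hermitian A ->
  A = udiag (spectralmx A) (fun i => complex.Re (spectral_diag A 0 i)).
Proof.
move=> hA; have /orthomx_spectralP := hermitian_normal hA.
rewrite (invmx_unitary (spectral_unitarymx A)) => {1}->.
rewrite /udiag -/(dag _); congr (_ *m _ *m _).
rewrite /cdiag; congr diag_mx; apply/rowP => i; rewrite !mxE RRe_real //.
have hs : A \is hermsymmx.
  by apply/is_hermitianmxP; rewrite expr0 scale1r; exact: (esym hA).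
by have /mxOverP := hermitian_spectral_diag_real hs; apply.
Qed.

Lemma hermitian_udiag (R : realType) n (A : 'M[R[i]]_n) :
  Defs.hermitian A -> exists V (l : 'I_n -> R), V \is unitarymx /\ A = udiag V l.
Proof.
move=> hA; exists (spectralmx A), (fun i => complex.Re (spectral_diag A 0 i)).
by split; [exact: spectral_unitarymx|exact: spectral_udiag].
Qed.

(** For a state [A], the probability of outcome [i] when measuring in the orthonormal basis formed
    by the columns of [dag V]. *)
Definition dent (R : realType) n (V A : 'M[R[i]]_n) (i : 'I_n) : R[i] :=
  (V *m A *m dag V) i i.

Lemma dentE (R : realType) n (V A : 'M[R[i]]_n) i : dent V A i = qf A (dag (row i V)).
Proof.
rewrite /dent /qf dagK -row_mul !mxE; apply: eq_bigr => j _.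
by rewrite !mxE.
Qed.

Lemma dent_udiag (R : realType) n (V : 'M[R[i]]_n) l i :
  V \is unitarymx -> dent V (udiag V l) i = (l i)%:C.
Proof.
move=> /unitaryP hV; rewrite /dent /udiag !mulmxA hV mul1mx -mulmxA hV mulmx1.
by rewrite !mxE eqxx.
Qed.

Lemma psd_udiagP (R : realType) n (A : 'M[R[i]]_n) :
  psd A -> exists V (l : 'I_n -> R),
    [/\ V \is unitarymx, forall i, 0 <= l i & A = udiag V l].
Proof.
move=> [hA pA]; have [V [l [hV eA]]] := hermitian_udiag hA.
exists V, l; split => // i; rewrite -ler0c -(dent_udiag l i hV) -eA dentE.
exact: pA.
Qed.

Lemma psd_gramP (R : realType) n (A : 'M[R[i]]_n) :
  psd A -> exists B : 'M[R[i]]_n, A = dag B *m B.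
Proof.
move=> /psd_udiagP[V [l [hV l0 ->]]].
exists (cdiag (fun i => Num.sqrt (l i)) *m V).
rewrite dagM dag_cdiag mulmxA -(mulmxA _ (cdiag _) (cdiag _)) cdiagM.
by congr (_ *m cdiag _ *m _); apply/funext => i; rewrite -expr2 sqr_sqrtr.
Qed.

(** An entry of [W] can be nonzero only where the two eigenvalues agree, and there [f] takes the
    same value on both. *)
Lemma cdiag_comm_fun (R : realType) n (D E : 'rV[R[i]]_n) (f : R[i] -> R[i])
  (W : 'M[R[i]]_n) :
  diag_mx D *m W = W *m diag_mx E ->
  diag_mx (map_mx f D) *m W = W *m diag_mx (map_mx f E).
Proof.
move=> h; apply/matrixP => i j.
have /matrixP/(_ i j) := h; rewrite !mul_diag_mx !mul_mx_diag !mxE => hij.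
have [->|W0] := eqVneq (W i j) 0; first by rewrite mulr0 mul0r.
suff -> : D 0 i = E 0 j by rewrite mulrC.
by apply: (mulIf W0); rewrite hij mulrC.
Qed.

Lemma udiag_uniq (R : realType) n (V W : 'M[R[i]]_n) (l l' : 'I_n -> R) (f : R -> R) :
  V \is unitarymx -> W \is unitarymx ->
  udiag V l = udiag W l' -> udiag V (fun i => f (l i)) = udiag W (fun i => f (l' i)).
Proof.
move=> /unitaryP hV /unitaryP hW h.
have := @cdiag_comm_fun R n (\row_i (l i)%:C) (\row_i (l' i)%:C)
  (fun z => (f (complex.Re z))%:C) (V *m dag W).
have -> : diag_mx (\row_i (l i)%:C) *m (V *m dag W) =
          V *m dag W *m diag_mx (\row_i (l' i)%:C).
  have := congr1 (fun X => V *m X *m dag W) h.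
  rewrite /udiag !mulmxA hV mul1mx -mulmxA => ->.
  by rewrite -!mulmxA hW mulmx1.
move=> /(_ erefl) e.
have -> : udiag V (fun i => f (l i)) =
  dag V *m (diag_mx (map_mx (fun z => (f (complex.Re z))%:C) (\row_i (l i)%:C))
    *m (V *m dag W)) *m W.
  rewrite !mulmxA -!(mulmxA _ (dag W)) hW mulmx1 /udiag; congr (_ *m diag_mx _ *m _).
  by apply/rowP=> i; rewrite !mxE.
rewrite e !mulmxA hV mul1mx /udiag; congr (_ *m diag_mx _ *m _).
by apply/rowP=> i; rewrite !mxE.
Qed.

(** The functional calculus does not depend on the diagonalization, so [mfun], defined through
    [spectralmx], can be computed in any eigenbasis. *)
Lemma mfun_udiag (R : realType) n (V : 'M[R[i]]_n) (l : 'I_n -> R) (f : R -> R) :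
  V \is unitarymx -> Defs.mfun f (udiag V l) = udiag V (fun i => f (l i)).
Proof.
move=> hV.
have hA : Defs.hermitian (udiag V l) by exact: dag_udiag.
set A := udiag V l in hA *.
have hP := spectral_unitarymx A.
have eA := spectral_udiag hA.
rewrite (udiag_uniq f hV hP eA) /Defs.mfun /udiag (invmx_unitary hP).
congr (_ *m _ *m _); rewrite /cdiag; congr diag_mx.
by apply/rowP => i; rewrite !mxE.
Qed.

(** * Classical tests and large deviations *)

Import numFieldNormedType.Exports.

Lemma jensen_powR (R : realType) (I : finType) (c z : I -> R) (b : R) :
  1 < b -> (forall i, 0 <= c i) -> \sum_i c i = 1 -> (forall i, 0 <= z i) ->
  (\sum_i c i * z i) `^ b <= \sum_i c i * z i `^ b.
Proof.
move=> b1 c0 c1 z0; set y := \sum_i c i * z i.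
have b0 : 0 < b by apply: lt_trans b1.
have y0 : 0 <= y by apply: sumr_ge0 => i _; rewrite mulr_ge0.
have [->|yn0] := eqVneq y 0.
  rewrite powR0 ?gt_eqF//; apply: sumr_ge0 => i _; rewrite mulr_ge0 ?powR_ge0//.
pose q := b / (b - 1).
have q0 : 0 < q by rewrite divr_gt0 // subr_gt0.
have bq : b^-1 + q^-1 = 1 by rewrite /q invf_div; field; rewrite gt_eqF.
(* Young's inequality at the mean [y] is the tangent line of the [b]-th power. *)
have young i : z i * y `^ (b - 1) <= z i `^ b / b + y `^ b / q.
  have := conjugate_powR (z0 i) (powR_ge0 y (b - 1)) b0 q0 bq.
  rewrite -[(y `^ (b - 1)) `^ q]powRrM.
  suff -> : (b - 1) * q = b by [].
  by rewrite /q mulrCA mulfV ?mulr1// subr_eq0 gt_eqF.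
have hy : y * y `^ (b - 1) = y `^ b.
  rewrite -{1}(powRr1 y0) -powRD; last by rewrite yn0 implybT.
  by congr (_ `^ _); ring.
have : y * y `^ (b - 1) <= \sum_i c i * (z i `^ b / b + y `^ b / q).
  rewrite /y mulr_suml; apply: ler_sum => i _.
  by rewrite -mulrA ler_wpM2l.
have -> : \sum_i c i * (z i `^ b / b + y `^ b / q) =
    (\sum_i c i * z i `^ b) / b + y `^ b / q.
  under eq_bigr do rewrite mulrDr.
  rewrite big_split /= -mulr_suml c1 mul1r; congr (_ + _).
  by rewrite mulr_suml; apply: eq_bigr => i _; rewrite mulrA.
rewrite hy => h.
have eq1 : y `^ b = y `^ b / b + y `^ b / q by rewrite -mulrDr bq mulr1.
move: h; rewrite {1}eq1 lerD2r ler_pM2r ?invr_gt0//.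
Qed.

(** Majorization: Jensen on each row, then summation of the columns. As [w] is only bounded by the
    averages, the lemma serves to compare spectra with pinched diagonals in both directions. *)
Lemma doubly_stochastic_powR (R : realType) (I J : finType) (B : I -> J -> R)
  (w : I -> R) (z : J -> R) (b : R) : 1 < b ->
  (forall i j, 0 <= B i j) -> (forall i, \sum_j B i j = 1) ->
  (forall j, \sum_i B i j = 1) -> (forall i, 0 <= w i) -> (forall j, 0 <= z j) ->
  (forall i, w i <= \sum_j B i j * z j) ->
  \sum_i w i `^ b <= \sum_j z j `^ b.
Proof.
move=> b1 B0 B1 B2 w0 z0 hw.
apply: (@le_trans _ _ (\sum_i \sum_j B i j * z j `^ b)).
  apply: ler_sum => i _; apply: le_trans (jensen_powR b1 (B0 i) (B1 i) z0).
  rewrite ge0_ler_powR ?nnegrE ?hw//; first by lra.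
  by apply: sumr_ge0 => j _; rewrite mulr_ge0.
rewrite exchange_big /=; apply: ler_sum => j _.
by rewrite -mulr_suml B2 mul1r.
Qed.

Lemma powRD_gt0 (R : realType) (x r s : R) : 0 < x ->
  x `^ (r + s) = x `^ r * x `^ s.
Proof. by move=> x0; rewrite powRD //; apply/implyP => _; rewrite gt_eqF. Qed.

(** Neyman-Pearson splitting at likelihood ratio [t]. Where [p i <= t * q i] the first term
    suffices; elsewhere [m i <= 1] and the (b - 1)-th power of [p i / (t * q i)] is at least 1. *)
Lemma test_threshold (R : realType) (I : finType) (p q m : I -> R) (b t : R) :
  1 < b -> 0 < t -> (forall i, 0 <= p i) -> (forall i, 0 <= q i) ->
  (forall i, 0 <= m i <= 1) -> (forall i, q i = 0 -> p i = 0) ->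
  \sum_i p i * m i <= t * (\sum_i q i * m i)
    + t `^ (1 - b) * \sum_i p i `^ b * q i `^ (1 - b).
Proof.
move=> b1 t0 p0 q0 m01 pq; rewrite !mulr_sumr -big_split /=.
apply: ler_sum => i _; have /andP[m0 m1] := m01 i.
have [h|h] := leP (p i) (t * q i).
  rewrite mulrA -[X in X <= _]addr0 lerD ?ler_wpM2r//.
  by rewrite !mulr_ge0 ?powR_ge0.
have [qi0|qi0] := eqVneq (q i) 0.
  by rewrite pq// qi0 !(mul0r,mulr0) powR0 ?mul0r ?mulr0 ?addr0//; lra.
have qi : 0 < q i by rewrite lt_neqAle eq_sym qi0 q0.
have pi : 0 < p i by apply: le_lt_trans h; rewrite mulr_ge0// ltW.
apply: (@le_trans _ _ (p i)); first by rewrite ler_piMr.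
apply: (@le_trans _ _ (t `^ (1 - b) * (p i `^ b * q i `^ (1 - b)))); last first.
  by rewrite lerDr !mulr_ge0// ltW.
rewrite mulrCA -powRM ?(ltW t0)// ?(ltW qi)//.
rewrite -ler_pdivrMl ?powR_gt0// -powRN.
rewrite -{2}(powRr1 (ltW pi)) -(powRD_gt0 _ _ pi).
have -> : - b + 1 = - (b - 1) by ring.
have -> : 1 - b = - (b - 1) by ring.
rewrite !powRN lef_pV2 ?posrE ?powR_gt0// ?mulr_gt0//.
apply: ge0_ler_powR; rewrite ?nnegrE ?(ltW h) ?(ltW pi)//; first by lra.
by rewrite mulr_ge0// ltW.
Qed.

(** The threshold t with t^b = Q / A makes the two terms of [test_threshold] equal, whence the
    factor 2, invisible in the exponent. For [A = 0] or [Q = 0] no positive threshold of this kind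
    exists, but then every summand on the left vanishes. *)
Lemma test_bound (R : realType) (I : finType) (p q m : I -> R) (b : R) :
  1 < b -> (forall i, 0 <= p i) -> (forall i, 0 <= q i) ->
  (forall i, 0 <= m i <= 1) -> (forall i, q i = 0 -> p i = 0) ->
  \sum_i p i * m i <= 2 * ((\sum_i p i `^ b * q i `^ (1 - b)) `^ (b^-1)
     * (\sum_i q i * m i) `^ (1 - b^-1)).
Proof.
move=> b1 p0 q0 m01 pq.
set Q := \sum_i p i `^ b * _; set A := \sum_i q i * m i.
have m0 i : 0 <= m i by case/andP: (m01 i).
have Q0 : 0 <= Q by apply: sumr_ge0 => i _; rewrite mulr_ge0 ?powR_ge0.
have A0 : 0 <= A by apply: sumr_ge0 => i _; rewrite mulr_ge0.
have rhs0 : 0 <= 2 * (Q `^ b^-1 * A `^ (1 - b^-1)).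
  by rewrite !mulr_ge0 ?powR_ge0.
have b0 : 0 < b by apply: lt_trans b1.
have [Ae|An] := eqVneq A 0.
  rewrite big1// => i _.
  have : q i * m i == 0.
    by move: Ae => /eqP; rewrite psumr_eq0 => [/allP/(_ i)|j _]; [apply; rewrite mem_index_enum|rewrite mulr_ge0].
  by rewrite mulf_eq0 => /orP[/eqP/pq ->|/eqP->]; rewrite ?mul0r ?mulr0.
have [Qe|Qn] := eqVneq Q 0.
  rewrite big1// => i _.
  have : p i `^ b * q i `^ (1 - b) == 0.
    by move: Qe => /eqP; rewrite psumr_eq0 => [/allP/(_ i)|j _]; [apply; rewrite mem_index_enum|rewrite mulr_ge0 ?powR_ge0].
  rewrite mulf_eq0 !powR_eq0 => /orP[/andP[/eqP -> _]|/andP[/eqP/pq -> _]]; by rewrite mul0r.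
have Ap : 0 < A by rewrite lt_neqAle eq_sym An.
have Qp : 0 < Q by rewrite lt_neqAle eq_sym Qn.
have t0 : 0 < (Q / A) `^ b^-1 by rewrite powR_gt0 // divr_gt0.
apply: le_trans (test_threshold b1 t0 p0 q0 m01 pq) _.
rewrite -/A -/Q mulrDl mul1r le_eqVlt; apply/orP; left; apply/eqP.
have e1 : (Q / A) `^ b^-1 = Q `^ b^-1 * (A `^ b^-1)^-1.
  by rewrite powRM ?invr_ge0// -(powR_inv1 A0) -powRrM mulN1r powRN.
have e2 : A `^ (1 - b^-1) = A / A `^ b^-1.
  by rewrite (powRD_gt0 _ _ Ap) powRN powRr1.
have e3 : (Q / A) `^ b^-1 `^ (1 - b) = (Q / A) `^ b^-1 * (A / Q).
  rewrite -powRrM mulrBr mulr1 mulVf ?gt_eqF// powRD_gt0 ?divr_gt0//.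
  by rewrite powRN powRr1 ?divr_ge0// invf_div.
by rewrite e3 e1 e2; field; rewrite ?An ?Qn ?gt_eqF// powR_gt0.
Qed.

(** From [1 - x <= expR (- x)] comes [expR x <= 1 / (1 - x)]. The constants make the remaining
    difference factor as [x ^+ 2 * (1 - 2 * x)]. *)
Lemma expR_le_quad (R : realType) (x : R) : x <= 2^-1 ->
  expR x <= 1 + x + 2 * x ^+ 2.
Proof.
move=> hx; have h := expR_ge1Dx (- x).
have h1 : 0 < 1 - x by lra.
rewrite -[x in expR x]opprK expRN.
apply: (@le_trans _ _ (1 - x)^-1).
  by rewrite lef_pV2 ?posrE// expR_gt0.
rewrite -[X in X <= _]mul1r ler_pdivrMr//.
rewrite -subr_ge0.
have -> : (1 + x + 2 * x ^+ 2) * (1 - x) - 1 = x ^+ 2 * (1 - 2 * x) by ring.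
by rewrite mulr_ge0 ?sqr_ge0//; lra.
Qed.

Lemma sum_prod_ffun (R : comPzRingType) (X : finType) (f : X -> R) N :
  \sum_(x : {ffun 'I_N -> X}) \prod_k f (x k) = (\sum_x f x) ^+ N.
Proof.
rewrite -(bigA_distr_bigA (fun (_ : 'I_N) (y : X) => f y)).
by rewrite prodr_const card_ord.
Qed.

(** Exponential Markov inequality. As [f] is centred, its moment generating function at a small [th]
    is at most [expR (th * eta / 2)], so half of the exponent [th * eta] is left as decay. With 1/4
    per tail, two tails leave mass at least 1/2. *)
Lemma chernoff_tail (R : realType) (X : finType) (t f : X -> R) (eta : R) :
  (forall x, 0 <= t x) -> \sum_x t x = 1 -> \sum_x t x * f x = 0 -> 0 < eta ->
  \forall N \near \oo,
    \sum_(x : {ffun 'I_N -> X} | N%:R * eta < \sum_k f (x k)) \prod_k t (x k) <= 4^-1.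
Proof.
move=> t0 t1 tf eta0.
have [K [K1 fK]] : exists K : R, 1 <= K /\ forall x, `|f x| <= K.
  exists (1 + \sum_x `|f x|); split=> [|x]; first by rewrite lerDl sumr_ge0.
  by rewrite (bigD1 x)//= addrCA lerDl addr_ge0// sumr_ge0.
(* The first bound keeps [th * f x] in the range of [expR_le_quad], the second makes the quadratic
   term at most [th * eta / 2]. *)
pose th := Num.min (2 * K)^-1 (eta / (4 * K ^+ 2)).
have K0 : 0 < K by lra.
have th0 : 0 < th by rewrite lt_min invr_gt0 !mulr_gt0//= ?invr_gt0 ?mulr_gt0 ?exprn_gt0.
have thK : th * K <= 2^-1.
  have : th <= (2 * K)^-1 by rewrite ge_min lexx.
  have -> : 2^-1 = (2 * K)^-1 * K by field; rewrite gt_eqF.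
  by rewrite ler_pM2r.
have thK2 : 2 * th * K ^+ 2 <= eta / 2.
  have : th <= eta / (4 * K ^+ 2) by rewrite ge_min lexx orbT.
  rewrite ler_pdivlMr; last by rewrite mulr_gt0 ?exprn_gt0.
  by nra.
have mgf : \sum_x t x * expR (th * f x) <= expR (th * eta / 2).
  apply: (@le_trans _ _ (\sum_x t x * (1 + th * f x + 2 * (th * K) ^+ 2))).
    apply: ler_sum => x _; rewrite ler_wpM2l//.
    have hf := fK x; have : `|th * f x| <= th * K by rewrite normrM gtr0_norm// ler_pM2l.
    move=> hthf; apply: le_trans (expR_le_quad _) _.
      by apply: le_trans (ler_norm _) _; exact: le_trans hthf thK.
    rewrite lerD2l ler_pM2l// -real_normK ?num_real//.
    by rewrite lerXn2r ?nnegrE// mulr_ge0// ltW.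
  under eq_bigr do rewrite !mulrDr mulr1 mulrCA.
  rewrite !big_split /= t1 -mulr_sumr tf mulr0 addr0 -mulr_suml t1 mul1r.
  apply: le_trans (expR_ge1Dx _).
  rewrite lerD2l.
  have -> : (2 * (th * K) ^+ 2) = th * (2 * th * K ^+ 2) by ring.
  have -> : th * eta / 2 = th * (eta / 2) by ring.
  by rewrite ler_pM2l.
have tail N : \sum_(x : {ffun 'I_N -> X} | N%:R * eta < \sum_k f (x k)) \prod_k t (x k)
    <= expR (- (N%:R * (th * eta / 2))).
  apply: (@le_trans _ _ (\sum_(x : {ffun 'I_N -> X})
      (\prod_k (t (x k) * expR (th * f (x k)))) * expR (- (N%:R * (th * eta))))).
    rewrite big_mkcond /=; apply: ler_sum => x _.
    have P0 : 0 <= \prod_k t (x k) by apply: prodr_ge0.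
    have e : \prod_k (t (x k) * expR (th * f (x k))) * expR (- (N%:R * (th * eta)))
        = \prod_k t (x k) * expR (th * (\sum_k f (x k) - N%:R * eta)).
      rewrite big_split /= -expR_sum -mulr_sumr -mulrA -expRD; congr (_ * expR _); ring.
    rewrite e; case: ifPn => h; last by rewrite mulr_ge0 ?expR_ge0.
    rewrite ler_peMr//; apply: le_trans (expR_ge1Dx _); rewrite lerDl.
    by rewrite mulr_ge0 ?(ltW th0)// subr_ge0 ltW.
  rewrite -mulr_suml (sum_prod_ffun (fun y => t y * expR (th * f y))).
  apply: (@le_trans _ _ (expR (th * eta / 2) ^+ N * expR (- (N%:R * (th * eta))))).
    rewrite ler_wpM2r ?expR_ge0// lerXn2r ?nnegrE ?expR_ge0//.
    by apply: sumr_ge0 => x _; rewrite mulr_ge0 ?expR_ge0.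
  by rewrite -expRM_natl -expRD ler_expR; lra.
pose c := th * eta / 2.
have c0 : 0 < c by rewrite !mulr_gt0.
exists (Num.truncn (4 / c)).+1 => // N /= hN.
apply: le_trans (tail N) _; rewrite -/c expRN lef_pV2 ?posrE ?expR_gt0//.
apply: le_trans (expR_ge1Dx _).
have : 4 / c < N%:R.
  apply: lt_le_trans (truncnS_gt _) _; by rewrite ler_nat.
by rewrite ltr_pdivrMr//; lra.
Qed.

(** * Exponential tilting and typical sequences *)

Definition tilted_mean (R : realType) (X : finType) (z f : X -> R) : R :=
  (\sum_x z x * f x) / \sum_x z x.

(** After division by the total weight, the upper and the lower tail around the mean have mass at
    most 1/4 each, so typical sequences keep half of the total. *)
Lemma tilted_typical (R : realType) (X : finType) (z f : X -> R) (eta : R) :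
  (forall x, 0 <= z x) -> 0 < \sum_x z x -> 0 < eta ->
  \forall N \near \oo,
    2^-1 * (\sum_x z x) ^+ N <=
    \sum_(x : {ffun 'I_N -> X} |
       `|\sum_k f (x k) - N%:R * tilted_mean z f| <= N%:R * eta) \prod_k z (x k).
Proof.
move=> z0; set Z := \sum_x z x => Z0 eta0; set mu := tilted_mean z f.
pose t x := z x / Z.
have t0 x : 0 <= t x by rewrite divr_ge0// ltW.
have t1 : \sum_x t x = 1 by rewrite -mulr_suml divff// gt_eqF.
have tf : \sum_x t x * (f x - mu) = 0.
  under eq_bigr do rewrite mulrBr.
  rewrite big_split /= sumrN -mulr_suml t1 mul1r /mu /tilted_mean mulr_suml.
  by apply/eqP; rewrite subr_eq0; apply/eqP; apply: eq_bigr => x _; rewrite mulrAC.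
have tf' : \sum_x t x * (mu - f x) = 0.
  transitivity (- \sum_x t x * (f x - mu)); last by rewrite tf oppr0.
  by rewrite -[RHS]sumrN; apply: eq_bigr => x _; ring.
have h1 := chernoff_tail t0 t1 tf eta0.
have h2 := chernoff_tail t0 t1 tf' eta0.
move: h1 h2; apply: filterS2 => N h1 h2.
have e1 (x : {ffun 'I_N -> X}) : \sum_k (f (x k) - mu) = \sum_k f (x k) - N%:R * mu.
  by rewrite big_split /= sumrN sumr_const card_ord mulr_natl.
have e2 (x : {ffun 'I_N -> X}) : \sum_k (mu - f (x k)) = - (\sum_k f (x k) - N%:R * mu).
  by rewrite -e1 -sumrN; apply: eq_bigr => k _; ring.
have tz (x : {ffun 'I_N -> X}) : \prod_k z (x k) = \prod_k t (x k) * Z ^+ N.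
  rewrite /t big_split /= prodr_const card_ord -mulrA -exprMn mulVf ?expr1n ?mulr1//.
  by rewrite gt_eqF.
under eq_bigr do rewrite tz.
rewrite -mulr_suml ler_pM2r ?exprn_gt0//.
have tot : \sum_(x : {ffun 'I_N -> X}) \prod_k t (x k) = 1.
  by rewrite (sum_prod_ffun t) t1 expr1n.
rewrite (bigID (fun x : {ffun 'I_N -> X} =>
   `|\sum_k f (x k) - N%:R * mu| <= N%:R * eta)) /= in tot.
have : \sum_(x : {ffun 'I_N -> X} | ~~ (`|\sum_k f (x k) - N%:R * mu| <= N%:R * eta))
    \prod_k t (x k) <= 4^-1 + 4^-1.
  apply: le_trans (lerD h1 h2).
  rewrite [X in _ <= X + _]big_mkcond [X in _ <= _ + X]big_mkcond -big_split /=.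
  rewrite big_mkcond; apply: ler_sum => x _.
  have P0 : 0 <= \prod_k t (x k) by apply: prodr_ge0.
  rewrite e1 e2 -ltNge; case: ifPn => h; last by case: ifP => _; case: ifP => _; lra.
  move: h; rewrite ltr_normr => /orP[] ->; rewrite ?lerDl ?lerDr; by case: ifP.
by lra.
Qed.

(** Applied with [h] equal to [bal_fun]. The left-hand side of the conclusion is the exponent lost
    at [b]: [- (1 - b^-1) * h b] for not being at a stationary point, [max 0 (h b)] for shrinking
    the test to its budget. *)
Lemma exponent_balance (R : realType) (h : R -> R) (K delta : R) :
  0 < delta -> 0 < K ->
  (forall b, 1 < b -> {for b, continuous h}) ->
  (forall b, 1 < b <= 2 -> - K <= h b) -> (forall b, 1 < b -> h b <= K) ->
  exists2 b, 1 < b & - (1 - b^-1) * h b + Num.max 0 (h b) <= delta.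
Proof.
move=> d0 K0 ch hlo hhi.
(* Without a zero, [h] has constant sign, and [b] near 1 or [b] large will do. *)
have [[b b1 hb]|no0] := pselect (exists2 b, 1 < b & h b = 0).
  by exists b => //; rewrite hb mulr0 add0r maxxx ltW.
(* If [h b0 < 0], the loss is [1 - b0^-1] times the modulus of [h b0], hence at most [(b0 - 1) * K];
   this [b0] brings it below [delta]. *)
pose b0 := Num.min 2 (1 + delta / K).
have b01 : 1 < b0 by rewrite lt_min; apply/andP; split; [lra|rewrite ltrDl divr_gt0].
have b02 : b0 <= 2 by rewrite ge_min lexx.
have b0K : (b0 - 1) * K <= delta.
  by rewrite -ler_pdivlMr// lerBlDl ge_min lexx orbT.
clearbody b0.
have [hb0|hb0|hb0] := ltgtP (h b0) 0; last 1 first.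
- by exfalso; apply: no0; exists b0.
- exists b0 => //; rewrite (max_l (ltW hb0)) addr0.
  have := hlo b0; rewrite b01 b02 => /(_ isT) h1.
  have s0 : 0 < b0^-1 by rewrite invr_gt0; lra.
  have s1 : b0^-1 * b0 = 1 by rewrite mulVf// gt_eqF//; lra.
  have s2 : 1 - b0^-1 <= b0 - 1 by nra.
  have s3 : 0 <= 1 - b0^-1 by rewrite subr_ge0 invf_le1//; lra.
  apply: (@le_trans _ _ ((b0 - 1) * K)); last exact: b0K.
  nra.
(* If [h b1 > 0], the loss collapses to [h b1 / b1], at most [K / b1]; this [b1] brings it below
   [delta]. *)
pose b1 := b0 + K / delta.
have b10 : b0 <= b1 by rewrite lerDl divr_ge0// ltW.
have b11 : 1 < b1 by lra.
have e1 : delta * b1 = delta * b0 + K by rewrite /b1 mulrDr mulrCA mulfV ?mulr1// gt_eqF.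
clearbody b1.
have [hb1|hb1] := leP (h b1) 0.
  have hw : {within `[b0, b1], continuous h}.
    apply: continuous_in_subspaceT => x; rewrite inE /= => /itvP xin.
    by apply: ch; apply: lt_le_trans b01 _; rewrite xin.
  have hm : Num.min (h b0) (h b1) <= 0 <= Num.max (h b0) (h b1).
    by rewrite ge_min hb1 orbT le_max (ltW hb0).
  have [c /itvP cin hc] := IVT b10 hw hm.
  exfalso; apply: no0; exists c => //.
  by apply: lt_le_trans b01 _; rewrite cin.
exists b1 => //; rewrite (max_r (ltW hb1)).
have -> : - (1 - b1^-1) * h b1 + h b1 = h b1 / b1.
  by rewrite mulrC; ring.
have b1p : 0 < b1 by lra.
rewrite ler_pdivrMr//; apply: le_trans (hhi _ b11) _.
rewrite e1 lerDr mulr_ge0//; lra.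
Qed.

Lemma tilted_mean_le (R : realType) (X : finType) (z f : X -> R) (K : R) :
  (forall x, 0 <= z x) -> 0 < \sum_x z x -> (forall x, 0 < z x -> f x <= K) ->
  tilted_mean z f <= K.
Proof.
move=> z0 Z0 hf; rewrite ler_pdivrMr// mulr_sumr; apply: ler_sum => x _.
rewrite [leRHS]mulrC; have := z0 x; rewrite le_eqVlt => /orP[/eqP <-|zx].
  by rewrite !mul0r.
by rewrite ler_wpM2l// hf.
Qed.

Lemma tilted_mean_affine (R : realType) (X : finType) (z f : X -> R) (b c : R) :
  0 < \sum_x z x -> tilted_mean z (fun x => b * f x + c) = b * tilted_mean z f + c.
Proof.
move=> Z0; rewrite /tilted_mean.
under eq_bigr do rewrite mulrDr mulrCA.
rewrite big_split /= -mulr_sumr -mulr_suml mulrDl mulrA; congr (_ + _).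
by rewrite mulrAC divff ?mul1r// gt_eqF.
Qed.

(** The weight p^b q^(1-b), written with [expR] and [ln] to be visibly continuous in [b]; the guard
    removes the points where [ln (p x)] is a default value. *)
Definition tilt_in (R : realType) (X : finType) (p q : X -> R) (b : R) (x : X) : R :=
  if 0 < p x then expR (b * ln (p x) + (1 - b) * ln (q x)) else 0.

Definition tilt_out (R : realType) (J : finType) (a l : J -> R) (s : R) (j : J) : R :=
  if 0 < a j * l j then a j * expR (s * ln (l j)) else 0.

(** The log-likelihood ratio, which is also the derivative in [b] of the logarithm of [tilt_in]. *)
Definition llr (R : realType) (X : finType) (p q : X -> R) (x : X) : R :=
  ln (p x) - ln (q x).

Lemma tilt_in_ge0 (R : realType) (X : finType) (p q : X -> R) b x :
  0 <= tilt_in p q b x.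
Proof. by rewrite /tilt_in; case: ifP => // _; exact: expR_ge0. Qed.

Lemma tilt_out_ge0 (R : realType) (J : finType) (a l : J -> R) s j :
  0 <= a j -> 0 <= tilt_out a l s j.
Proof. by move=> a0; rewrite /tilt_out; case: ifP => // _; rewrite mulr_ge0 ?expR_ge0. Qed.

Lemma tilt_in_sum_gt0 (R : realType) (X : finType) (p q : X -> R) b :
  (exists x, 0 < p x) -> 0 < \sum_x tilt_in p q b x.
Proof.
case=> x px; rewrite (bigD1 x)//= ltr_wpDr ?sumr_ge0//.
  by move=> y _; exact: tilt_in_ge0.
by rewrite /tilt_in px expR_gt0.
Qed.

Lemma tilt_out_sum_gt0 (R : realType) (J : finType) (a l : J -> R) s :
  (forall j, 0 <= a j) -> (forall j, 0 <= l j) ->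
  (exists j, 0 < a j * l j) -> 0 < \sum_j tilt_out a l s j.
Proof.
move=> a0 l0 [j aj]; rewrite (bigD1 j)//= ltr_wpDr ?sumr_ge0//.
  by move=> y _; exact: tilt_out_ge0.
rewrite /tilt_out aj mulr_gt0 ?expR_gt0//.
by rewrite lt_neqAle a0 andbT; apply/eqP => h; move: aj; rewrite -h mul0r ltxx.
Qed.

Lemma sum_continuous (R : realType) (I : finType) (F : I -> R -> R) :
  (forall i, continuous (F i)) -> continuous (fun b : R => \sum_i F i b).
Proof.
move=> h; apply: continuous_big => //.
exact: add_continuous.
Qed.

Lemma tilt_in_continuous (R : realType) (X : finType) (p q : X -> R) x :
  continuous (fun b : R => tilt_in p q b x).
Proof.
rewrite /tilt_in; case: (0 < p x); last exact: cst_continuous.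
move=> b; apply: (@continuous_comp _ _ _ (fun b : R => b * ln (p x) + (1 - b) * ln (q x)) expR).
  apply: cvgD; apply: cvgM; [apply: cvg_id|apply: cvg_cst| |apply: cvg_cst].
  by apply: cvgB; [apply: cvg_cst|apply: cvg_id].
exact: continuous_expR.
Qed.

Lemma tilt_out_continuous (R : realType) (J : finType) (a l : J -> R) j :
  continuous (fun s : R => tilt_out a l s j).
Proof.
rewrite /tilt_out; case: (0 < a j * l j); last exact: cst_continuous.
move=> s; apply: cvgM; first apply: cvg_cst.
apply: (@continuous_comp _ _ _ (fun s : R => s * ln (l j)) expR).
  by apply: cvgM; [apply: cvg_id|apply: cvg_cst].
exact: continuous_expR.
Qed.

Lemma tilted_mean_continuous (R : realType) (X : finType) (z : R -> X -> R) (f : X -> R) :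
  (forall x, continuous (z ^~ x)) -> (forall b, 0 < \sum_x z b x) ->
  continuous (fun b : R => tilted_mean (z b) f).
Proof.
move=> cz z0 b; rewrite /tilted_mean; apply: cvgM.
  apply: (@sum_continuous R X (fun x b => z b x * f x)) => x c.
  by apply: cvgM; [exact: cz|apply: cvg_cst].
apply: cvgV; first by rewrite gt_eqF.
exact: (@sum_continuous R X (fun x b => z b x)).
Qed.

(* [bal_fun p q a l r b] compares the two sides of the constraint "probability of the
   test under [q] is at most the eigenvalue [l]" for the tilted distributions at [b]. *)
Definition bal_fun (R : realType) (X J : finType) (p q : X -> R) (a l : J -> R)
  (r b : R) : R :=
  - (r * tilted_mean (tilt_out a l (1 - b^-1)) (fun j => ln (l j)))
  - (b * tilted_mean (tilt_in p q b) (llr p q) - ln (\sum_x tilt_in p q b x)).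

Lemma bal_fun_continuous (R : realType) (X J : finType) (p q : X -> R) (a l : J -> R)
  (r b : R) : (exists x, 0 < p x) -> (forall j, 0 <= a j) -> (forall j, 0 <= l j) ->
  (exists j, 0 < a j * l j) -> 1 < b ->
  {for b, continuous (bal_fun p q a l r)}.
Proof.
move=> px a0 l0 aj b1.
have Zc := @sum_continuous R X (fun x b => tilt_in p q b x)
  (fun x => @tilt_in_continuous R X p q x).
have Mc := @tilted_mean_continuous R X (tilt_in p q) (llr p q)
  (fun x => @tilt_in_continuous R X p q x) (fun b => tilt_in_sum_gt0 q b px).
have Lc := @tilted_mean_continuous R J (tilt_out a l) (fun j => ln (l j))
  (fun j => @tilt_out_continuous R J a l j) (fun s => tilt_out_sum_gt0 s a0 l0 aj).
apply: cvgB.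
  apply: cvgN; apply: cvgM; first apply: cvg_cst.
  apply: (@continuous_comp _ _ _ (fun b : R => 1 - b^-1) (fun s =>
    tilted_mean (tilt_out a l s) (fun j => ln (l j)))); last exact: Lc.
  apply: cvgB; first apply: cvg_cst.
  apply: cvgV; last apply: cvg_id.
  by rewrite gt_eqF//; apply: lt_trans b1.
apply: cvgB; first by apply: cvgM; [apply: cvg_id|exact: Mc].
apply: (@continuous_comp _ _ _ (fun b => \sum_x tilt_in p q b x) (@ln R)); first exact: Zc.
by apply: continuous_ln; exact: tilt_in_sum_gt0.
Qed.

(** The quantity in the middle is the relative entropy of the normalized tilted distribution with
    respect to [q]. It is at most [K] because a normalized weight has nonpositive logarithm and
    [- ln (q x) <= K] on the support. *)
Lemma tilted_divergence_bounds (R : realType) (X : finType) (p q : X -> R) (K b : R) :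
  (exists x, 0 < p x) -> (forall x, 0 <= q x) -> \sum_x q x <= 1 ->
  (forall x, 0 < p x -> 0 < q x) -> (forall x, 0 < p x -> - ln (q x) <= K) ->
  0 <= b * tilted_mean (tilt_in p q b) (llr p q) - ln (\sum_x tilt_in p q b x) <= K.
Proof.
move=> px q0 q1 pq hK.
have Z0 := tilt_in_sum_gt0 q b px.
have z0 x := tilt_in_ge0 p q b x.
set Z := \sum_x _ in Z0 *.
rewrite -(tilted_mean_affine (llr p q) b (- ln Z) Z0).
have zp x : 0 < tilt_in p q b x -> 0 < p x.
  by rewrite /tilt_in; case: ifP => //; rewrite ltxx.
apply/andP; split; last first.
  apply: tilted_mean_le => // x /zp px0.
  have zZ : tilt_in p q b x <= Z by rewrite /Z (bigD1 x)//= lerDl sumr_ge0.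
  have : ln (tilt_in p q b x) <= ln Z.
    by rewrite ler_ln// posrE /tilt_in px0 expR_gt0.
  rewrite {1}/tilt_in px0 expRK /llr => h.
  by have := hK x px0; lra.
(* Nonnegativity of a relative entropy, from 1 - exp (- y) <= y. *)
apply: (@le_trans _ _ (tilted_mean (tilt_in p q b)
   (fun x => 1 - expR (- (b * llr p q x - ln Z))))); last first.
  rewrite /tilted_mean ler_pM2r ?invr_gt0//; apply: ler_sum => x _.
  rewrite ler_wpM2l//; have := expR_ge1Dx (- (b * llr p q x - ln Z)); lra.
rewrite /tilted_mean divr_ge0 ?(ltW Z0)//.
under eq_bigr do rewrite mulrBr mulr1.
rewrite big_split /= sumrN subr_ge0 -/Z.
apply: (@le_trans _ _ (\sum_x Z * q x)); last by rewrite -mulr_sumr ler_piMr// ltW.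
apply: ler_sum => x _; rewrite {1}/tilt_in; case: ifP => [px0|_]; last first.
  by rewrite mul0r mulr_ge0// ltW.
rewrite -expRD -[X in _ <= X * _]lnK ?posrE// -[X in _ <= _ * X]lnK ?posrE ?pq//.
by rewrite -expRD ler_expR /llr; lra.
Qed.

(** Change of measure: both likelihoods are the tilted weight times an exponential that sees the
    sequence only through its total log-likelihood ratio. *)
Lemma prod_tilt_in (R : realType) (X : finType) (p q : X -> R) (b : R) N
  (x : {ffun 'I_N -> X}) : (forall k, 0 < p (x k)) -> (forall k, 0 < q (x k)) ->
  \prod_k p (x k) =
    \prod_k tilt_in p q b (x k) * expR (- ((b - 1) * \sum_k llr p q (x k))) /\
  \prod_k q (x k) =
    \prod_k tilt_in p q b (x k) * expR (- (b * \sum_k llr p q (x k))).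
Proof.
move=> px qx; rewrite !mulr_sumr -!sumrN !expR_sum -!big_split /=.
split; apply: eq_bigr => k _; rewrite /tilt_in px -expRD.
  rewrite -{1}(@lnK _ (p (x k))) ?posrE//; congr expR; rewrite /llr; ring.
rewrite -{1}(@lnK _ (q (x k))) ?posrE//; congr expR; rewrite /llr; ring.
Qed.

Lemma prod_tilt_out (R : realType) (J : finType) (a l : J -> R) (s : R) m
  (y : {ffun 'I_m -> J}) : (forall k, 0 < a (y k) * l (y k)) ->
  \prod_k a (y k) =
    \prod_k tilt_out a l s (y k) * expR (- (s * \sum_k ln (l (y k)))).
Proof.
move=> h; rewrite !mulr_sumr -!sumrN !expR_sum -!big_split /=.
apply: eq_bigr => k _; rewrite /tilt_out h -mulrA -expRD subrr expR0 mulr1//.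
Qed.

Lemma prod_tilt_eq0 (R : realType) (X : finType) (z : X -> R) (P : pred X) N
  (x : {ffun 'I_N -> X}) : (forall y, ~~ P y -> z y = 0) ->
  ~~ [forall k, P (x k)] -> \prod_k z (x k) = 0.
Proof. by move=> h; rewrite negb_forall => /existsP[k /h hk]; rewrite (bigD1 k)//= hk mul0r. Qed.

(** [B] consists of the sequences in the support of [p] whose total log-likelihood ratio is near
    [N * mu]. There [prod_tilt_in] fixes the exponential factors up to [eta]; the whole tilted mass
    bounds the [q]-probability, and half of it, by [tilted_typical], the [p]-probability. *)
Lemma typical_test (R : realType) (X : finType) (p q : X -> R) (b eta : R) :
  1 < b -> (exists x, 0 < p x) -> (forall x, 0 <= p x) -> (forall x, 0 <= q x) ->
  (forall x, 0 < p x -> 0 < q x) -> 0 < eta ->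
  let Z := \sum_x tilt_in p q b x in
  let mu := tilted_mean (tilt_in p q b) (llr p q) in
  \forall N \near \oo, exists B : pred {ffun 'I_N -> X},
    \sum_(x | B x) \prod_k q (x k) <= expR (N%:R * ln Z - b * (N%:R * (mu - eta))) /\
    2^-1 * expR (N%:R * ln Z - (b - 1) * (N%:R * (mu + eta)))
      <= \sum_(x | B x) \prod_k p (x k).
Proof.
move=> b1 px p0 q0 pq eta0 Z mu.
have Z0 : 0 < Z by exact: tilt_in_sum_gt0.
have z0 x := tilt_in_ge0 p q b x.
have ZN N : Z ^+ N = expR (N%:R * ln Z).
  by rewrite expRM_natl lnK ?posrE.
have := tilted_typical (llr p q) z0 Z0 eta0.
apply: filterS => N hN.
exists (fun x => [forall k, 0 < p (x k)] &&
   (`|\sum_k llr p q (x k) - N%:R * mu| <= N%:R * eta)); split.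
  apply: (@le_trans _ _ (\sum_(x : {ffun 'I_N -> X}) \prod_k tilt_in p q b (x k)
     * expR (- (b * (N%:R * (mu - eta)))))); last first.
    by rewrite -mulr_suml (sum_prod_ffun (tilt_in p q b)) ZN -expRD.
  rewrite big_mkcond /=; apply: ler_sum => x _.
  have P0 : 0 <= \prod_k tilt_in p q b (x k) by apply: prodr_ge0 => k _.
  case: ifPn => [/andP[/forallP hx hs]|_]; last by rewrite mulr_ge0 ?expR_ge0.
  have [_ ->] := prod_tilt_in b hx (fun k => pq _ (hx k)).
  rewrite ler_wpM2l// ler_expR lerN2 ler_pM2l; last by lra.
  by move: hs; rewrite ler_norml -/mu; lra.
rewrite expRD -ZN [2^-1 * (_ * _)]mulrA.
rewrite -ler_pdivlMr ?expR_gt0// -expRN opprK.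
apply: le_trans hN _; rewrite mulr_suml big_mkcond [leRHS]big_mkcond /=.
apply: ler_sum => x _; case: (boolP [forall k, 0 < p (x k)]) => /= hx; last first.
  case: ifP => // _; rewrite (@prod_tilt_eq0 _ _ _ (fun x => 0 < p x))// => y.
  by rewrite /tilt_in => /negbTE->.
case: ifP => // hs; move/forallP: hx => hx.
have [-> _] := prod_tilt_in b hx (fun k => pq _ (hx k)).
rewrite -mulrA -expRD ler_peMr//; first by apply: prodr_ge0.
apply: le_trans (expR_ge1Dx _); rewrite lerDl.
have : (b - 1) * \sum_k llr p q (x k) <= (b - 1) * (N%:R * (mu + eta)).
  rewrite ler_pM2l; last by lra.
  by move: hs; rewrite ler_norml -/mu; lra.
lra.
Qed.

(** Same construction on the output side: in [T] the total log-eigenvalue is near [m * mu], which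
    bounds the eigenvalue from below and fixes the ratio between [a] and its tilted version. *)
Lemma typical_target (R : realType) (J : finType) (a l : J -> R) (s eta : R) :
  0 <= s -> (forall j, 0 <= a j) -> (forall j, 0 <= l j) ->
  (exists j, 0 < a j * l j) -> 0 < eta ->
  let Z := \sum_j tilt_out a l s j in
  let mu := tilted_mean (tilt_out a l s) (fun j => ln (l j)) in
  \forall m \near \oo, exists T : pred {ffun 'I_m -> J},
    (forall y, T y -> expR (m%:R * (mu - eta)) <= \prod_k l (y k)) /\
    2^-1 * expR (m%:R * ln Z - s * (m%:R * (mu + eta)))
      <= \sum_(y | T y) \prod_k a (y k).
Proof.
move=> s0 a0 l0 aj eta0 Z mu.
have Z0 : 0 < Z by exact: tilt_out_sum_gt0.
have z0 j := tilt_out_ge0 l s (a0 j).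
have ZN N : Z ^+ N = expR (N%:R * ln Z).
  by rewrite expRM_natl lnK ?posrE.
have := tilted_typical (fun j => ln (l j)) z0 Z0 eta0.
apply: filterS => N hN.
exists (fun x => [forall k, 0 < a (x k) * l (x k)] &&
   (`|\sum_k ln (l (x k)) - N%:R * mu| <= N%:R * eta)); split.
  move=> y /andP[/forallP hy hs].
  have lp k : 0 < l (y k).
    rewrite lt_neqAle l0 andbT; apply/eqP => e.
    by have := hy k; rewrite -e mulr0 ltxx.
  under eq_bigr do rewrite -(@lnK _ (l (y _))) ?posrE//.
  rewrite -expR_sum ler_expR; by move: hs; rewrite ler_norml -/mu; lra.
rewrite expRD -ZN [2^-1 * (_ * _)]mulrA.
rewrite -ler_pdivlMr ?expR_gt0// -expRN opprK.
apply: le_trans hN _; rewrite mulr_suml big_mkcond [leRHS]big_mkcond /=.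
apply: ler_sum => x _; case: (boolP [forall k, 0 < a (x k) * l (x k)]) => /= hx; last first.
  case: ifP => // _; rewrite (@prod_tilt_eq0 _ _ _ (fun x => 0 < a x * l x))// => y.
  by rewrite /tilt_out => /negbTE->.
case: ifP => // hs; move/forallP: hx => hx.
rewrite (prod_tilt_out s hx).
rewrite -mulrA -expRD ler_peMr//; first by apply: prodr_ge0.
apply: le_trans (expR_ge1Dx _); rewrite lerDl.
have : s * \sum_k ln (l (x k)) <= s * (N%:R * (mu + eta)).
  by rewrite ler_wpM2l//; move: hs; rewrite ler_norml -/mu; lra.
lra.
Qed.

(** The classical counterpart of [sc_term]. Its derivative with respect to [1 - b^-1] is
    [bal_fun]. *)
Definition tilt_rate (R : realType) (X J : finType) (p q : X -> R) (a l : J -> R)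
  (r b : R) : R :=
  - (b^-1 * ln (\sum_x tilt_in p q b x)) - r * ln (\sum_j tilt_out a l (1 - b^-1) j).

(** Uniformly in [b], the divergence part is bounded by the logarithms of [q] and the mean of
    [ln (l j)] by those of [l]. This is the boundedness that [exponent_balance] asks for. *)
Lemma bal_fun_bounds (R : realType) (X J : finType) (p q : X -> R) (a l : J -> R) (r : R) :
  (exists x, 0 < p x) -> (forall x, 0 <= p x) -> (forall x, 0 <= q x) ->
  \sum_x q x <= 1 -> (forall x, 0 < p x -> 0 < q x) ->
  (forall j, 0 <= a j) -> (forall j, 0 <= l j <= 1) -> (exists j, 0 < a j * l j) ->
  0 < r -> exists2 K, 0 < K & forall b, - K <= bal_fun p q a l r b <= K.
Proof.
move=> px p0 q0 q1 pq a0 l01 aj r0.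
have l0 j : 0 <= l j by case/andP: (l01 j).
pose K1 := \sum_x `|ln (q x)|; pose K2 := \sum_j `|ln (l j)|.
have K10 : 0 <= K1 by apply: sumr_ge0.
have K20 : 0 <= K2 by apply: sumr_ge0.
exists (1 + K1 + r * K2).
  have := mulr_ge0 (ltW r0) K20; lra.
move=> b; rewrite /bal_fun.
have hK1 x : 0 < p x -> - ln (q x) <= K1.
  move=> _; rewrite /K1 (bigD1 x)//=; apply: (@le_trans _ _ `|ln (q x)|).
    by rewrite -normrN ler_norm.
  by rewrite lerDl sumr_ge0.
have := tilted_divergence_bounds b px q0 q1 pq hK1.
set D := b * _ - _ => /andP[D0 D1].
have s0 := tilt_out_sum_gt0 (1 - b^-1) a0 l0 aj.
have z0 j := tilt_out_ge0 l (1 - b^-1) (a0 j).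
set M := tilted_mean _ _.
have M0 : M <= 0.
  by apply: tilted_mean_le => // j _; apply: ln_le0; case/andP: (l01 j).
have M1 : - K2 <= M.
  have := tilted_mean_le (f := fun j => -1 * ln (l j) + 0) z0 s0 (K := K2).
  rewrite tilted_mean_affine// -/M => h.
  suff : -1 * M + 0 <= K2 by lra.
  apply: h => j _; rewrite /K2 (bigD1 j)//=; apply: (@le_trans _ _ `|ln (l j)|).
    by rewrite mulN1r addr0 -normrN ler_norm.
  by rewrite lerDl sumr_ge0.
have h1 : 0 <= - (r * M) by rewrite -mulrN mulr_ge0 ?(ltW r0)//; lra.
have h2 : - (r * M) <= r * K2 by rewrite -mulrN ler_pM2l//; lra.
by apply/andP; split; lra.
Qed.

(** If the [Q]-probability [expR v] of [B] exceeds the budget [expR u], membership in [B] is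
    accepted only with probability [expR (u - v)]. *)
Lemma clip_test (R : realType) (Y : finType) (P Q : Y -> R) (B : pred Y) (u v w : R) :
  (forall y, 0 <= P y) -> (forall y, 0 <= Q y) ->
  \sum_(y | B y) Q y <= expR v -> 2^-1 * expR w <= \sum_(y | B y) P y ->
  exists f : Y -> R, [/\ forall y, 0 <= f y <= 1,
    \sum_y f y * Q y <= expR u &
    2^-1 * expR (w + Num.min 0 (u - v)) <= \sum_y f y * P y].
Proof.
move=> P0 Q0 hQ hP; set th := expR (Num.min 0 (u - v)).
have th0 : 0 <= th by exact: expR_ge0.
have th1 : th <= 1 by rewrite /th -[leRHS]expR0 ler_expR ge_min lexx.
have e (F : Y -> R) : \sum_y (if B y then th else 0) * F y = th * \sum_(y | B y) F y.
  rewrite mulr_sumr [RHS]big_mkcond; apply: eq_bigr => y _.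
  by case: ifP; rewrite ?mul0r.
exists (fun y => if B y then th else 0); split.
- by move=> y; case: ifP; rewrite ?th0 ?th1 ?lexx ?ler01.
- rewrite e; apply: (@le_trans _ _ (th * expR v)); first by rewrite ler_wpM2l.
  rewrite /th -expRD ler_expR.
  have : Num.min 0 (u - v) <= u - v by rewrite ge_min lexx orbT.
  lra.
- by rewrite e expRD mulrA mulrC ler_wpM2l.
Qed.

Lemma near_scaled_infty (R : realType) (A c : R) : 0 < c ->
  \forall N \near \oo, A <= c * N%:R.
Proof.
move=> c0; exists (Num.truncn (A / c)).+1 => // N /= hN.
rewrite mulrC -ler_pdivrMr//; apply/ltW; apply: lt_le_trans (truncnS_gt _) _.
by rewrite ler_nat.
Qed.

(** Typical test and typical target at a balanced [b], the test being clipped to the eigenvalue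
    bound [L] of the target. Up to slack, the logarithm of the product per input letter is
    [- g + s * h - max 0 h], with [g] the value of [tilt_rate], and balance makes
    [- s * h + max 0 h] small. The tolerance [K] on [m] absorbs the rounding caused by cutting n
    copies into blocks. *)
Lemma iid_test_lower_bound (R : realType) (X J : finType) (p q : X -> R) (a l : J -> R)
  (r K delta : R) :
  (exists x, 0 < p x) -> (forall x, 0 <= p x) -> (forall x, 0 <= q x) ->
  \sum_x q x <= 1 -> (forall x, 0 < p x -> 0 < q x) ->
  (forall j, 0 <= a j) -> (forall j, 0 <= l j <= 1) -> (exists j, 0 < a j * l j) ->
  0 < r -> 0 <= K -> 0 < delta ->
  exists2 b, 1 < b & \forall N \near \oo, forall m, `|m%:R - r * N%:R| <= K ->
    exists (f : {ffun 'I_N -> X} -> R) (T : pred {ffun 'I_m -> J}) (L : R),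
    [/\ forall x, 0 <= f x <= 1, 0 < L, forall y, T y -> L <= \prod_k l (y k),
      \sum_x f x * \prod_k q (x k) <= L &
      expR (- (N%:R * (tilt_rate p q a l r b + delta))) <=
        (\sum_x f x * \prod_k p (x k)) * \sum_(y | T y) \prod_k a (y k)].
Proof.
move=> px p0 q0 q1 pq a0 l01 aj r0 K0 d0.
have l0 j : 0 <= l j by case/andP: (l01 j).
have [M M0 hM] := bal_fun_bounds px p0 q0 q1 pq a0 l01 aj r0.
have d30 : 0 < delta / 3 by rewrite divr_gt0.
have [b b1 hb] := exponent_balance d30 M0
  (fun b => @bal_fun_continuous R X J p q a l r b px a0 l0 aj)
  (fun b _ => proj1 (andP (hM b))) (fun b _ => proj2 (andP (hM b))).
exists b => //.
pose s := 1 - b^-1.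
have bp : 0 < b by lra.
have bs : b * s = b - 1 by rewrite /s mulrBr mulr1 mulfV// gt_eqF.
have s0 : 0 < s by rewrite -(pmulr_rgt0 _ bp) bs; lra.
have s1 : s <= 1 by rewrite /s lerBlDr lerDl invr_ge0 ltW.
(* One third of [delta] pays for the balance, one for the typicality slack, one for constants. The
   slack is at most [2 * (b + r) * eta] per letter, hence the 6. *)
pose eta := delta / (6 * (b + r)).
have br : 0 < b + r by lra.
have eta0 : 0 < eta by rewrite divr_gt0// mulr_gt0.
have eta_e : 6 * (b + r) * eta = delta.
  by rewrite /eta mulrC mulfVK// gt_eqF// mulr_gt0.
have hin := typical_test b1 px p0 q0 pq eta0.
have hout := typical_target (ltW s0) a0 l0 aj eta0.
move: hin hout hb; rewrite /bal_fun /tilt_rate -/s.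
set lZi := ln (\sum_x _); set mu := tilted_mean _ _; set lZo := ln (\sum_j _).
set nu := tilted_mean _ _ => hin hout.
set h := - (r * nu) - (b * mu - lZi) => hb.
set g := - (b^-1 * lZi) - r * lZo.
have ge : g = - lZi - r * lZo + s * lZi by rewrite /g /s; ring.
clearbody lZi mu lZo nu eta.
case: hout => M1 _ hout.
(* The 4 pays for the two factors 1/2, the other terms for replacing [m] by [r * N], from which it
   differs by at most [K]. *)
pose K1 := 4 + K * (`|nu| + `|lZo - s * nu|) + 2 * K * eta.
near=> N; move=> m hm.
have hm2 : r * N%:R - K <= m%:R <= r * N%:R + K.
  by move: hm; rewrite ler_norml; lra.
have [B [hB1 hB2]] : exists B : pred {ffun 'I_N -> X},
    \sum_(x | B x) \prod_k q (x k) <= expR (N%:R * lZi - b * (N%:R * (mu - eta))) /\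
    2^-1 * expR (N%:R * lZi - (b - 1) * (N%:R * (mu + eta)))
      <= \sum_(x | B x) \prod_k p (x k).
  by near: N.
have [T [hT1 hT2]] : exists T : pred {ffun 'I_m -> J},
    (forall y, T y -> expR (m%:R * (nu - eta)) <= \prod_k l (y k)) /\
    2^-1 * expR (m%:R * lZo - s * (m%:R * (nu + eta)))
      <= \sum_(y | T y) \prod_k a (y k).
  apply: hout => /=; rewrite -(ler_nat R).
  suff : M1%:R + K <= r * N%:R by case/andP: hm2; lra.
  by near: N; apply: near_scaled_infty.
have P0 (x : {ffun 'I_N -> X}) : 0 <= \prod_k p (x k) by apply: prodr_ge0.
have Q0 (x : {ffun 'I_N -> X}) : 0 <= \prod_k q (x k) by apply: prodr_ge0.
have [f [f01 fQ fP]] := clip_test (m%:R * (nu - eta)) P0 Q0 hB1 hB2.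
exists f, T, (expR (m%:R * (nu - eta))); split => //; first exact: expR_gt0.
apply: (@le_trans _ _ ((2^-1 * expR
   (N%:R * lZi - (b - 1) * (N%:R * (mu + eta)) +
   Num.min 0 (m%:R * (nu - eta) - (N%:R * lZi - b * (N%:R * (mu - eta)))))) *
   (2^-1 * expR (m%:R * lZo - s * (m%:R * (nu + eta)))))); last first.
  by rewrite ler_pM// ?mulr_ge0 ?expR_ge0.
set mn := Num.min _ _.
have hNK : K1 <= delta / 3 * N%:R by near: N; apply: near_scaled_infty.
have hmn : - (N%:R * Num.max 0 h) - K * `|nu| - (m%:R + b * N%:R) * eta <= mn.
  have c1 : - (K * `|nu|) <= (m%:R - r * N%:R) * nu.
    rewrite lerNl; apply: le_trans (ler_norm _) _.
    by rewrite normrN normrM ler_wpM2r.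
  have c2 : N%:R * h <= N%:R * Num.max 0 h.
    by rewrite ler_wpM2l ?ler0n// le_max lexx orbT.
  have c3 : 0 <= N%:R * Num.max 0 h by rewrite mulr_ge0 ?ler0n// le_max lexx.
  have c4 : 0 <= K * `|nu| by rewrite mulr_ge0.
  have c5 : 0 <= (m%:R + b * N%:R) * eta.
    by rewrite mulr_ge0 ?(ltW eta0)// addr_ge0 ?ler0n// mulr_ge0 ?ler0n// ltW.
  rewrite le_min; apply/andP; split; first by lra.
  rewrite /h in c2 *; lra.
clearbody mn.
have c6 : - (K * `|lZo - s * nu|) <= (m%:R - r * N%:R) * (lZo - s * nu).
  rewrite lerNl; apply: le_trans (ler_norm _) _.
  by rewrite normrN normrM ler_wpM2r.
have c7 : s * (m%:R * eta) <= m%:R * eta.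
  by rewrite ler_piMl// mulr_ge0 ?ler0n// ltW.
have c8 : m%:R * eta <= (r * N%:R + K) * eta.
  by rewrite ler_pM2r//; case/andP: hm2.
have c9 : N%:R * (- s * h + Num.max 0 h) <= N%:R * (delta / 3).
  by rewrite ler_wpM2l ?ler0n//; exact: hb.
have c10 : N%:R * ((b + r) * eta) = N%:R * (delta / 6).
  by rewrite -eta_e; congr (_ * _); field.
have h4 : expR (- (4 : R)) <= 2^-1 * 2^-1.
  rewrite expRN -invfM lef_pV2 ?posrE ?expR_gt0 ?mulr_gt0//.
  by apply: le_trans (expR_ge1Dx _); lra.
rewrite mulrACA -expRD.
apply: (@le_trans _ _ (expR (- 4) * expR
   (N%:R * lZi - (b - 1) * (N%:R * (mu + eta)) + mn +
   (m%:R * lZo - s * (m%:R * (nu + eta)))))); last by rewrite ler_wpM2r ?expR_ge0.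
rewrite -expRD ler_expR ge -bs.
rewrite /K1 in hNK.
have c11 : (b * s) * (N%:R * eta) <= b * (N%:R * eta).
  rewrite ler_wpM2r ?mulr_ge0 ?ler0n ?(ltW eta0)//.
  by rewrite ler_piMr// ltW.
rewrite /h in c9.
move: c9; set mx := Num.max _ _ => c9.
rewrite -/h -/mx in hmn.
lra.
Unshelve. all: by end_near.
Qed.

(** * Tensor powers *)

(** Mirrors the recursion of [ntensmx]: [d ^ 1] reduces to [d], so it starts at one factor and
    splits further ones off on the left; the empty product is left to [tdig]. *)
Fixpoint tdig_rec (d n : nat) : 'I_(d ^ n.+1) -> 'I_n.+1 -> 'I_d :=
  match n return 'I_(d ^ n.+1) -> 'I_n.+1 -> 'I_d with
  | 0 => fun i _ => i
  | n'.+1 => fun i k =>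
      if unlift ord0 k is Some k' then @tdig_rec d n' (@mxtens_unindex d (d ^ n'.+1) i).2 k'
      else (@mxtens_unindex d (d ^ n'.+1) i).1
  end.

(* Position of a basis index of the [n]-fold tensor power in each factor. *)
Definition tdig (d n : nat) (i : 'I_(d ^ n)) : {ffun 'I_n -> 'I_d} :=
  match n return 'I_(d ^ n) -> {ffun 'I_n -> 'I_d} with
  | 0 => fun _ => ffun0 (card_ord 0)
  | n'.+1 => fun i => [ffun k => @tdig_rec d n' i k]
  end i.

(** In this entrywise form, identities on tensor powers become distributivity of a product over
    sums, as in [sum_prod_tdig]. *)
Lemma ntensmxE (R : realType) d e n (A : 'M[R[i]]_(d, e)) i j :
  ntensmx A n i j = \prod_k A (tdig i k) (tdig j k).
Proof.
case: n i j => [|n] i j; first by rewrite big_ord0 (ord1 i) (ord1 j) !mxE eqxx.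
under eq_bigr do rewrite !ffunE.
elim: n i j => [|n IH] i j; first by rewrite big_ord_recl big_ord0 mulr1.
rewrite big_ord_recl /= unlift_none.
rewrite [LHS]mxE; congr (_ * _).
rewrite [LHS](IH _ _); apply: eq_bigr => k _.
by rewrite !liftK.
Qed.

Lemma tdig_inj d n : injective (@tdig d n).
Proof.
case: n => [|n] i j; first by rewrite (ord1 i) (ord1 j).
move=> /ffunP e; have {}e k : tdig_rec i k = tdig_rec j k by have := e k; rewrite !ffunE.
elim: n i j e => [|n IH] i j e; first exact: (e ord0).
have e0 := e ord0; rewrite /= unlift_none in e0.
have e1 : (mxtens_unindex (m := d) (n := d ^ n.+1) i).2 =
          (mxtens_unindex (m := d) (n := d ^ n.+1) j).2.
  apply: IH => k; have := e (lift ord0 k); by rewrite /= liftK.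
rewrite -(@mxtens_unindexK d (d ^ n.+1) i) -(@mxtens_unindexK d (d ^ n.+1) j).
exact: (congr2 (fun a b => mxtens_index (a, b)) e0 e1).
Qed.

Lemma tdig_bij d n : bijective (@tdig d n).
Proof.
apply: inj_card_bij; first exact: tdig_inj.
by rewrite card_ffun !card_ord.
Qed.

Lemma sum_tdig (V : nmodType) d n (F : {ffun 'I_n -> 'I_d} -> V) :
  \sum_(i : 'I_(d ^ n)) F (tdig i) = \sum_x F x.
Proof.
rewrite [RHS](reindex (@tdig d n)) //=.
exact: onW_bij (tdig_bij d n).
Qed.

Lemma sum_prod_tdig (R : comPzRingType) d n (F : 'I_n -> 'I_d -> R) :
  \sum_(i : 'I_(d ^ n)) \prod_k F k (tdig i k) = \prod_k \sum_j F k j.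
Proof.
rewrite (sum_tdig (fun x : {ffun 'I_n -> 'I_d} => \prod_k F k (x k))).
by rewrite bigA_distr_bigA.
Qed.

Lemma ntensmx_mul (R : realType) d e f n (A : 'M[R[i]]_(d, e)) (B : 'M[R[i]]_(e, f)) :
  ntensmx (A *m B) n = ntensmx A n *m ntensmx B n.
Proof.
apply/matrixP=> i j; rewrite ntensmxE mxE.
under [RHS]eq_bigr do rewrite !ntensmxE -big_split /=.
rewrite (sum_prod_tdig (fun k l => A (tdig i k) l * B l (tdig j k))).
by apply: eq_bigr => k _; rewrite mxE.
Qed.

Lemma dag_ntensmx (R : realType) d e n (A : 'M[R[i]]_(d, e)) :
  dag (ntensmx A n) = ntensmx (dag A) n.
Proof.
apply/matrixP=> i j; rewrite dagE !ntensmxE rmorph_prod.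
by apply: eq_bigr => k _; rewrite dagE.
Qed.

Lemma mxtrace_ntensmx (R : realType) d n (A : 'M[R[i]]_d) :
  \tr (ntensmx A n) = (\tr A) ^+ n.
Proof.
rewrite /mxtrace; under eq_bigr do rewrite ntensmxE.
by rewrite (sum_prod_tdig (fun _ j => A j j)) prodr_const card_ord.
Qed.

Lemma ntensmx_1 (R : realType) d n : ntensmx (1%:M : 'M[R[i]]_d) n = 1%:M.
Proof.
apply/matrixP=> i j; rewrite ntensmxE !mxE.
have [->|ij] := eqVneq i j; first by rewrite big1// => k _; rewrite mxE eqxx.
have [k hk] : exists k, tdig i k != tdig j k.
  apply/existsP; rewrite -negb_forall; apply: contra ij => /forallP h.
  by apply/eqP/tdig_inj/ffunP => k; apply/eqP.
by rewrite (bigD1 k)//= mxE (negbTE hk) mul0r.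
Qed.

Lemma unitary_ntensmx (R : realType) d n (V : 'M[R[i]]_d) :
  V \is unitarymx -> ntensmx V n \is unitarymx.
Proof.
move=> hV; apply/unitarymxP; rewrite -/(dag _) dag_ntensmx -ntensmx_mul.
by rewrite (unitaryP hV) ntensmx_1.
Qed.

Lemma ntensmx_cdiag (R : realType) d n (l : 'I_d -> R) :
  ntensmx (cdiag l) n = cdiag (fun i => \prod_k l (tdig i k)).
Proof.
apply/matrixP=> i j; rewrite ntensmxE !mxE.
have [->|ij] := eqVneq i j.
  by rewrite mulr1n prodRC; apply: eq_bigr => k _; rewrite !mxE eqxx mulr1n.
have [k hk] : exists k, tdig i k != tdig j k.
  apply/existsP; rewrite -negb_forall; apply: contra ij => /forallP h.
  by apply/eqP/tdig_inj/ffunP => k; apply/eqP.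
by rewrite (bigD1 k)//= !mxE (negbTE hk) mulr0n mul0r.
Qed.

Lemma ntensmx_udiag (R : realType) d n (V : 'M[R[i]]_d) (l : 'I_d -> R) :
  ntensmx (udiag V l) n = udiag (ntensmx V n) (fun i => \prod_k l (tdig i k)).
Proof. by rewrite /udiag !ntensmx_mul ntensmx_cdiag dag_ntensmx. Qed.

(** Defined apart from [ntensmx], which would turn a column into a matrix with [1 ^ n] columns. *)
Definition vtens (R : realType) d n (x : 'cV[R[i]]_d) : 'cV[R[i]]_(d ^ n) :=
  \col_i \prod_k x (tdig i k) 0.

Lemma mul_vtens (R : realType) d n (A : 'M[R[i]]_d) (x : 'cV[R[i]]_d) :
  ntensmx A n *m vtens n x = vtens n (A *m x).
Proof.
apply/matrixP=> i j; rewrite !mxE.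
under [LHS]eq_bigr do rewrite ntensmxE mxE -big_split /=.
rewrite (sum_prod_tdig (fun k l => A (tdig i k) l * x l 0)).
by apply: eq_bigr => k _; rewrite mxE.
Qed.

Lemma ntensmx_pure (R : realType) d n (x : 'cV[R[i]]_d) :
  ntensmx (x *m dag x) n = vtens n x *m dag (vtens n x).
Proof.
apply/matrixP=> i j; rewrite ntensmxE mxE big_ord1 dagE !mxE rmorph_prod -big_split /=.
by apply: eq_bigr => k _; rewrite mxE big_ord1 dagE.
Qed.

Lemma psd_ntensmx (R : realType) d n (A : 'M[R[i]]_d) : psd A -> psd (ntensmx A n).
Proof. by move=> /psd_gramP[B ->]; rewrite ntensmx_mul -dag_ntensmx; exact: psd_gram. Qed.

Lemma density_ntensmx (R : realType) d n (A : 'M[R[i]]_d) :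
  density A -> density (ntensmx A n).
Proof.
by move=> [pA tA]; split; [exact: psd_ntensmx|rewrite mxtrace_ntensmx tA expr1n].
Qed.

(** The type of a basis index, as in the method of types. The label set has [(n + 1) ^ d] elements,
    which is the source of the polynomial factors; [inord] is faithful here because a count is at
    most [n]. *)
Definition ttype (d n : nat) (i : 'I_(d ^ n)) : {ffun 'I_d -> 'I_n.+1} :=
  [ffun j => inord #|[pred k | tdig i k == j]|].

Lemma prod_ttype (R : comPzRingType) d n (l : 'I_d -> R) (i : 'I_(d ^ n)) :
  \prod_k l (tdig i k) = \prod_j l j ^+ ttype i j.
Proof.
rewrite (partition_big (tdig i) predT)//=; apply: eq_bigr => j _.
rewrite ffunE inordK; last by rewrite ltnS -[X in (_ <= X)%N]card_ord max_card.
by rewrite (eq_bigr (fun=> l j)) => [|k /eqP->//]; rewrite prodr_const.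
Qed.

Lemma card_ttype d n : #|{ffun 'I_d -> 'I_n.+1}| = (n.+1 ^ d)%N.
Proof. by rewrite card_ffun !card_ord. Qed.

(** A tensor product read through an index map [c], so that [d ^ (k + n)] and [d ^ k * d ^ n] need
    not be identified by casts. *)
Definition cten (R : realType) d1 d2 d (c : 'I_d -> 'I_d1 * 'I_d2)
  (A : 'M[R[i]]_d1) (B : 'M[R[i]]_d2) : 'M[R[i]]_d :=
  \matrix_(i, j) (A (c i).1 (c j).1 * B (c i).2 (c j).2).

Lemma cten_mul (R : realType) d1 d2 d (c : 'I_d -> 'I_d1 * 'I_d2)
  (A A' : 'M[R[i]]_d1) (B B' : 'M[R[i]]_d2) : bijective c ->
  cten c A B *m cten c A' B' = cten c (A *m A') (B *m B').
Proof.
move=> bc; apply/matrixP=> i j; rewrite !mxE.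
rewrite big_distrlr /= pair_big /=.
rewrite [RHS](reindex c) /=; last exact: onW_bij.
by apply: eq_bigr => k _; rewrite !mxE mulrACA.
Qed.

Lemma dag_cten (R : realType) d1 d2 d (c : 'I_d -> 'I_d1 * 'I_d2)
  (A : 'M[R[i]]_d1) (B : 'M[R[i]]_d2) : dag (cten c A B) = cten c (dag A) (dag B).
Proof. by apply/matrixP=> i j; rewrite dagE !mxE rmorphM. Qed.

Lemma mxtrace_cten (R : realType) d1 d2 d (c : 'I_d -> 'I_d1 * 'I_d2)
  (A : 'M[R[i]]_d1) (B : 'M[R[i]]_d2) : bijective c ->
  \tr (cten c A B) = \tr A * \tr B.
Proof.
move=> bc; rewrite /mxtrace big_distrlr /= pair_big /=.
rewrite [RHS](reindex c) /=; last exact: onW_bij.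
by apply: eq_bigr => k _; rewrite !mxE.
Qed.

Lemma cten1 (R : realType) d1 d2 d (c : 'I_d -> 'I_d1 * 'I_d2) : bijective c ->
  cten c 1%:M 1%:M = 1%:M :> 'M[R[i]]_d.
Proof.
move=> /bij_inj bc; apply/matrixP=> i j; rewrite !mxE -natrM mulnb.
by rewrite -xpair_eqE -!surjective_pairing (inj_eq bc).
Qed.

Lemma psd_cten (R : realType) d1 d2 d (c : 'I_d -> 'I_d1 * 'I_d2)
  (A : 'M[R[i]]_d1) (B : 'M[R[i]]_d2) : bijective c ->
  psd A -> psd B -> psd (cten c A B).
Proof.
move=> bc /psd_gramP[A' ->] /psd_gramP[B' ->].
by rewrite -cten_mul// -dag_cten; exact: psd_gram.
Qed.

Lemma ntensmx_add (d k n : nat) :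
  exists c : 'I_(d ^ (k + n)) -> 'I_(d ^ k) * 'I_(d ^ n), bijective c /\
    forall (R : realType) (A : 'M[R[i]]_d),
      ntensmx A (k + n) = cten c (ntensmx A k) (ntensmx A n).
Proof.
have [gk gkK kgK] := tdig_bij d k; have [gn gnK ngK] := tdig_bij d n.
exists (fun i => (gk [ffun u => tdig i (lshift n u)], gn [ffun u => tdig i (rshift k u)])).
split; last first.
  move=> R A; apply/matrixP=> i j; rewrite mxE !ntensmxE big_split_ord /= !kgK !ngK.
  by congr (_ * _); apply: eq_bigr => u _; rewrite !ffunE.
apply: inj_card_bij; last by rewrite card_prod !card_ord expnD.
move=> i j [] /(can_inj kgK) /ffunP e1 /(can_inj ngK) /ffunP e2.
apply: tdig_inj; apply/ffunP => u; rewrite -(splitK u).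
case: (fintype.split u) => v /=; [have := e1 v|have := e2 v]; by rewrite !ffunE.
Qed.

(** * Pinching *)

Lemma qfE (R : realType) n (A : 'M[R[i]]_n) x :
  qf A x = \sum_i \sum_j Num.conj (x i 0) * A i j * x j 0.
Proof.
rewrite /qf -mulmxA mxE; apply: eq_bigr => i _.
rewrite dagE mxE mulr_sumr; apply: eq_bigr => j _; by rewrite mulrA.
Qed.

Definition bf (R : realType) n (A : 'M[R[i]]_n) (x y : 'cV[R[i]]_n) : R[i] :=
  (dag x *m A *m y) 0 0.

Lemma qfB_vec (R : realType) n (A : 'M[R[i]]_n) x y :
  qf A (x - y) = qf A x + qf A y - bf A x y - bf A y x.
Proof.
rewrite /qf /bf dagD dagN !(mulmxDl, mulmxDr, mulNmx, mulmxN) !mxE.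
ring.
Qed.

Lemma bf_sum (R : realType) n (A : 'M[R[i]]_n) (I J : finType) (x : I -> 'cV_n) (y : J -> 'cV_n) :
  bf A (\sum_i x i) (\sum_j y j) = \sum_i \sum_j bf A (x i) (y j).
Proof.
rewrite /bf dag_sum !mulmx_suml summxE; apply: eq_bigr => i _.
by rewrite mulmx_sumr summxE.
Qed.

(** Expand the nonnegative sum of [qf A (x c - x d)] over all pairs. This is the pinching
    inequality, with the number of blocks as constant. *)
Lemma qf_sum_le (R : realType) n (A : 'M[R[i]]_n) (I : finType) (x : I -> 'cV_n) :
  psd A -> qf A (\sum_c x c) <= #|I|%:R * \sum_c qf A (x c).
Proof.
move=> pA.
have h : 0 <= \sum_c \sum_d qf A (x c - x d).
  by apply: sumr_ge0 => c _; apply: sumr_ge0 => d _; exact: psd_qf.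
have e : \sum_c \sum_d qf A (x c - x d) =
    2 * (#|I|%:R * \sum_c qf A (x c) - qf A (\sum_c x c)).
  transitivity (\sum_c \sum_d (qf A (x c) + qf A (x d))
     - \sum_c \sum_d bf A (x c) (x d) - \sum_c \sum_d bf A (x d) (x c)).
    rewrite -!sumrB; apply: eq_bigr => c _.
    by rewrite -!sumrB; apply: eq_bigr => d _; rewrite qfB_vec.
  rewrite [X in _ - X](exchange_big) /= -bf_sum -/(qf _ _).
  under eq_bigr do rewrite big_split /= sumr_const.
  rewrite big_split /= sumr_const -mulr_natl.
  under eq_bigr do rewrite -mulr_natl.
  by rewrite -mulr_sumr /bf /qf; ring.
by move: h; rewrite e pmulr_rge0// subr_ge0.
Qed.

Definition vpart (R : realType) n (C : eqType) (t : 'I_n -> C) (x : 'cV[R[i]]_n) (c : C) : 'cV[R[i]]_n :=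
  \col_i (if t i == c then x i 0 else 0).

Lemma sum_vpart (R : realType) n (C : finType) (t : 'I_n -> C) (x : 'cV[R[i]]_n) :
  \sum_c vpart t x c = x.
Proof.
apply/matrixP=> i j; rewrite summxE (ord1 j) (bigD1 (t i))//= mxE eqxx big1 ?addr0//.
by move=> c hc; rewrite mxE eq_sym (negbTE hc).
Qed.

Lemma pinching_qf (R : realType) n (C : finType) (t : 'I_n -> C) (A : 'M[R[i]]_n) x :
  \sum_c qf A (vpart t x c) =
  qf (\matrix_(i, j) (if t i == t j then A i j else 0)) x.
Proof.
under eq_bigr do rewrite qfE.
rewrite exchange_big [RHS]qfE /=; apply: eq_bigr => i _.
rewrite exchange_big /=; apply: eq_bigr => j _.
rewrite (bigD1 (t i))//= big1 ?addr0.
  rewrite !mxE eqxx [t j == _]eq_sym; case: eqP => // _.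
  by rewrite mulr0 !mulr0 mul0r.
by move=> c hc; rewrite !mxE [t i == c]eq_sym (negbTE hc) rmorph0 !mul0r.
Qed.

Lemma trig_hermitian (R : realType) n (A : 'M[R[i]]_n) :
  Defs.hermitian A -> is_trig_mx A -> exists l : 'I_n -> R, A = cdiag l.
Proof.
move=> hA /is_trig_mxP tA; exists (fun i => complex.Re (A i i)).
have conjA i j : Num.conj (A j i) = A i j by rewrite -[in RHS]hA dagE.
apply/matrixP=> i j; rewrite !mxE; have [->|] := eqVneq i j.
  rewrite mulr1n RRe_real//; apply/CrealP; exact: conjA.
rewrite mulr0n neq_ltn => /orP[h|h]; first exact: tA.
by rewrite -conjA tA// rmorph0.
Qed.

Lemma hermitian_conj (R : realType) n (V A : 'M[R[i]]_n) :
  Defs.hermitian A -> Defs.hermitian (V *m A *m dag V).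
Proof. by move=> hA; rewrite /Defs.hermitian !dagM dagK hA mulmxA. Qed.

Lemma codiagonalization (R : realType) n (A B : 'M[R[i]]_n) :
  Defs.hermitian A -> Defs.hermitian B -> A *m B = B *m A ->
  exists U (p q : 'I_n -> R), [/\ U \is unitarymx,
     U *m A *m dag U = cdiag p & U *m B *m dag U = cdiag q].
Proof.
move=> hA hB /cotrigonalization2[U hU /andP[]].
rewrite /similar_to !conjymx// => tA tB.
have [p hp] := trig_hermitian (hermitian_conj U hA) tA.
have [q hq] := trig_hermitian (hermitian_conj U hB) tB.
by exists U, p, q.
Qed.

(** Written in the basis [V], the pinching [P] of [A] commutes with the diagonal matrix of [l], so
    one unitary [U] diagonalizes both. Since [U] only rotates within eigenspaces, the diagonal of
    [A] in the new basis is the spectrum of [P]. *)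
Lemma pinching_basis_aux (R : realType) n (C : finType) (A V : 'M[R[i]]_n)
  (l : 'I_n -> R) (t : 'I_n -> C) :
  psd A -> V \is unitarymx -> (forall i j, (t i == t j) = (l i == l j)) ->
  exists W (p q : 'I_n -> R), [/\ W \is unitarymx, udiag V l = udiag W q,
    forall x, exists i, q x = l i, forall x, dent W A x = (p x)%:C &
    forall x, qf A x <= #|C|%:R * qf (udiag W p) x].
Proof.
move=> pA hV ht; have uV := unitaryP hV.
pose A' := V *m A *m dag V.
have pA' : psd A' by have := psd_conj (dag V) pA; rewrite dagK.
have eA' : V *m A *m dag V = A' by [].
clearbody A'.
pose P : 'M[R[i]]_n := \matrix_(i, j) (if t i == t j then A' i j else 0).
have hP : Defs.hermitian P.
  apply/matrixP => i j; rewrite dagE !mxE [t j == _]eq_sym.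
  by case: ifP => _; rewrite ?rmorph0// -[in RHS](proj1 pA') dagE.
have PD : P *m cdiag l = cdiag l *m P.
  apply/matrixP => i j; rewrite mul_mx_diag mul_diag_mx !mxE ht.
  by case: eqP => [->|_]; rewrite ?mul0r ?mulr0// mulrC.
have [U [p [q [hU eP eD]]]] := codiagonalization hP (dag_cdiag l) PD.
have uU := unitaryP hU.
have UD : cdiag q *m U = U *m cdiag l.
  by rewrite -eD -(mulmxA _ (dag U)) uU mulmx1.
(* Each row of [U] is supported on a single eigenspace. *)
have Uq x i : U x i != 0 -> q x = l i.
  move=> U0; have /matrixP/(_ x i) := UD.
  rewrite mul_diag_mx mul_mx_diag !mxE mulrC => /(mulfI U0).
  by move=> /complexI.
have eW : U *m V \is unitarymx := mul_unitarymx hU hV.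
exists (U *m V), p, q; split => //.
- rewrite /udiag dagM -!mulmxA; congr (_ *m _); rewrite !mulmxA -eD.
  by rewrite !mulmxA uU mul1mx -(mulmxA _ (dag U)) uU mulmx1.
- move=> x; have /existsP[i hi] : [exists i, U x i != 0].
    apply: contraT; rewrite negb_exists => /forallP h.
    have /matrixP/(_ x x) := uU.1; rewrite !mxE eqxx big1 => [/esym/eqP|i _].
      by rewrite oner_eq0.
    by have := h i; rewrite negbK => /eqP ->; rewrite mul0r.
  by exists i; exact: Uq.
(* The entries erased by the pinching join different eigenspaces, so they are multiplied by a zero
   entry of row [x] of [U]. *)
- move=> x; rewrite /dent dagM !mulmxA -(mulmxA U V) -(mulmxA U (V *m A)) eA'.
  have -> : (p x)%:C = (U *m P *m dag U) x x by rewrite eP !mxE eqxx.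
  rewrite !mxE; apply: eq_bigr => j _; rewrite !mxE !mulr_suml.
  apply: eq_bigr => i _; rewrite !mxE; case: ifP => // hij.
  have [Ui|Ui] := eqVneq (U x i) 0; first by rewrite Ui !mul0r.
  have [Uj|Uj] := eqVneq (U x j) 0; first by rewrite Uj rmorph0 !mulr0.
  by move: hij; rewrite ht -(Uq _ _ Ui) -(Uq _ _ Uj) eqxx.
- move=> x.
  have -> : udiag (U *m V) p = dag V *m P *m V.
    rewrite /udiag dagM -!mulmxA; congr (_ *m _); rewrite !mulmxA -eP.
    by rewrite !mulmxA uU mul1mx -(mulmxA _ (dag U)) uU mulmx1.
  have -> : A = dag V *m A' *m V.
    by rewrite -eA' !mulmxA uV mul1mx -(mulmxA _ (dag V)) uV mulmx1.
  rewrite !qf_conj -[in leLHS](sum_vpart t (V *m x)) -pinching_qf.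
  exact: qf_sum_le.
Qed.

(** Different types may give equal eigenvalues. A pinching finer than the eigenspaces would not do,
    since [U] could then mix blocks with a common eigenvalue. *)
Lemma pinching_basis (R : realType) n (C : finType) (A V : 'M[R[i]]_n)
  (l : 'I_n -> R) (t : 'I_n -> C) :
  psd A -> V \is unitarymx -> (forall i j, t i = t j -> l i = l j) ->
  exists W (p q : 'I_n -> R), [/\ W \is unitarymx, udiag V l = udiag W q,
    forall x, exists i, q x = l i, forall x, dent W A x = (p x)%:C &
    forall x, qf A x <= #|C|%:R * qf (udiag W p) x].
Proof.
move=> pA hV ht.
(* Labels of representatives coincide exactly when the eigenvalues do. *)
pose rep i := odflt i [pick j | l j == l i].
have lrep i : l (rep i) = l i by rewrite /rep; case: pickP => //= j /eqP.
apply: (pinching_basis_aux (t := fun i => t (rep i))) => // i j.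
apply/eqP/eqP => [/ht|e]; first by rewrite !lrep.
congr t; rewrite /rep e; case: pickP => //= /(_ j); by rewrite eqxx.
Qed.

(** * Matrix powers and the sandwiched trace functional *)

Definition pospow (R : realType) (p l : R) : R := if 0 < l then l `^ p else 0.

Lemma pospow_ge0 (R : realType) (p l : R) : 0 <= pospow p l.
Proof. by rewrite /pospow; case: ifP => // _; exact: powR_ge0. Qed.

(** Exponent 0 is excluded because at [l = 0] it gives 1 for [powR] and 0 for [pospow]. *)
Lemma pospowE (R : realType) (p l : R) : p != 0 -> 0 <= l -> pospow p l = l `^ p.
Proof.
move=> p0; rewrite le_eqVlt /pospow => /orP[/eqP <-|->//].
by rewrite ltxx powR0.
Qed.

Lemma powR_prod (R : realType) (p : R) n (l : 'I_n -> R) :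
  (forall k, 0 <= l k) -> (\prod_k l k) `^ p = \prod_k l k `^ p.
Proof.
move=> l0; have [_ ->//] : 0 <= \prod_k l k /\ (\prod_k l k) `^ p = \prod_k l k `^ p.
elim/big_rec2: _ => [|k y x _ [x0 <-]]; first by rewrite powR1.
by rewrite mulr_ge0// powRM.
Qed.

Lemma pospow_prod (R : realType) (p : R) n (l : 'I_n -> R) :
  (forall k, 0 <= l k) -> pospow p (\prod_k l k) = \prod_k pospow p (l k).
Proof.
move=> l0; rewrite /pospow; have [h|h] := boolP [forall k, 0 < l k].
  move/forallP in h; rewrite prodr_gt0//.
  under [RHS]eq_bigr do rewrite h.
  by rewrite powR_prod.
move: h; rewrite negb_forall => /existsP[k hk].
have lk : l k = 0 by apply/eqP; rewrite eq_le l0 leNgt hk.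
by rewrite (bigD1 k)//= lk mul0r ltxx [RHS](bigD1 k)//= lk ltxx mul0r.
Qed.

Lemma mpow_udiag (R : realType) n (V : 'M[R[i]]_n) (l : 'I_n -> R) p :
  V \is unitarymx -> mpow p (udiag V l) = udiag V (fun i => pospow p (l i)).
Proof. by move=> hV; rewrite /mpow mfun_udiag. Qed.

Lemma psd_mpow (R : realType) n (A : 'M[R[i]]_n) p : psd A -> psd (mpow p A).
Proof.
move=> /psd_udiagP[V [l [hV l0 ->]]]; rewrite mpow_udiag//.
by apply: psd_udiag => i; exact: pospow_ge0.
Qed.

Lemma mpow_ntensmx (R : realType) d n (A : 'M[R[i]]_d) p : psd A ->
  mpow p (ntensmx A n) = ntensmx (mpow p A) n.
Proof.
move=> /psd_udiagP[V [l [hV l0 ->]]].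
rewrite ntensmx_udiag !mpow_udiag ?unitary_ntensmx// ntensmx_udiag.
by apply: eq_udiag => i; rewrite pospow_prod.
Qed.

Lemma psd_trace_ge0 (R : realType) n (A : 'M[R[i]]_n) : psd A -> 0 <= \tr A.
Proof.
move=> /psd_udiagP[V [l [hV l0 ->]]]; rewrite trace_udiag// ler0c.
exact: sumr_ge0.
Qed.

Lemma rtrK (R : realType) n (A : 'M[R[i]]_n) : psd A -> (rtr A)%:C = \tr A.
Proof. by move=> pA; apply: ge0_ReK; exact: psd_trace_ge0. Qed.

Lemma psd_sandwich (R : realType) n (A B : 'M[R[i]]_n) p :
  psd A -> psd B -> psd (mpow p B *m A *m mpow p B).
Proof.
move=> pA pB; rewrite -[X in X *m A](proj1 (psd_mpow p pB)).
exact: psd_conj.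
Qed.

Definition sandQ (R : realType) n (b : R) (A B : 'M[R[i]]_n) : R :=
  rtr (mpow b (mpow ((1 - b) / (2 * b)) B *m A *m mpow ((1 - b) / (2 * b)) B)).

Lemma sandQ_ntensmx (R : realType) d n b (A B : 'M[R[i]]_d) : psd A -> psd B ->
  sandQ b (ntensmx A n) (ntensmx B n) = sandQ b A B ^+ n.
Proof.
move=> pA pB; rewrite /sandQ !mpow_ntensmx// -!ntensmx_mul.
set Y := _ *m _.
have pY : psd Y by exact: psd_sandwich.
rewrite mpow_ntensmx//; apply: complexI.
rewrite (rtrK (psd_ntensmx n (psd_mpow b pY))) mxtrace_ntensmx.
by rewrite -(rtrK (psd_mpow b pY)) -[LHS]rmorphXn.
Qed.

(** Transition probabilities between two orthonormal bases. They form a doubly stochastic matrix,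
    the means of comparing operators with different eigenbases. *)
Definition overlap (R : realType) n (V W : 'M[R[i]]_n) (i j : 'I_n) : R :=
  complex.Re (`|(V *m dag W) i j| ^+ 2).

Lemma overlapE (R : realType) n (V W : 'M[R[i]]_n) i j :
  (overlap V W i j)%:C = `|(V *m dag W) i j| ^+ 2.
Proof. by rewrite /overlap ge0_ReK// exprn_ge0. Qed.

Lemma overlap_ge0 (R : realType) n (V W : 'M[R[i]]_n) i j : 0 <= overlap V W i j.
Proof. by rewrite -ler0c overlapE exprn_ge0. Qed.

Lemma overlap_sum (R : realType) n (V W : 'M[R[i]]_n) i :
  V \is unitarymx -> W \is unitarymx -> \sum_j overlap V W i j = 1.
Proof.
move=> /unitaryP hV /unitaryP hW; apply: complexI; rewrite sumRC.
under eq_bigr do rewrite overlapE normCK.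
transitivity ((V *m dag W *m dag (V *m dag W)) i i).
  by rewrite [RHS]mxE; apply: eq_bigr => j _; rewrite dagE.
by rewrite dagM dagK mulmxA -(mulmxA V) hW mulmx1 hV mxE eqxx.
Qed.

Lemma overlapC (R : realType) n (V W : 'M[R[i]]_n) i j :
  overlap V W i j = overlap W V j i.
Proof.
apply: complexI; rewrite !overlapE; congr (_ ^+ 2).
have -> : V *m dag W = dag (W *m dag V) by rewrite dagM dagK.
by rewrite dagE norm_conjC.
Qed.

Lemma dent_overlap (R : realType) n (V W : 'M[R[i]]_n) (z : 'I_n -> R) i :
  dent V (udiag W z) i = (\sum_j overlap V W i j * z j)%:C.
Proof.
rewrite /dent /udiag !mulmxA -(mulmxA _ W).
have -> : W *m dag V = dag (V *m dag W) by rewrite dagM dagK.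
move: (V *m dag W) (@overlapE R n V W i) => M hM.
rewrite mxE sumRC; apply: eq_bigr => j _.
by rewrite mul_mx_diag !mxE rmorphM /= hM normCK mulrAC.
Qed.

Lemma dent_sandwich (R : realType) n (W A : 'M[R[i]]_n) (f : 'I_n -> R) x :
  W \is unitarymx -> dent W (udiag W f *m A *m udiag W f) x =
  (f x ^+ 2)%:C * dent W A x.
Proof.
move=> /unitaryP hW; rewrite /dent /udiag !mulmxA hW mul1mx -!mulmxA hW mulmx1.
rewrite !mulmxA -(mulmxA (cdiag f)) -(mulmxA (cdiag f)) mul_mx_diag mul_diag_mx !mxE.
rewrite mulrAC -rmorphM -expr2; congr (_ * _).
Qed.

Lemma pospow_sandwich (R : realType) (b p q : R) : 1 < b -> 0 <= p -> 0 <= q ->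
  (pospow ((1 - b) / (2 * b)) q ^+ 2 * p) `^ b = p `^ b * q `^ (1 - b).
Proof.
move=> b1 p0; rewrite le_eqVlt => /orP[/eqP <-|q0].
  rewrite /pospow ltxx expr0n mul0r !powR0 ?mulr0//; first by lra.
  by apply/eqP; lra.
rewrite /pospow q0 powRM ?exprn_ge0 ?powR_ge0// mulrC; congr (_ * _).
rewrite -powR_mulrn ?powR_ge0// -!powRrM; congr (_ `^ _).
by field; apply/eqP; lra.
Qed.

(** Measuring in an eigenbasis of [B] does not increase the functional: the diagonal of the
    sandwiched operator in [W] is a doubly stochastic average of its eigenvalues. *)
Lemma sandQ_lower (R : realType) n (W A B : 'M[R[i]]_n) (p q : 'I_n -> R) b :
  1 < b -> psd A -> W \is unitarymx -> (forall x, 0 <= q x) -> B = udiag W q ->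
  (forall x, dent W A x = (p x)%:C) ->
  \sum_x p x `^ b * q x `^ (1 - b) <= sandQ b A B.
Proof.
move=> b1 pA hW q0 eB hp.
have p0 x : 0 <= p x by rewrite -ler0c -hp dentE; exact: psd_qf.
have pB : psd B by rewrite eB; exact: psd_udiag.
pose s := (1 - b) / (2 * b).
have [V [w [hV w0 eY]]] := psd_udiagP (psd_sandwich s pA pB).
rewrite /sandQ -/s eY mpow_udiag// /rtr trace_udiag//=.
have -> : \sum_i pospow b (w i) = \sum_i w i `^ b.
  by apply: eq_bigr => i _; rewrite pospowE//; apply/eqP; lra.
have -> : \sum_x p x `^ b * q x `^ (1 - b) = \sum_x (pospow s (q x) ^+ 2 * p x) `^ b.
  by apply: eq_bigr => x _; rewrite pospow_sandwich.
apply: (doubly_stochastic_powR (B := overlap W V)) => //.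
- by move=> x y; exact: overlap_ge0.
- by move=> x; exact: overlap_sum.
- by move=> y; under eq_bigr do rewrite overlapC; exact: overlap_sum.
- by move=> x; rewrite mulr_ge0 ?exprn_ge0 ?pospow_ge0.
- move=> x; rewrite -lecR -dent_overlap -eY eB mpow_udiag// dent_sandwich// hp.
  by rewrite -rmorphM.
Qed.

(** The reverse direction: an eigenvalue of the sandwiched operator is its quadratic form at an
    eigenvector, which the operator bound [hv] turns into [v] times a doubly stochastic average of
    the pinched values. *)
Lemma sandQ_upper (R : realType) n (W A B : 'M[R[i]]_n) (p q : 'I_n -> R) b (v : R) :
  1 < b -> 0 <= v -> psd A -> W \is unitarymx -> (forall x, 0 <= q x) -> B = udiag W q ->
  (forall x, dent W A x = (p x)%:C) ->
  (forall x, qf A x <= v%:C * qf (udiag W p) x) ->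
  sandQ b A B <= v `^ b * \sum_x p x `^ b * q x `^ (1 - b).
Proof.
move=> b1 v0 pA hW q0 eB hp hv.
have p0 x : 0 <= p x by rewrite -ler0c -hp dentE; exact: psd_qf.
have pB : psd B by rewrite eB; exact: psd_udiag.
pose s := (1 - b) / (2 * b).
have [V [w [hV w0 eY]]] := psd_udiagP (psd_sandwich s pA pB).
rewrite /sandQ -/s eY mpow_udiag// /rtr trace_udiag//=.
have -> : \sum_i pospow b (w i) = \sum_i w i `^ b.
  by apply: eq_bigr => i _; rewrite pospowE//; apply/eqP; lra.
have -> : \sum_x p x `^ b * q x `^ (1 - b) = \sum_x (pospow s (q x) ^+ 2 * p x) `^ b.
  by apply: eq_bigr => x _; rewrite pospow_sandwich.
pose z x := pospow s (q x) ^+ 2 * p x.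
have z0 x : 0 <= z x by rewrite mulr_ge0 ?exprn_ge0 ?pospow_ge0.
have -> : v `^ b * \sum_x z x `^ b = \sum_x (v * z x) `^ b.
  by rewrite mulr_sumr; apply: eq_bigr => x _; rewrite powRM.
apply: (doubly_stochastic_powR (B := overlap V W)) => //.
- by move=> x y; exact: overlap_ge0.
- by move=> x; exact: overlap_sum.
- by move=> y; under eq_bigr do rewrite overlapC; exact: overlap_sum.
- by move=> x; rewrite mulr_ge0.
- move=> y; rewrite -lecR -(dent_udiag w y hV) -eY dentE.
  set u := dag (row y V).
  have hS : mpow s B = dag (mpow s B) by rewrite (proj1 (psd_mpow s pB)).
  rewrite {1}hS qf_conj; apply: le_trans (hv _) _.
  rewrite -qf_conj -hS eB mpow_udiag// !udiagM//.
  have -> : udiag W (fun i => pospow s (q i) * p i * pospow s (q i)) = udiag W z.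
    by apply: eq_udiag => i; rewrite /z expr2 mulrAC.
  rewrite -dentE dent_overlap -rmorphM lecR mulr_sumr.
  by apply: ler_sum => x _; rewrite mulrCA.
Qed.

(** * Trace distance and channels *)

Lemma bf_conj (R : realType) n (A : 'M[R[i]]_n) x y :
  Defs.hermitian A -> bf A y x = Num.conj (bf A x y).
Proof. by move=> hA; rewrite /bf -dagE !dagM dagK hA mulmxA. Qed.

Lemma bfZl (R : realType) n (A : 'M[R[i]]_n) a x y :
  bf A (a *: x) y = Num.conj a * bf A x y.
Proof. by rewrite /bf dagZ -!scalemxAl mxE. Qed.

Lemma bfZr (R : realType) n (A : 'M[R[i]]_n) a x y : bf A x (a *: y) = a * bf A x y.
Proof. by rewrite /bf -!scalemxAr mxE. Qed.

Lemma qf_lin (R : realType) n (A : 'M[R[i]]_n) (a b : R[i]) x y :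
  qf A (a *: x - b *: y) = Num.conj a * a * qf A x + Num.conj b * b * qf A y
    - Num.conj a * b * bf A x y - Num.conj b * a * bf A y x.
Proof.
have h z : qf A z = bf A z z by [].
by rewrite qfB_vec !h !bfZl !bfZr !mulrA.
Qed.

(** The hypothesis is the expanded quadratic form at [qf A y *: x - bf A y x *: y], and it factors
    as [Y] times the wanted difference. *)
Lemma cauchy_schwarz_scalar (K : numClosedFieldType) (X Y c : K) : 0 < Y ->
  0 <= Num.conj Y * Y * X + Num.conj (Num.conj c) * Num.conj c * Y
    - Num.conj Y * Num.conj c * c - Num.conj (Num.conj c) * Y * Num.conj c ->
  `|c| ^+ 2 <= X * Y.
Proof.
move=> Y0; have -> : Num.conj Y = Y by apply/CrealP; exact: gtr0_real.
rewrite conjCK normCK.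
have -> : Y * Y * X + c * Num.conj c * Y - Y * Num.conj c * c - c * Y * Num.conj c
  = Y * (X * Y - c * Num.conj c) by ring.
by rewrite pmulr_rge0// subr_ge0.
Qed.

Lemma cauchy_schwarz (R : realType) n (A : 'M[R[i]]_n) x y : psd A ->
  `|bf A x y| ^+ 2 <= qf A x * qf A y.
Proof.
move=> pA; have qx := psd_qf x pA; have qy := psd_qf y pA.
have [B eB] := psd_gramP pA.
have [y0|yn0] := eqVneq (qf A y) 0.
  have By : B *m y = 0.
    apply/matrixP => i j; rewrite (ord1 j) [RHS]mxE.
    move: y0; rewrite eB qf_gram qf1 => /eqP.
    rewrite psumr_eq0 => [/allP/(_ i)|k _]; last by rewrite exprn_ge0.
    by rewrite mem_index_enum => /(_ isT); rewrite expf_eq0 normr_eq0 => /eqP.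
  by rewrite y0 mulr0 /bf eB -!mulmxA By !mulmx0 mxE normr0 expr0n.
have yp : 0 < qf A y by rewrite lt_neqAle eq_sym yn0.
have := psd_qf (qf A y *: x - bf A y x *: y) pA.
by rewrite qf_lin (bf_conj x y (proj1 pA)); exact: cauchy_schwarz_scalar.
Qed.

Lemma trace_mul_udiag (R : realType) n (A V : 'M[R[i]]_n) (l : 'I_n -> R) :
  \tr (A *m udiag V l) = \sum_i dent V A i * (l i)%:C.
Proof.
rewrite /udiag !mulmxA mxtrace_mulC !mulmxA /mxtrace; apply: eq_bigr => i _.
by rewrite /dent mul_mx_diag [LHS]mxE [X in _ * X]mxE.
Qed.

Lemma trace_outer (R : realType) n (A : 'M[R[i]]_n) x : \tr (A *m (x *m dag x)) = qf A x.
Proof. by rewrite mulmxA mxtrace_mulC mulmxA /mxtrace big_ord1. Qed.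

Lemma psd_trace_mul (R : realType) n (A B : 'M[R[i]]_n) :
  psd A -> psd B -> 0 <= \tr (A *m B).
Proof.
move=> pA /psd_udiagP[V [l [hV l0 ->]]]; rewrite trace_mul_udiag.
by apply: sumr_ge0 => i _; rewrite mulr_ge0 ?ler0c// dentE; exact: psd_qf.
Qed.

Lemma trnorm_udiag (R : realType) n (V : 'M[R[i]]_n) (x : 'I_n -> R) :
  V \is unitarymx -> trnorm (udiag V x) = \sum_i `|x i|.
Proof.
move=> hV; rewrite /trnorm dag_udiag udiagM// mfun_udiag// /rtr trace_udiag//=.
by apply: eq_bigr => i _; rewrite -expr2 sqrtr_sqr.
Qed.

Lemma dent_psd (R : realType) n (V Q : 'M[R[i]]_n) i : psd Q -> 0 <= dent V Q i.
Proof. by rewrite dentE; exact: psd_qf. Qed.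

Lemma dentB (R : realType) n (V A B : 'M[R[i]]_n) i :
  dent V (A - B) i = dent V A i - dent V B i.
Proof. by rewrite /dent mulmxBr mulmxBl !mxE. Qed.

Lemma dent1 (R : realType) n (V : 'M[R[i]]_n) i : V \is unitarymx -> dent V 1%:M i = 1.
Proof. by move=> /unitaryP hV; rewrite /dent mulmx1 hV mxE eqxx. Qed.

Lemma sqrD_le (K : numDomainType) (a b : K) : a \is Num.real -> b \is Num.real ->
  (a + b) ^+ 2 <= 2 * (a ^+ 2 + b ^+ 2).
Proof.
move=> ra rb; rewrite -subr_ge0.
have -> : 2 * (a ^+ 2 + b ^+ 2) - (a + b) ^+ 2 = (a - b) ^+ 2 by ring.
by rewrite real_exprn_even_ge0// rpredB.
Qed.

Lemma tdist_pure_le_arith (K : numDomainType) (a T u v : K) :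
  T <= 1 - a -> a * v <= v -> a * (1 - (u - v)) <= 1 - (T + (a * u - v)).
Proof.
move=> hT hv; rewrite -subr_ge0.
have -> : 1 - (T + (a * u - v)) - a * (1 - (u - v)) = (1 - a - T) + (v - a * v) by ring.
by rewrite addr_ge0// subr_ge0.
Qed.

Lemma half_sum_norm (R : realType) (I : finType) (x : I -> R) : \sum_i x i = 0 ->
  2^-1 * \sum_i `|x i| = \sum_i Num.max 0 (x i).
Proof.
move=> x0; have -> : \sum_i `|x i| = \sum_i (`|x i| + x i).
  by rewrite big_split /= x0 addr0.
rewrite mulr_sumr; apply: eq_bigr => i _; case: (leP 0 (x i)) => h.
  by rewrite ger0_norm//; lra.
by rewrite ltr0_norm//; lra.
Qed.

(** Variational characterization of the trace distance: for trace 0, half the trace norm is the sum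
    of the positive eigenvalues, and no effect [Q] collects more. The projector on the positive part
    attains it. *)
Lemma half_trnorm_ge (R : realType) n (X Q : 'M[R[i]]_n) :
  Defs.hermitian X -> \tr X = 0 -> psd Q -> psd (1%:M - Q) ->
  \tr (Q *m X) <= (2^-1 * trnorm X)%:C.
Proof.
move=> /hermitian_udiag[V [x [hV ->]]]; rewrite trace_udiag// trnorm_udiag//.
move=> /(congr1 (@complex.Re R)) /= x0 pQ pQ1.
have -> : 2^-1 * \sum_i `|x i| = \sum_i Num.max 0 (x i).
  exact: half_sum_norm.
rewrite trace_mul_udiag sumRC; apply: ler_sum => i _.
have d0 := dent_psd V i pQ.
have d1 : dent V Q i <= 1.
  by have := dent_psd V i pQ1; rewrite dentB dent1// subr_ge0.
case: (leP 0 (x i)) => h; first by rewrite ler_piMl// ler0c.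
by rewrite mulr_ge0_le0// (lecR _ 0) ltW.
Qed.

Lemma half_trnorm_attained (R : realType) n (X : 'M[R[i]]_n) :
  Defs.hermitian X -> \tr X = 0 -> exists P : 'M[R[i]]_n,
  [/\ psd P, psd (1%:M - P) & (2^-1 * trnorm X)%:C = \tr (P *m X)].
Proof.
move=> /hermitian_udiag[V [x [hV ->]]]; rewrite trace_udiag// trnorm_udiag//.
move=> /(congr1 (@complex.Re R)) /= x0.
pose e i : R := (0 < x i)%R%:R.
exists (udiag V e); split.
- by apply: psd_udiag => i; rewrite /e ler0n.
- rewrite -(udiag1 hV) -udiagB; apply: psd_udiag => i.
  by rewrite subr_ge0 /e; case: (0 < x i); rewrite ?lexx ?ler01.
- rewrite udiagM// trace_udiag//; congr (_%:C).
  rewrite half_sum_norm//; apply: eq_bigr => i _; rewrite /e.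
  by case: ltP => h; rewrite ?mul1r ?mul0r.
Qed.

Lemma trnorm_ge0 (R : realType) n (X : 'M[R[i]]_n) :
  Defs.hermitian X -> 0 <= trnorm X.
Proof.
by move=> /hermitian_udiag[V [x [hV ->]]]; rewrite trnorm_udiag// sumr_ge0.
Qed.

Lemma qf1_dag (R : realType) n (x : 'cV[R[i]]_n) : qf 1%:M x = (dag x *m x) 0 0.
Proof. by rewrite /qf mulmx1. Qed.

Lemma outer_idem (R : realType) n (x : 'cV[R[i]]_n) : qf 1%:M x = 1 ->
  (x *m dag x) *m (x *m dag x) = x *m dag x.
Proof.
move=> x1; rewrite mulmxA -(mulmxA x) [dag x *m x]mx11_scalar -qf1_dag x1.
by rewrite mulmx1.
Qed.

Lemma dag_outer (R : realType) n (x : 'cV[R[i]]_n) : dag (x *m dag x) = x *m dag x.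
Proof. by rewrite dagM dagK. Qed.

Lemma psd_compl_outer (R : realType) n (x : 'cV[R[i]]_n) : qf 1%:M x = 1 ->
  psd (1%:M - x *m dag x).
Proof.
move=> x1.
have -> : 1%:M - x *m dag x = dag (1%:M - x *m dag x) *m (1%:M - x *m dag x).
  rewrite dagD dagN dag1 dag_outer mulmxBr mulmx1 mulmxBl mul1mx outer_idem//.
  by rewrite subrr subr0.
exact: psd_gram.
Qed.

Lemma trace_outer1 (R : realType) n (x : 'cV[R[i]]_n) : \tr (x *m dag x) = qf 1%:M x.
Proof. by rewrite -[X in \tr X]mul1mx trace_outer. Qed.

Lemma tdist_herm (R : realType) n (w : 'M[R[i]]_n) (x : 'cV[R[i]]_n) :
  density w -> qf 1%:M x = 1 ->
  Defs.hermitian (w - x *m dag x) /\ \tr (w - x *m dag x) = 0.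
Proof.
move=> [pw tw] x1; split; first by rewrite /Defs.hermitian dagD dagN dag_outer (proj1 pw).
by rewrite mxtraceD raddfN /= tw trace_outer1 x1 subrr.
Qed.

(** The discriminating test is the complement of the projector on [x], which never fires on [x]
    itself. *)
Lemma tdist_pure_ge (R : realType) n (w : 'M[R[i]]_n) (x : 'cV[R[i]]_n) :
  density w -> qf 1%:M x = 1 -> (1 - tdist w (x *m dag x))%:C <= qf w x.
Proof.
move=> dw x1; have [hX tX] := tdist_herm dw x1; have [pw tw] := dw.
have pQ : psd (1%:M - (1%:M - x *m dag x)).
  by rewrite opprB addrCA subrr addr0; exact: psd_cogram.
have := half_trnorm_ge hX tX (psd_compl_outer x1) pQ.
rewrite mulmxBl mul1mx mxtraceD raddfN /= tX add0r mulmxBr outer_idem// mxtraceD raddfN /=.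
rewrite mxtrace_mulC trace_outer trace_outer1 x1 opprB.
by rewrite rmorphB /= rmorph1 lerBlDr -lerBlDl.
Qed.

(** The inner product is split along [P] and [1 - P]. Cauchy-Schwarz bounds the two parts by
    [qf P x] and [1 - qf P f], and squaring the sum costs the factor 2. *)
Lemma overlap_split (R : realType) n (P : 'M[R[i]]_n) (f x : 'cV[R[i]]_n) :
  psd P -> psd (1%:M - P) -> qf 1%:M f = 1 -> qf 1%:M x = 1 ->
  `|bf 1%:M f x| ^+ 2 <= 2 * (1 - (qf P f - qf P x)).
Proof.
move=> pP pP1 f1 x1.
have e : bf 1%:M f x = bf P f x + bf (1%:M - P) f x.
  by rewrite /bf mulmxBr mulmxBl [X in _ = _ + X]mxE [X in _ + (_ + X)]mxE addrC subrK.
have qf_le1 y : qf 1%:M y = 1 -> 0 <= qf P y <= 1.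
  move=> y1; rewrite psd_qf//= -y1 -subr_ge0 -qfN -qfD; exact: psd_qf.
have c1 : `|bf P f x| ^+ 2 <= qf P x.
  apply: le_trans (cauchy_schwarz f x pP) _.
  by case/andP: (qf_le1 _ f1) => h0 h1; rewrite ler_piMl// psd_qf.
have c2 : `|bf (1%:M - P) f x| ^+ 2 <= 1 - qf P f.
  apply: le_trans (cauchy_schwarz f x pP1) _.
  rewrite !(qfD, qfN) f1 x1; case/andP: (qf_le1 _ f1) => _ h1.
  by case/andP: (qf_le1 _ x1) => h0 _; rewrite ler_piMr ?subr_ge0// gerBl.
rewrite e; set a := bf P f x in c1 *; set b := bf _ f x in c2 *.
apply: (@le_trans _ _ (2 * (`|a| ^+ 2 + `|b| ^+ 2))); last first.
  by rewrite ler_pM2l//; apply: le_trans (lerD c1 c2) _; rewrite opprB addrCA.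
apply: (@le_trans _ _ ((`|a| + `|b|) ^+ 2)).
  by rewrite lerXn2r ?nnegrE ?addr_ge0// ler_normD.
by apply: sqrD_le; exact: normr_real.
Qed.

(** For the optimal test [P], the part of [w] beyond [a] times the projector on [f] contributes at
    most [1 - a] to the distance; what remains is [a] times the quantity bounded in
    [overlap_split]. *)
Lemma tdist_pure_le (R : realType) n (w : 'M[R[i]]_n) (f x : 'cV[R[i]]_n) (a : R) :
  density w -> 0 <= a <= 1 -> psd (w - a%:C *: (f *m dag f)) ->
  qf 1%:M f = 1 -> qf 1%:M x = 1 ->
  a%:C * `|bf 1%:M f x| ^+ 2 <= 2 * (1 - tdist w (x *m dag x))%:C.
Proof.
move=> dw /andP[a0 a1] pD f1 x1; have [hX tX] := tdist_herm dw x1; have [pw tw] := dw.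
have [P [pP pP1 eP]] := half_trnorm_attained hX tX.
have hov := overlap_split pP pP1 f1 x1.
apply: (@le_trans _ _ (a%:C * (2 * (1 - (qf P f - qf P x))))).
  by rewrite ler_wpM2l// ler0c.
rewrite mulrCA ler_pM2l// rmorphB /= rmorph1 /tdist eP.
have hD : \tr (P *m (w - a%:C *: (f *m dag f))) <= 1 - a%:C.
  have := psd_trace_mul pP1 pD.
  rewrite mulmxBl mul1mx mxtraceD raddfN /= subr_ge0 => h; apply: le_trans h _.
  by rewrite mxtraceD raddfN /= mxtraceZ trace_outer1 f1 mulr1 tw.
have -> : P *m (w - x *m dag x) = P *m (w - a%:C *: (f *m dag f)) +
   (a%:C *: (P *m (f *m dag f)) - P *m (x *m dag x)).
  by rewrite !mulmxBr -scalemxAr addrA subrK.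
rewrite !mxtraceD raddfN /= mxtraceZ !trace_outer.
move: hD; set T := \tr _ => hD.
have qx : 0 <= qf P x by exact: psd_qf.
have hax : a%:C * qf P x <= qf P x by rewrite ler_piMl// (lecR _ 1).
exact: tdist_pure_le_arith.
Qed.

(** * Channels: duality and Kraus representations *)

Lemma channel_dual (R : realType) m k (E : 'M[R[i]]_m -> 'M[R[i]]_k) :
  is_channel E -> exists D : 'M[R[i]]_k -> 'M[R[i]]_m,
  [/\ forall X Y, \tr (Y *m E X) = \tr (D Y *m X), forall Y, psd Y -> psd (D Y),
      D 1%:M = 1%:M, forall Y Z, D (Y - Z) = D Y - D Z & forall a Y, D (a *: Y) = a *: D Y].
Proof.
move=> [s [s1 hE]]; exists (fun Y => \sum_(K <- s) dag K *m Y *m K); split.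
- move=> X Y; rewrite hE mulmx_sumr mulmx_suml !raddf_sum /=.
  apply: eq_bigr => K _.
  by rewrite !mulmxA mxtrace_mulC !mulmxA.
- by move=> Y pY; apply: psd_sum => K _; exact: psd_conj.
- by rewrite -[RHS]s1; apply: eq_bigr => K _; rewrite mulmx1.
- move=> Y Z; rewrite -sumrB; apply: eq_bigr => K _.
  by rewrite mulmxBr mulmxBl.
- move=> a Y; rewrite scaler_sumr; apply: eq_bigr => K _.
  by rewrite -scalemxAr -scalemxAl.
Qed.

Lemma channel_density (R : realType) m k (E : 'M[R[i]]_m -> 'M[R[i]]_k) X :
  is_channel E -> density X -> density (E X).
Proof.
move=> cE [pX tX]; split.
  case: cE => s [_ ->]; apply: psd_sum => K _.
  by rewrite -{1}[K]dagK; exact: psd_conj.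
have [D [hD _ D1 _ _]] := channel_dual cE.
by rewrite -[E X]mul1mx hD D1 mul1mx.
Qed.

Lemma qf_outer (R : realType) n (x y : 'cV[R[i]]_n) :
  qf (y *m dag y) x = `|bf 1%:M y x| ^+ 2.
Proof.
rewrite normCKC -bf_conj; last exact: dag1.
rewrite /qf /bf !mulmx1 !mulmxA -(mulmxA (dag x *m y)).
by rewrite mxE big_ord1.
Qed.

Lemma psd_norm_outer (R : realType) n (y : 'cV[R[i]]_n) :
  psd (qf 1%:M y *: 1%:M - y *m dag y).
Proof.
split.
  rewrite /Defs.hermitian dagD dagN dag_outer dagZ dag1; congr (_ *: _ - _).
  by apply/CrealP; apply: ger0_real; exact: qf1_ge0.
move=> x; rewrite -/(qf _ _) qfD qfN qfZ qf_outer subr_ge0.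
by apply: cauchy_schwarz; exact: psd1.
Qed.

Lemma mul_delta_sandwich (R : realType) m n (A : 'M[R[i]]_n) (i : 'I_n) (j j' : 'I_m) :
  delta_mx j i *m A *m delta_mx i j' = A i i *: delta_mx j j'.
Proof.
apply/matrixP => a b; rewrite !mxE (bigD1 i)//= big1 ?addr0; last first.
  by move=> c ci; rewrite !mxE (negbTE ci) mulr0.
rewrite !mxE (bigD1 i)//= big1 ?addr0; last first.
  by move=> c ci; rewrite !mxE (negbTE ci) andbF mul0r.
rewrite !mxE !eqxx andbT.
by case: (a == j); case: (b == j'); rewrite /= ?mul1r ?mul0r ?mulr1 ?mulr0.
Qed.

Lemma sum_delta_diag (R : realType) n : \sum_(i < n) delta_mx i i = 1%:M :> 'M[R[i]]_n.
Proof.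
apply/matrixP => a b; rewrite summxE (bigD1 a)//= big1 ?addr0; last first.
  by move=> c ca; rewrite mxE eq_sym (negbTE ca).
by rewrite !mxE eqxx /= eq_sym.
Qed.

Lemma dag_delta (R : realType) m n (i : 'I_m) (j : 'I_n) :
  dag (delta_mx i j : 'M[R[i]]_(m, n)) = delta_mx j i.
Proof. by apply/matrixP => a b; rewrite dagE !mxE andbC rmorph_nat. Qed.

Lemma sum_triple (V : nmodType) (X I J : finType) (F : X * (I * J) -> V) :
  \sum_t F t = \sum_x \sum_i \sum_j F (x, (i, j)).
Proof.
transitivity (\sum_x \sum_p F (x, p)).
  by rewrite pair_big /=; apply: eq_bigr => -[].
by apply: eq_bigr => x _; rewrite pair_big /=; apply: eq_bigr => -[].
Qed.

(** With M = B^* B and tau = C C^*, the Kraus operators are C E_ij B for the matrix units E_ij: the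
    sum over j produces the outcome probability, the sum over i rebuilds the prepared state. *)
Lemma measure_prepare_channel (R : realType) m k (X : finType)
  (M : X -> 'M[R[i]]_m) (tau : X -> 'M[R[i]]_k) :
  (forall x, psd (M x)) -> \sum_x M x = 1%:M -> (forall x, density (tau x)) ->
  is_channel (fun Y => \sum_x \tr (M x *m Y) *: tau x).
Proof.
move=> pM sM dt.
have [B eB] : exists B : X -> 'M[R[i]]_m, forall x, M x = dag (B x) *m B x.
  by exists (fun x => sval (cid (psd_gramP (pM x)))) => x; case: cid.
have [C eC] : exists C : X -> 'M[R[i]]_k, forall x, tau x = C x *m dag (C x).
  exists (fun x => dag (sval (cid (psd_gramP (proj1 (dt x)))))) => x.
  by rewrite dagK; case: cid.
pose T : finType := (X * ('I_k * 'I_m))%type.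
pose K (t : T) : 'M[R[i]]_(k, m) := C t.1 *m delta_mx t.2.1 t.2.2 *m B t.1.
exists [seq K t | t <- enum T]; split.
  rewrite big_map big_enum /=.
  transitivity (\sum_x \sum_i \sum_j dag (K (x, (i, j))) *m K (x, (i, j))).
    exact: (@sum_triple _ X _ _ (fun t : T => dag (K t) *m K t)).
  rewrite -sM; apply: eq_bigr => x _.
  transitivity (\sum_i (dag (C x) *m C x) i i *: M x).
    apply: eq_bigr => i _.
    transitivity (\sum_j (dag (C x) *m C x) i i *: (dag (B x) *m delta_mx j j *m B x)).
      apply: eq_bigr => j _; rewrite /K /= !dagM dag_delta.
      have := mul_delta_sandwich (dag (C x) *m C x) i j j.
      rewrite !mulmxA => h.
      have -> : dag (B x) *m delta_mx j i *m dag (C x) *m C x *m delta_mx i j *m B x =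
        dag (B x) *m (delta_mx j i *m dag (C x) *m C x *m delta_mx i j) *m B x.
        by rewrite !mulmxA.
      by rewrite h -scalemxAr -scalemxAl.
    rewrite -scaler_sumr -mulmx_suml -mulmx_sumr sum_delta_diag mulmx1 eB//.
  rewrite -scaler_suml.
  have -> : \sum_i (dag (C x) *m C x) i i = \tr (dag (C x) *m C x) by [].
  by rewrite mxtrace_mulC -eC (proj2 (dt x)) scale1r.
move=> Y; rewrite big_map big_enum /=.
transitivity (\sum_x \sum_i \sum_j K (x, (i, j)) *m Y *m dag (K (x, (i, j)))); last first.
  exact: esym (@sum_triple _ X _ _ (fun t : T => K t *m Y *m dag (K t))).
apply: eq_bigr => x _.
transitivity (\sum_i \tr (M x *m Y) *: (C x *m delta_mx i i *m dag (C x))).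
  rewrite -scaler_sumr -mulmx_suml -mulmx_sumr sum_delta_diag mulmx1 eC//.
apply: eq_bigr => i _.
transitivity (\sum_j (B x *m Y *m dag (B x)) j j *: (C x *m delta_mx i i *m dag (C x))).
  rewrite -scaler_suml; congr (_ *: _).
  by rewrite eB -mulmxA mxtrace_mulC.
apply: eq_bigr => j _; rewrite /K /= !dagM dag_delta.
have := mul_delta_sandwich (B x *m Y *m dag (B x)) j i i.
rewrite !mulmxA => h.
have -> : C x *m delta_mx i j *m B x *m Y *m dag (B x) *m delta_mx j i *m dag (C x) =
   C x *m (delta_mx i j *m B x *m Y *m dag (B x) *m delta_mx j i) *m dag (C x).
  by rewrite !mulmxA.
by rewrite h -scalemxAr -scalemxAl.
Qed.

(** * Converse bound *)

Lemma natRC (R : realType) n : (n%:R : R)%:C = n%:R :> R[i].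
Proof. exact: (rmorph_nat (real_complex R)). Qed.

Lemma pinched_power (R : realType) d n (rho sigma : 'M[R[i]]_d) :
  density rho -> density sigma ->
  exists W (p q : 'I_(d ^ n) -> R),
  [/\ W \is unitarymx, ntensmx sigma n = udiag W q, forall x, 0 <= q x,
      forall x, dent W (ntensmx rho n) x = (p x)%:C &
      forall x, qf (ntensmx rho n) x <= ((n.+1 ^ d)%:R : R)%:C * qf (udiag W p) x].
Proof.
move=> [pr tr] [ps ts].
have [V [l [hV l0 es]]] := psd_udiagP ps.
have [] := @pinching_basis R _ _ (ntensmx rho n) (ntensmx V n)
  (fun i => \prod_k l (tdig i k)) (@ttype d n) (psd_ntensmx n pr) (unitary_ntensmx n hV).
  by move=> i j e; rewrite !prod_ttype e.
move=> W [p [q [hW eW hq hp hle]]]; exists W, p, q; split => //.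
- by rewrite es ntensmx_udiag.
- by move=> x; have [i ->] := hq x; apply: prodr_ge0.
- by move=> x; rewrite natRC -card_ttype.
Qed.

Lemma dent_ge0 (R : realType) n (W A : 'M[R[i]]_n) (p : 'I_n -> R) : psd A ->
  (forall x, dent W A x = (p x)%:C) -> forall x, 0 <= p x.
Proof. by move=> pA hp x; rewrite -ler0c -hp; exact: dent_psd. Qed.

Lemma trace_dent (R : realType) n (W A : 'M[R[i]]_n) : W \is unitarymx ->
  \tr A = \sum_x dent W A x.
Proof.
move=> hW; rewrite -[A]mulmx1 -(udiag1 hW) trace_mul_udiag udiag1// mulmx1.
by apply: eq_bigr => i _; rewrite mulr1.
Qed.

Lemma sum_dent (R : realType) n (W A : 'M[R[i]]_n) (p : 'I_n -> R) :
  W \is unitarymx -> \tr A = 1 -> (forall x, dent W A x = (p x)%:C) ->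
  \sum_x p x = 1.
Proof.
move=> hW tA hp; apply: complexI; rewrite sumRC.
under eq_bigr do rewrite -hp.
by rewrite -trace_dent.
Qed.

Lemma supp_subP (R : realType) n (A B : 'M[R[i]]_n) :
  reflect (exists D, A = B *m D) (supp_sub A B).
Proof.
apply: (iffP submxP) => [[D e]|[D ->]]; last by exists D^T; rewrite trmx_mul.
by exists D^T; rewrite -[A]trmxK e trmx_mul trmxK.
Qed.

Lemma supp_sub_ntensmx (R : realType) d n (A B : 'M[R[i]]_d) :
  supp_sub A B -> supp_sub (ntensmx A n) (ntensmx B n).
Proof.
by move=> /supp_subP[D ->]; apply/supp_subP; exists (ntensmx D n); rewrite ntensmx_mul.
Qed.

Lemma supp_sub_dent (R : realType) n (W A B : 'M[R[i]]_n) (p q : 'I_n -> R) :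
  supp_sub A B -> W \is unitarymx -> B = udiag W q ->
  (forall x, dent W A x = (p x)%:C) -> forall x, q x = 0 -> p x = 0.
Proof.
move=> /supp_subP[D ->] /unitaryP hW -> hp x qx; apply: complexI; rewrite -hp.
rewrite /dent /udiag !mulmxA hW mul1mx -!mulmxA mul_diag_mx !mxE qx.
by rewrite mul0r.
Qed.

(** The components of the target are not normalized, so tests are bounded by a squared norm [Y]
    instead of 1; [F] will be an eigenvalue of the target. *)
Lemma test_bound_scaled (R : realType) (I : finType) (p q m : I -> R) (b F Y : R) :
  1 < b -> (forall i, 0 <= p i) -> (forall i, 0 <= q i) -> 0 <= Y ->
  (forall i, 0 <= m i <= Y) -> (forall i, q i = 0 -> p i = 0) ->
  \sum_i q i * m i = F * Y ->
  \sum_i p i * m i <= 2 * (\sum_i p i `^ b * q i `^ (1 - b)) `^ (b^-1)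
     * (Y * F `^ (1 - b^-1)).
Proof.
move=> b1 p0 q0 Y0 mY pq hF.
have [Ye|Yn] := eqVneq Y 0.
  rewrite Ye mul0r mulr0 big1// => i _.
  by have := mY i; rewrite Ye => /le_anti <-; rewrite mulr0.
have Yp : 0 < Y by rewrite lt_neqAle eq_sym Yn.
have h : forall i, 0 <= m i / Y <= 1.
  by move=> i; have /andP[h0 h1] := mY i; rewrite divr_ge0//= ler_pdivrMr// mul1r.
have := test_bound b1 p0 q0 h pq.
under eq_bigr do rewrite mulrA.
under [X in _ <= _ * (_ * X `^ _)]eq_bigr do rewrite mulrA.
rewrite -!mulr_suml hF mulfK// ler_pdivrMr// => h'; apply: le_trans h' _.
by rewrite -!mulrA [_ * Y]mulrC.
Qed.

(** Summed against [l j] to the power s, these weights give <psi|sigma2^s|psi> when [V] and [l]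
    diagonalize sigma2. *)
Definition pure_weight (R : realType) d (V : 'M[R[i]]_d) (psi : 'cV[R[i]]_d) (j : 'I_d) : R :=
  complex.Re (`|(V *m psi) j 0| ^+ 2).

Lemma pure_weightE (R : realType) d (V : 'M[R[i]]_d) (psi : 'cV[R[i]]_d) j :
  (pure_weight V psi j)%:C = `|(V *m psi) j 0| ^+ 2.
Proof. by apply: ge0_ReK; rewrite exprn_ge0. Qed.

Lemma pure_weight_ge0 (R : realType) d (V : 'M[R[i]]_d) (psi : 'cV[R[i]]_d) j :
  0 <= pure_weight V psi j.
Proof. by rewrite -ler0c pure_weightE exprn_ge0. Qed.

Lemma pure_weight_vtens (R : realType) d m (V : 'M[R[i]]_d) (psi : 'cV[R[i]]_d) i :
  pure_weight (ntensmx V m) (vtens m psi) i = \prod_k pure_weight V psi (tdig i k).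
Proof.
apply: complexI; rewrite pure_weightE prodRC mul_vtens mxE.
rewrite normr_prod -prodrXl; apply: eq_bigr => k _.
by rewrite -pure_weightE.
Qed.

Lemma qf_udiag_weight (R : realType) d (V : 'M[R[i]]_d) l (x : 'cV[R[i]]_d) :
  qf (udiag V l) x = (\sum_j pure_weight V x j * l j)%:C.
Proof.
rewrite /udiag qf_conj qfE sumRC; apply: eq_bigr => i _.
rewrite (bigD1 i)//= big1 ?addr0; last first.
  by move=> j ji; rewrite !mxE eq_sym (negbTE ji) mulr0n mulr0 mul0r.
rewrite rmorphM /= pure_weightE normCKC mulrAC; congr (_ * _).
by rewrite !mxE eqxx mulr1n.
Qed.

Lemma qf1_weight (R : realType) d (V : 'M[R[i]]_d) (x : 'cV[R[i]]_d) :
  V \is unitarymx -> qf 1%:M x = (\sum_j pure_weight V x j)%:C.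
Proof.
move=> hV; rewrite -(udiag1 hV) qf_udiag_weight; congr (_%:C).
by apply: eq_bigr => j _; rewrite mulr1.
Qed.

Lemma pure_weight_vpart (R : realType) d (C : eqType) (t : 'I_d -> C) (V : 'M[R[i]]_d) x c j :
  V \is unitarymx ->
  pure_weight V (dag V *m vpart t (V *m x) c) j = if t j == c then pure_weight V x j else 0.
Proof.
move=> /unitaryP hV; apply: complexI; rewrite pure_weightE mulmxA hV mul1mx !mxE.
case: ifP => _; last by rewrite normr0 expr0n.
by rewrite pure_weightE mxE.
Qed.

Lemma sum_unitary_vpart (R : realType) d (C : finType) (t : 'I_d -> C) (V : 'M[R[i]]_d) x :
  V \is unitarymx -> \sum_c dag V *m vpart t (V *m x) c = x.
Proof.
by move=> /unitaryP hV; rewrite -mulmx_sumr sum_vpart mulmxA hV mul1mx.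
Qed.

(** The dual channel maps the projector on [y] to a test bounded by [qf 1%:M y]. Its probability
    under the input reference state is [qf sigma y], so its relative size is [F], and
    [test_bound_scaled] applies once [rho] is replaced by [v] times its pinching. *)
Lemma channel_overlap_bound (R : realType) n m (E : 'M[R[i]]_n -> 'M[R[i]]_m)
  (rho : 'M[R[i]]_n) (W : 'M[R[i]]_n) (p q : 'I_n -> R) (sigma : 'M[R[i]]_m)
  (y : 'cV[R[i]]_m) (b F v : R) :
  1 < b -> is_channel E -> psd rho -> W \is unitarymx -> (forall x, 0 <= q x) ->
  (forall x, dent W rho x = (p x)%:C) -> (forall x, q x = 0 -> p x = 0) -> 0 <= v ->
  (forall x, qf rho x <= v%:C * qf (udiag W p) x) ->
  E (udiag W q) = sigma -> qf sigma y = F%:C * qf 1%:M y ->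
  qf (E rho) y <= (2 * v * (\sum_i p i `^ b * q i `^ (1 - b)) `^ (b^-1)
      * F `^ (1 - b^-1))%:C * qf 1%:M y.
Proof.
move=> b1 cE pr hW q0 hp pq v0 hv es hF.
have p0 := dent_ge0 pr hp.
have [D [hD pD D1 DB DZ]] := channel_dual cE.
pose N := D (y *m dag y).
have pN : psd N by apply: pD; exact: psd_cogram.
pose Y := complex.Re (qf 1%:M y).
have eY : Y%:C = qf 1%:M y by apply: ge0_ReK; exact: qf1_ge0.
have Y0 : 0 <= Y by rewrite -ler0c eY qf1_ge0.
pose nx x := complex.Re (dent W N x).
have enx x : (nx x)%:C = dent W N x by apply: ge0_ReK; exact: dent_psd.
have hnx x : 0 <= nx x <= Y.
  rewrite -ler0c enx dent_psd//= -lecR enx eY -subr_ge0.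
  have := dent_psd W x (pD _ (psd_norm_outer y)).
  by rewrite DB DZ D1 dentB /dent -scalemxAr -scalemxAl mulmx1 (unitaryP hW) !mxE eqxx mulr1.
have hFY : \sum_x q x * nx x = F * Y.
  apply: complexI; rewrite rmorphM /= eY -hF -es -trace_outer mxtrace_mulC hD.
  rewrite trace_mul_udiag sumRC; apply: eq_bigr => x _.
  by rewrite rmorphM /= enx mulrC.
have hpn := test_bound_scaled b1 p0 q0 Y0 hnx pq hFY.
rewrite -trace_outer mxtrace_mulC hD -/N.
have pv : psd (v%:C *: udiag W p - rho).
  split; last first.
    by move=> x; rewrite -/(qf _ _) qfD qfN qfZ subr_ge0.
  by rewrite /Defs.hermitian dagD dagN dagZ conjRC dag_udiag (proj1 pr).
have := psd_trace_mul pN pv.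
rewrite mulmxBr mxtraceD raddfN /= subr_ge0 -scalemxAr mxtraceZ trace_mul_udiag => h.
apply: le_trans h _.
have -> : \sum_x dent W N x * (p x)%:C = (\sum_x p x * nx x)%:C.
  by rewrite sumRC; apply: eq_bigr => x _; rewrite -enx -rmorphM mulrC.
rewrite -eY -!rmorphM lecR; apply: le_trans (ler_wpM2l v0 hpn) _.
rewrite le_eqVlt; apply/orP; left; apply/eqP; ring.
Qed.

(** Every basis index has exactly one type, so summing over types restores the sum over all indices,
    which factorizes over the [m] copies. *)
Lemma sum_type_weights (R : realType) d m (V : 'M[R[i]]_d) (l : 'I_d -> R)
  (psi : 'cV[R[i]]_d) (K s : R) : V \is unitarymx -> (forall j, 0 <= l j) ->
  \sum_(c : {ffun 'I_d -> 'I_m.+1}) (K * (\prod_j l j ^+ c j) `^ s)%:C *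
     qf 1%:M (dag (ntensmx V m) *m vpart (@ttype d m) (ntensmx V m *m vtens m psi) c) =
  (K * (\sum_j pure_weight V psi j * l j `^ s) ^+ m)%:C.
Proof.
move=> hV l0; have hVm := unitary_ntensmx m hV.
pose g (i : 'I_(d ^ m)) : R :=
  \prod_k (pure_weight V psi (tdig i k) * l (tdig i k) `^ s).
have h (c : {ffun 'I_d -> 'I_m.+1}) : (\prod_j l j ^+ c j) `^ s *
   \sum_i pure_weight (ntensmx V m) (dag (ntensmx V m) *m
      vpart (@ttype d m) (ntensmx V m *m vtens m psi) c) i =
   \sum_i (if @ttype d m i == c then g i else 0).
  rewrite mulr_sumr; apply: eq_bigr => i _.
  rewrite pure_weight_vpart//; case: eqP => [<-|_]; last by rewrite mulr0.
  rewrite pure_weight_vtens -prod_ttype /g big_split /= mulrC; congr (_ * _).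
  by rewrite powR_prod.
under eq_bigr => c _ do rewrite (qf1_weight _ hVm) -rmorphM -(mulrA K) h.
rewrite -sumRC -mulr_sumr exchange_big /=; congr ((_ * _)%:C).
rewrite -[in RHS](card_ord m) -prodr_const.
rewrite -(sum_prod_tdig (fun _ j => pure_weight V psi j * l j `^ s)).
apply: eq_bigr => i _; rewrite (bigD1 (ttype i))//= eqxx big1 ?addr0//.
by move=> c hc; rewrite eq_sym (negbTE hc).
Qed.

Lemma converse_bound (R : realType) d1 d2 n m (rho1 sigma1 : 'M[R[i]]_d1)
  (V : 'M[R[i]]_d2) (l : 'I_d2 -> R) (psi : 'cV[R[i]]_d2) (b : R) E :
  density rho1 -> density sigma1 -> supp_sub rho1 sigma1 ->
  V \is unitarymx -> (forall j, 0 <= l j) -> qf 1%:M psi = 1 -> 1 < b ->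
  is_channel E -> E (ntensmx sigma1 n) = ntensmx (udiag V l) m ->
  1 - tdist (E (ntensmx rho1 n)) (ntensmx (psi *m dag psi) m) <=
  2 * (n.+1 ^ d1)%:R * (m.+1 ^ d2)%:R * (sandQ b rho1 sigma1 ^+ n) `^ (b^-1) *
    (\sum_j pure_weight V psi j * l j `^ (1 - b^-1)) ^+ m.
Proof.
move=> dr ds hs hV l0 psi1 b1 cE hE.
have [W [p [q [hW es q0 hp hle]]]] := pinched_power n dr ds.
have hVm := unitary_ntensmx m hV.
have pq := supp_sub_dent (supp_sub_ntensmx n hs) hW es hp.
have prn := psd_ntensmx n dr.1.
set Om := E _.
have dOm : density Om by apply: channel_density => //; exact: density_ntensmx.
set psim := vtens m psi.
have psim1 : qf 1%:M psim = 1.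
  rewrite (qf1_weight _ hVm).
  under eq_bigr do rewrite pure_weight_vtens.
  rewrite (sum_prod_tdig (fun _ j => pure_weight V psi j)) prodr_const card_ord.
  by rewrite rmorphXn /= -qf1_weight// psi1 expr1n.
rewrite -lecR ntensmx_pure; apply: le_trans (tdist_pure_ge dOm psim1) _.
pose L (c : {ffun 'I_d2 -> 'I_m.+1}) := \prod_j l j ^+ c j.
have eL i : \prod_k l (tdig i k) = L (@ttype d2 m i) by rewrite prod_ttype.
(* The component of [psim] on the basis vectors of type [c], where the target power acts as the
   scalar [L c]. *)
pose y c := dag (ntensmx V m) *m vpart (@ttype d2 m) (ntensmx V m *m psim) c.
have hy c : qf (ntensmx (udiag V l) m) (y c) = (L c)%:C * qf 1%:M (y c).
  rewrite ntensmx_udiag qf_udiag_weight (qf1_weight _ hVm) -rmorphM mulr_sumr /=.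
  congr (_%:C); apply: eq_bigr => i _; rewrite pure_weight_vpart// eL.
  by case: eqP => [->|_]; rewrite ?mul0r ?mulr0// mulrC.
have v0 : 0 <= (n.+1 ^ d1)%:R :> R by rewrite ler0n.
have es' : E (udiag W q) = ntensmx (udiag V l) m by rewrite -es.
have bd c := channel_overlap_bound b1 cE prn hW q0 hp pq v0 hle es' (hy c).
rewrite -[psim in qf _ psim](sum_unitary_vpart (@ttype d2 m) psim hVm).
apply: le_trans (qf_sum_le _ dOm.1) _; rewrite card_ttype.
apply: le_trans (ler_wpM2l _ (ler_sum _ (fun c _ => bd c))) _; first by rewrite ler0n.
set Q := \sum_i _ `^ b * _.
have hQ : Q <= sandQ b rho1 sigma1 ^+ n.
  rewrite -sandQ_ntensmx; [|exact: dr.1|exact: ds.1].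
  exact: (sandQ_lower b1 prn hW q0 es hp).
have Q0 : 0 <= Q by apply: sumr_ge0 => i _; rewrite mulr_ge0 ?powR_ge0.
rewrite (@sum_type_weights R d2 m V l psi _ _ hV l0) -natRC -rmorphM lecR.
set S := _ ^+ m.
have S0 : 0 <= S by rewrite exprn_ge0// sumr_ge0// => j _; rewrite mulr_ge0 ?powR_ge0 ?pure_weight_ge0.
have hQb : Q `^ b^-1 <= (sandQ b rho1 sigma1 ^+ n) `^ b^-1.
  have hn : 0 <= sandQ b rho1 sigma1 ^+ n by apply: le_trans hQ.
  apply: ge0_ler_powR; rewrite ?nnegrE// invr_ge0; lra.
set u := (m.+1 ^ d2)%:R; set v := (n.+1 ^ d1)%:R.
have -> : u * (2 * v * Q `^ b^-1 * S) = (2 * v * u * S) * Q `^ b^-1 by ring.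
rewrite [leRHS]mulrAC ler_wpM2l// !mulr_ge0//; exact: ler0n.
Qed.

(** * Achievability bound *)

(** Arbitrary outcome types keep matrix dimensions out of the classical argument and make products
    of measurements easy to form. *)
Definition povm_realizes (R : realType) d (rho sigma : 'M[R[i]]_d) (n : nat)
  (X : finType) (p q : X -> R) : Prop :=
  exists M : X -> 'M[R[i]]_(d ^ n),
  [/\ forall x, psd (M x), \sum_x M x = 1%:M,
      forall x, \tr (M x *m ntensmx rho n) = (p x)%:C &
      forall x, \tr (M x *m ntensmx sigma n) = (q x)%:C].

Lemma povm_basis (R : realType) d (rho sigma : 'M[R[i]]_d) n
  (U : 'M[R[i]]_(d ^ n)) (p q : 'I_(d ^ n) -> R) : U \is unitarymx ->
  (forall x, dent U (ntensmx rho n) x = (p x)%:C) ->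
  (forall x, dent U (ntensmx sigma n) x = (q x)%:C) ->
  povm_realizes rho sigma n p q.
Proof.
move=> hU hp hq; exists (fun x => udiag U (fun y => (y == x)%:R)).
have ht A x : \tr (udiag U (fun y => (y == x)%:R) *m A) = dent U A x.
  rewrite mxtrace_mulC trace_mul_udiag (bigD1 x)//= eqxx mulr1 big1 ?addr0//.
  by move=> y /negbTE ->; rewrite mulr0.
split; [|rewrite -(udiag1 hU)|by move=> x; rewrite ht|by move=> x; rewrite ht].
  by move=> x; apply: psd_udiag => y; rewrite ler0n.
rewrite /udiag -mulmx_suml -mulmx_sumr; congr (_ *m _ *m _).
apply/matrixP => i j; rewrite summxE (bigD1 i)//= big1 ?addr0.
  by rewrite !mxE eqxx.
by move=> y yi; rewrite !mxE eq_sym (negbTE yi) mul0rn.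
Qed.

Lemma povm_prod (R : realType) d (rho sigma : 'M[R[i]]_d) k n (X Y Z : finType)
  (p q : X -> R) (p' q' : Y -> R) (g : Z -> X * Y) : bijective g ->
  povm_realizes rho sigma k p q -> povm_realizes rho sigma n p' q' ->
  povm_realizes rho sigma (k + n) (fun z => p (g z).1 * p' (g z).2)
    (fun z => q (g z).1 * q' (g z).2).
Proof.
move=> bg [M [pM sM Mp Mq]] [N [pN sN Np Nq]].
have [c [bc hc]] := ntensmx_add d k n.
exists (fun z => cten c (M (g z).1) (N (g z).2)); split.
- by move=> z; exact: psd_cten.
- rewrite -(cten1 R bc) -sM -sN.
  apply/matrixP => i j; rewrite summxE !mxE !summxE big_distrlr /= pair_big /=.
  rewrite [RHS](reindex g) /=; last exact: onW_bij.
  by apply: eq_bigr => z _; rewrite mxE.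
- by move=> z; rewrite hc cten_mul// mxtrace_cten// Mp Np rmorphM.
- by move=> z; rewrite hc cten_mul// mxtrace_cten// Mq Nq rmorphM.
Qed.

Lemma povm_trivial (R : realType) d (rho sigma : 'M[R[i]]_d) n (X : finType) :
  density rho -> density sigma -> #|X| = 1%N ->
  povm_realizes rho sigma n (fun _ : X => 1) (fun _ => 1).
Proof.
move=> dr ds X1; exists (fun _ => 1%:M); split.
- by move=> _; exact: psd1.
- by rewrite sumr_const X1.
- by move=> _; rewrite mul1mx (density_ntensmx n dr).2.
- by move=> _; rewrite mul1mx (density_ntensmx n ds).2.
Qed.

Lemma eq_povm (R : realType) d (rho sigma : 'M[R[i]]_d) n (X : finType)
  (p q p' q' : X -> R) : p =1 p' -> q =1 q' ->
  povm_realizes rho sigma n p q -> povm_realizes rho sigma n p' q'.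
Proof.
by move=> ep eq [M [pM sM Mp Mq]]; exists M; split => // x; rewrite ?Mp ?Mq ?ep ?eq.
Qed.

(** The [l] copies left over after [N] blocks of [k] are measured trivially. *)
Lemma povm_iid (R : realType) d (rho sigma : 'M[R[i]]_d) k l (X : finType) (p q : X -> R) N :
  density rho -> density sigma -> povm_realizes rho sigma k p q ->
  povm_realizes rho sigma (N * k + l)
    (fun x : {ffun 'I_N -> X} => \prod_i p (x i))
    (fun x : {ffun 'I_N -> X} => \prod_i q (x i)).
Proof.
move=> dr ds hX; elim: N => [|N IH].
  apply: eq_povm (povm_trivial (l) dr ds _).
  - by move=> x; rewrite big_ord0.
  - by move=> x; rewrite big_ord0.
  - by rewrite card_ffun card_ord expn0.
pose g (x : {ffun 'I_N.+1 -> X}) := (x ord0, [ffun i => x (lift ord0 i)]).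
have bg : bijective g.
  apply: inj_card_bij; last by rewrite card_prod !card_ffun !card_ord expnS.
  move=> x y [e0 /ffunP e1]; apply/ffunP => i.
  by case: (unliftP ord0 i) => [j ->|->//]; have := e1 j; rewrite !ffunE.
rewrite mulSn -addnA; apply: eq_povm (povm_prod bg hX IH).
- move=> x; rewrite big_ord_recl; congr (_ * _).
  by apply: eq_bigr => i _; rewrite ffunE.
- move=> x; rewrite big_ord_recl; congr (_ * _).
  by apply: eq_bigr => i _; rewrite ffunE.
Qed.

Lemma psd_trace0 (R : realType) n (A : 'M[R[i]]_n) : psd A -> \tr A = 0 -> A = 0.
Proof.
move=> /psd_udiagP[V [l [hV l0 ->]]]; rewrite trace_udiag// => /(congr1 (@complex.Re R)) /= /eqP.
rewrite psumr_eq0// => /allP h.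
have -> : l = fun=> 0.
  by apply/funext => i; apply/eqP; have := h i; rewrite mem_index_enum => /(_ isT).
rewrite /udiag; have -> : cdiag (fun=> 0 : R) = 0 :> 'M[R[i]]_n.
  by apply/matrixP => i j; rewrite !mxE mul0rn.
by rewrite mulmx0 mul0mx.
Qed.

Lemma density_outer (R : realType) n (x : 'cV[R[i]]_n) : qf 1%:M x = 1 ->
  density (x *m dag x).
Proof. by move=> x1; split; [exact: psd_cogram|rewrite trace_outer1]. Qed.

(** On success of the test the channel prepares [f], on failure a state [om] chosen so that [sigma]
    goes exactly to [sigma']. Such an [om] exists because [mu <= L] keeps the remainder of [sigma']
    positive. *)
Lemma test_prepare (R : realType) n m (rho sigma M : 'M[R[i]]_n) (sigma' : 'M[R[i]]_m)
  (f : 'cV[R[i]]_m) (a mu L : R) :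
  density rho -> density sigma -> density sigma' -> psd M -> psd (1%:M - M) ->
  qf 1%:M f = 1 -> psd (sigma' - L%:C *: (f *m dag f)) ->
  \tr (M *m sigma) = mu%:C -> \tr (M *m rho) = a%:C -> mu <= L ->
  exists2 E, is_channel E & E sigma = sigma' /\ psd (E rho - a%:C *: (f *m dag f)).
Proof.
move=> dr ds ds' pM pM1 f1 pL hmu ha muL.
have pf : psd (f *m dag f) by exact: psd_cogram.
have mu1 : mu <= 1.
  rewrite -lecR -hmu -subr_ge0; have := psd_trace_mul pM1 ds.1.
  by rewrite mulmxBl mul1mx mxtraceD raddfN /= ds.2.
have a1 : a <= 1.
  rewrite -lecR -ha -subr_ge0; have := psd_trace_mul pM1 dr.1.
  by rewrite mulmxBl mul1mx mxtraceD raddfN /= dr.2.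
have pmu : psd (sigma' - mu%:C *: (f *m dag f)).
  have -> : sigma' - mu%:C *: (f *m dag f) =
    (sigma' - L%:C *: (f *m dag f)) + (L - mu)%:C *: (f *m dag f).
    by rewrite rmorphB scalerBl addrA subrK.
  have h : 0 <= L - mu by rewrite subr_ge0.
  exact: psdD pL (psdZ h pf).
have [om [dom eom]] : exists om, density om /\
    mu%:C *: (f *m dag f) + (1 - mu)%:C *: om = sigma'.
  (* If success is certain under [sigma], the remainder is positive with trace 0, so [sigma'] is the
     projector on [f] and [om] gets weight 0. *)
  have [mue|mun] := eqVneq mu 1.
    exists sigma'; split => //; rewrite mue subrr scale0r addr0 scale1r.
    apply/esym/eqP; rewrite -subr_eq0; apply/eqP/psd_trace0.
      by move: pmu; rewrite mue scale1r.
    by rewrite mxtraceD raddfN /= ds'.2 trace_outer1 f1 subrr.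
  have mup : 0 < 1 - mu by rewrite subr_gt0 lt_neqAle mun.
  exists ((1 - mu)^-1%:C *: (sigma' - mu%:C *: (f *m dag f))); split.
    split; first by apply: psdZ => //; rewrite invr_ge0 ltW.
    rewrite mxtraceZ mxtraceD raddfN /= mxtraceZ ds'.2 trace_outer1 f1 mulr1.
    by rewrite -(rmorph1 (real_complex R)) -rmorphB -rmorphM /= mulVf ?gt_eqF.
  rewrite scalerA -rmorphM /= mulfV ?gt_eqF// scale1r addrC subrK//.
pose E Y := \sum_(t : bool) \tr ((if t then M else 1%:M - M) *m Y) *:
   (if t then f *m dag f else om).
have eE Y : E Y = \tr (M *m Y) *: (f *m dag f) + (\tr Y - \tr (M *m Y)) *: om.
  rewrite /E big_bool /=; congr (_ + _ *: _).
  by rewrite mulmxBl mul1mx mxtraceD raddfN.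
exists E.
  apply: measure_prepare_channel.
  - by case.
  - by rewrite big_bool /= addrCA subrr addr0.
  - by case => //; exact: density_outer.
split; first by rewrite eE hmu ds.2 -eom rmorphB.
rewrite eE ha dr.2 addrAC subrr add0r.
have -> : 1 - a%:C = (1 - a)%:C :> R[i] by rewrite rmorphB.
have h : 0 <= 1 - a by rewrite subr_ge0.
exact: psdZ h dom.1.
Qed.

(** [f] is the normalized projection of [x] on the eigenvectors in [T]. The operator dominates [L]
    times that projection, which in turn dominates the projector on [f]. *)
Lemma projected_state (R : realType) n (V : 'M[R[i]]_n) (l : 'I_n -> R)
  (x : 'cV[R[i]]_n) (T : pred 'I_n) (L : R) :
  V \is unitarymx -> (forall i, 0 <= l i) -> 0 <= L -> (forall i, T i -> L <= l i) ->
  0 < \sum_(i | T i) pure_weight V x i ->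
  exists f, [/\ qf 1%:M f = 1, psd (udiag V l - L%:C *: (f *m dag f)) &
    `|bf 1%:M f x| ^+ 2 = (\sum_(i | T i) pure_weight V x i)%:C].
Proof.
move=> hV l0 L0 hT; set A := \sum_(i | T i) _ => A0.
pose P := udiag V (fun i => (T i)%:R).
have PP : P *m P = P.
  by rewrite udiagM//; apply: eq_udiag => i; rewrite -natrM mulnb andbb.
have hP : dag P = P by exact: dag_udiag.
have eA : qf P x = A%:C.
  rewrite qf_udiag_weight; congr (_%:C); rewrite /A [RHS]big_mkcond /=.
  by apply: eq_bigr => i _; case: (T i); rewrite ?mulr1 ?mulr0.
have eLP : udiag V (fun i => L * (T i)%:R) = L%:C *: P.
  rewrite /P /udiag scalemxAl scalemxAr; congr (_ *m _ *m _).
  by apply/matrixP => i j; rewrite !mxE rmorphM mulrnAr.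
clearbody P.
pose s := (Num.sqrt A)^-1.
have s2 : s * s * A = 1.
  by rewrite /s -invfM -expr2 sqr_sqrtr ?(ltW A0)// mulVf// gt_eqF.
have s0 : 0 < s by rewrite invr_gt0 sqrtr_gt0.
pose f := s%:C *: (P *m x).
have Pf : P *m f = f by rewrite /f -scalemxAr mulmxA PP.
have f1 : qf 1%:M f = 1.
  suff -> : qf 1%:M f = (s * s * A)%:C by rewrite s2.
  rewrite !rmorphM /= -eA.
  have -> : qf 1%:M f = bf 1%:M f f by [].
  rewrite /f bfZl bfZr conjRC mulrA; congr (_ * _).
  by rewrite -[P in RHS]PP -[X in qf (X *m _)]hP qf_gram.
exists f; split => //.
  have -> : udiag V l - L%:C *: (f *m dag f) =
     udiag V (fun i => l i - L * (T i)%:R) + L%:C *: (P - f *m dag f).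
    by rewrite udiagB eLP scalerBr addrA subrK.
  apply: psdD; first apply: psd_udiag => i.
    case: (boolP (T i)) => Ti; rewrite ?mulr1 ?mulr0 subr_ge0; [exact: hT|exact: l0].
  apply: psdZ => //.
  have -> : P - f *m dag f = dag P *m (1%:M - f *m dag f) *m P.
    have fP : dag f *m P = dag f by rewrite -[P in LHS]hP -dagM Pf.
    rewrite hP mulmxBr mulmx1 mulmxBl PP; congr (_ - _).
    by rewrite mulmxA Pf -mulmxA fP.
  by apply: psd_conj; exact: psd_compl_outer.
have -> : bf 1%:M f x = (s * A)%:C.
  rewrite /f bfZl conjRC rmorphM /= -eA; congr (_ * _).
  by rewrite /bf mulmx1 dagM hP.
rewrite ger0_norm ?ler0c ?mulr_ge0 ?(ltW s0) ?(ltW A0)//.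
rewrite -rmorphXn /=; congr (_%:C).
by rewrite exprMn expr2 (expr2 A) mulrA s2 mul1r.
Qed.

Lemma achievability_bound (R : realType) d1 d2 n m (rho1 sigma1 : 'M[R[i]]_d1)
  (V : 'M[R[i]]_d2) (l : 'I_d2 -> R) (psi : 'cV[R[i]]_d2) (X : finType)
  (p q f : X -> R) (T : pred {ffun 'I_m -> 'I_d2}) (L : R) :
  density rho1 -> density sigma1 -> density (udiag V l) ->
  V \is unitarymx -> (forall j, 0 <= l j) -> qf 1%:M psi = 1 ->
  povm_realizes rho1 sigma1 n p q -> (forall x, 0 <= f x <= 1) -> 0 <= L ->
  (forall y, T y -> L <= \prod_k l (y k)) -> \sum_x f x * q x <= L ->
  0 < \sum_(y | T y) \prod_k pure_weight V psi (y k) ->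
  exists2 E, is_channel E & E (ntensmx sigma1 n) = ntensmx (udiag V l) m /\
    (\sum_x f x * p x) * (\sum_(y | T y) \prod_k pure_weight V psi (y k)) <=
    2 * (1 - tdist (E (ntensmx rho1 n)) (ntensmx (psi *m dag psi) m)).
Proof.
move=> dr ds ds' hV l0 psi1 [M [pM sM Mp Mq]] f01 L0 hT hq A0.
have hVm := unitary_ntensmx m hV.
have dsn := density_ntensmx n ds; have drn := density_ntensmx n dr.
have dsm := density_ntensmx m ds'.
pose T' := fun i : 'I_(d2 ^ m) => T (tdig i).
have eA : \sum_(i | T' i) pure_weight (ntensmx V m) (vtens m psi) i =
  \sum_(y | T y) \prod_k pure_weight V psi (y k).
  rewrite big_mkcond [RHS]big_mkcond /=.
  rewrite -(sum_tdig (fun y => if T y then \prod_k pure_weight V psi (y k) else 0)).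
  by apply: eq_bigr => i _; rewrite pure_weight_vtens.
have [|||g [g1 pg gx]] := @projected_state R _ (ntensmx V m) (fun i => \prod_k l (tdig i k))
    (vtens m psi) T' L hVm _ L0 _ _.
- by move=> i; apply: prodr_ge0.
- by move=> i; exact: hT.
- by rewrite eA.
(* The randomized classical test becomes a quantum effect: measure, then accept outcome [x] with
   probability [f x]. *)
pose M' := \sum_x (f x)%:C *: M x.
have tM (w : X -> R) A : (forall x, \tr (M x *m A) = (w x)%:C) ->
   \tr (M' *m A) = (\sum_x f x * w x)%:C.
  move=> h; rewrite mulmx_suml raddf_sum sumRC; apply: eq_bigr => x _ /=.
  by rewrite -scalemxAl mxtraceZ h rmorphM.
have pM' : psd M'.
  by apply: psd_sum => x _; apply: psdZ => //; case/andP: (f01 x).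
have pM1 : psd (1%:M - M').
  rewrite -sM -sumrB; apply: psd_sum => x _.
  have -> : M x - (f x)%:C *: M x = (1 - f x)%:C *: M x.
    by rewrite rmorphB scalerBl scale1r.
  by apply: psdZ => //; rewrite subr_ge0; case/andP: (f01 x).
rewrite -ntensmx_udiag in pg.
have [E cE [Es Er]] := test_prepare drn dsn dsm pM' pM1 g1 pg (tM _ _ Mq) (tM _ _ Mp) hq.
exists E => //; split => //.
have dE : density (E (ntensmx rho1 n)) by exact: channel_density.
have psim1 : qf 1%:M (vtens m psi) = 1.
  rewrite (qf1_weight _ hVm).
  under eq_bigr do rewrite pure_weight_vtens.
  rewrite (sum_prod_tdig (fun _ j => pure_weight V psi j)) prodr_const card_ord.
  by rewrite rmorphXn /= -qf1_weight// psi1 expr1n.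
set a := \sum_x f x * p x in Er *.
have ha : \tr (M' *m ntensmx rho1 n) = a%:C by exact: tM.
have a01 : 0 <= a <= 1.
  apply/andP; split; first by rewrite -ler0c -ha; exact: psd_trace_mul pM' drn.1.
  have := psd_trace_mul pM1 drn.1.
  by rewrite mulmxBl mul1mx mxtraceD raddfN /= drn.2 ha subr_ge0 (lecR _ 1).
have := tdist_pure_le dE a01 Er g1 psim1.
rewrite gx eA -ntensmx_pure -rmorphM /= -natRC -rmorphM lecR.
by [].
Qed.

(** * Asymptotics *)

Lemma tdist_ge0 (R : realType) n (A B : 'M[R[i]]_n) :
  density A -> density B -> 0 <= tdist A B.
Proof.
move=> [[hA _] _] [[hB _] _]; rewrite mulr_ge0 ?invr_ge0// trnorm_ge0//.
by rewrite /Defs.hermitian dagD dagN hA hB.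
Qed.

Lemma replacement_channel (R : realType) m k (tau : 'M[R[i]]_k) : density tau ->
  is_channel (fun Y : 'M[R[i]]_m => \tr Y *: tau).
Proof.
move=> dt.
have := @measure_prepare_channel R m k unit (fun _ => 1%:M) (fun _ => tau)
  (fun _ => psd1 R m) _ (fun _ => dt).
rewrite big_const card_unit /= addr0 => /(_ erefl).
by under eq_fun do rewrite big_const card_unit /= addr0 mul1mx.
Qed.

(** Replacing every input by the target power shows that admissible channels exist, so [inf] is a
    true greatest lower bound and not its default value. *)
Lemma eps_dr_bounds (R : realType) d1 d2 (rho1 sigma1 : 'M[R[i]]_d1)
  (rho2 sigma2 : 'M[R[i]]_d2) (r : R) n :
  density rho1 -> density sigma1 -> density rho2 -> density sigma2 ->
  [/\ 0 <= eps_dr rho1 sigma1 rho2 sigma2 r n,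
    forall E, is_channel E -> E (ntensmx sigma1 n) = ntensmx sigma2 (nr r n) ->
      eps_dr rho1 sigma1 rho2 sigma2 r n <=
        tdist (E (ntensmx rho1 n)) (ntensmx rho2 (nr r n)) &
    forall B, (forall E, is_channel E -> E (ntensmx sigma1 n) = ntensmx sigma2 (nr r n) ->
        1 - tdist (E (ntensmx rho1 n)) (ntensmx rho2 (nr r n)) <= B) ->
      1 - eps_dr rho1 sigma1 rho2 sigma2 r n <= B].
Proof.
move=> dr1 ds1 dr2 ds2.
have dm := density_ntensmx (nr r n) ds2.
rewrite /eps_dr; set S := mkset _.
have Sne : S !=set0.
  exists (tdist (\tr (ntensmx rho1 n) *: ntensmx sigma2 (nr r n)) (ntensmx rho2 (nr r n))).
  exists (fun Y => \tr Y *: ntensmx sigma2 (nr r n)); split => //.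
    exact: replacement_channel.
  by rewrite (density_ntensmx n ds1).2 scale1r.
have S0 : lbound S 0.
  move=> _ [E [cE _ ->]]; apply: tdist_ge0; last exact: density_ntensmx.
  by apply: channel_density => //; exact: density_ntensmx.
split.
- exact: lb_le_inf.
- move=> E cE hE; apply: ge_inf; first by exists 0.
  by exists E.
- move=> B hB; rewrite lerBlDr -lerBlDl; apply: lb_le_inf => // _ [E [cE hE ->]].
  by rewrite lerBlDl -lerBlDr; exact: hB.
Qed.

Lemma ln2_gt0 (R : realType) : 0 < ln 2 :> R.
Proof. by rewrite ln_gt0// ltr1n. Qed.

(** The factor [ln 2] converts base 2 to natural logarithms. If [1 - eps_dr] is not positive,
    [sc_rate] is [+oo] and the bound is free. *)
Lemma sc_rate_ge (R : realType) d1 d2 (rho1 sigma1 : 'M[R[i]]_d1)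
  (rho2 sigma2 : 'M[R[i]]_d2) (r c : R) n : (0 < n)%N ->
  1 - eps_dr rho1 sigma1 rho2 sigma2 r n <= expR (- (n%:R * (c * ln 2))) ->
  (c%:E <= sc_rate rho1 sigma1 rho2 sigma2 r n)%E.
Proof.
move=> n0 h; rewrite /sc_rate; case: ifPn => [e0|_]; last exact: leey.
rewrite lee_fin /log2 mulrA -mulNr ler_pdivlMr ?ln2_gt0//.
rewrite -mulrN ler_pdivlMl ?ltr0n// lerNr.
by rewrite -[leRHS]expRK ler_ln ?posrE ?expR_gt0.
Qed.

Lemma sc_rate_le (R : realType) d1 d2 (rho1 sigma1 : 'M[R[i]]_d1)
  (rho2 sigma2 : 'M[R[i]]_d2) (r c : R) n : (0 < n)%N ->
  expR (- (n%:R * (c * ln 2))) <= 1 - eps_dr rho1 sigma1 rho2 sigma2 r n ->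
  (sc_rate rho1 sigma1 rho2 sigma2 r n <= c%:E)%E.
Proof.
move=> n0 h; have e0 := lt_le_trans (expR_gt0 _) h.
rewrite /sc_rate e0 lee_fin /log2 mulrA -mulNr ler_pdivrMr ?ln2_gt0//.
rewrite -mulrN ler_pdivrMl ?ltr0n// lerNl.
by rewrite -[leLHS]expRK ler_ln ?posrE ?expR_gt0.
Qed.

Lemma nr_bounds (R : realType) (r : R) n : 0 < r ->
  n%:R * r - 1 < (nr r n)%:R <= n%:R * r.
Proof.
move=> r0; rewrite /nr; have h : 0 <= n%:R * r by rewrite mulr_ge0 ?ler0n// ltW.
have /andP[h1 h2] := truncn_itv h.
by rewrite h1 andbT ltrBlDr -natr1 in h2 *.
Qed.

(** An arbitrarily small slope [eps] is allowed, so polynomial factors are absorbed into any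
    exponential gap. *)
Lemma ln_le_linear (R : realType) (eps y : R) : 0 < eps -> 0 < y ->
  ln y <= eps * y - ln eps.
Proof.
move=> e0 y0; rewrite lerBrDr -lnM ?posrE// mulrC.
have := expR_ge1Dx (ln (eps * y)); rewrite lnK ?posrE ?mulr_gt0//; lra.
Qed.

Lemma pure_mpow (R : realType) d (psi : 'cV[R[i]]_d) p : qf 1%:M psi = 1 ->
  mpow p (psi *m dag psi) = psi *m dag psi.
Proof.
move=> psi1; have := outer_idem psi1.
have [V [l [hV l0 ->]]] := psd_udiagP (psd_cogram psi).
rewrite (mpow_udiag _ _ hV) (udiagM _ _ hV) => h; apply: eq_udiag => i.
(* A rank-one projector has eigenvalues 0 and 1 only, and [pospow] fixes both. *)
have : l i * l i = l i.
  by apply: complexI; rewrite -!(dent_udiag _ _ hV) -[in RHS]h !dent_udiag.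
move=> /eqP; rewrite -subr_eq0 -{3}[l i]mulr1 -mulrBr mulf_eq0 subr_eq0 => /orP[]/eqP ->.
  by rewrite /pospow ltxx.
by rewrite /pospow ltr01 powR1.
Qed.

Lemma rtr_pure_udiag (R : realType) d (V : 'M[R[i]]_d) l (psi : 'cV[R[i]]_d) :
  rtr (psi *m dag psi *m udiag V l) = \sum_j pure_weight V psi j * l j.
Proof. by rewrite /rtr mxtrace_mulC trace_outer qf_udiag_weight. Qed.

(** Orthogonality of the supports is tested at [psi] in one direction; in the other, a vanishing
    form at [psi] kills all its off-diagonal values by Cauchy-Schwarz. *)
Lemma supp_orth_weight (R : realType) d (V : 'M[R[i]]_d) l (psi : 'cV[R[i]]_d) :
  V \is unitarymx -> qf 1%:M psi = 1 -> (forall j, 0 <= l j) ->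
  supp_orth (psi *m dag psi) (udiag V l) <-> (forall j, pure_weight V psi j * l j = 0).
Proof.
move=> hV psi1 l0; have ppsi : psi *m dag psi *m psi = psi.
  by rewrite -mulmxA [dag psi *m psi]mx11_scalar -qf1_dag psi1 mulmx1.
split.
  move=> h j; have h0 : \sum_j pure_weight V psi j * l j = 0.
    apply: complexI; rewrite -qf_udiag_weight.
    by have := h psi psi; rewrite ppsi mulmxA /qf => ->; rewrite mxE.
  apply: (psumr_eq0P _ h0) => // k _.
  by rewrite mulr_ge0 ?pure_weight_ge0.
move=> h x y; have q0 : qf (udiag V l) psi = 0.
  by rewrite qf_udiag_weight big1// => j _; exact: h.
have b0 : bf (udiag V l) psi y = 0.
  have := cauchy_schwarz psi y (psd_udiag V l0); rewrite q0 mul0r => hle.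
  by apply/eqP; rewrite -normr_eq0 -sqrf_eq0 eq_le hle exprn_ge0.
have e : dag psi *m (udiag V l *m y) = 0.
  by rewrite [LHS]mx11_scalar mulmxA -/(bf _ _ _) b0; apply/matrixP => i k; rewrite !mxE mul0rn.
by rewrite !dagM dagK -(mulmxA (dag x)) -(mulmxA psi) e !mulmx0.
Qed.

Lemma sum_pospow (R : realType) d (a l : 'I_d -> R) (s : R) : s != 0 ->
  (forall j, 0 <= l j) -> \sum_j a j * pospow s (l j) = \sum_j a j * l j `^ s.
Proof. by move=> s0 l0; apply: eq_bigr => j _; rewrite pospowE. Qed.

Lemma petz_pure (R : realType) d (V : 'M[R[i]]_d) l (psi : 'cV[R[i]]_d) (b : R) :
  V \is unitarymx -> qf 1%:M psi = 1 -> (forall j, 0 <= l j) -> 1 < b ->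
  petz b^-1 (psi *m dag psi) (udiag V l) =
  if `[< forall j, pure_weight V psi j * l j = 0 >] then +oo%E
  else ((b^-1 - 1)^-1 * log2 (\sum_j pure_weight V psi j * l j `^ (1 - b^-1)))%:E.
Proof.
move=> hV psi1 l0 b1; have bn : b^-1 != 1 by rewrite invr_eq1 gt_eqF.
rewrite /petz (negbTE bn).
have -> : `[< supp_orth (psi *m dag psi) (udiag V l) >] =
          `[< forall j, pure_weight V psi j * l j = 0 >].
  by apply: asbool_equiv_eq; exact: supp_orth_weight.
case: ifP => // _; rewrite pure_mpow// mpow_udiag// rtr_pure_udiag sum_pospow//.
by rewrite subr_eq0 eq_sym.
Qed.

Lemma sandwichedE (R : realType) d (b : R) (A B : 'M[R[i]]_d) : 1 < b ->
  sandwiched b A B =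
  if supp_sub A B then ((b - 1)^-1 * log2 (sandQ b A B))%:E else +oo%E.
Proof. by move=> b1; rewrite /sandwiched gt_eqF. Qed.

Lemma sandQ_gt0 (R : realType) d (b : R) (rho sigma : 'M[R[i]]_d) :
  density rho -> density sigma -> supp_sub rho sigma -> 1 < b ->
  0 < sandQ b rho sigma.
Proof.
move=> dr ds hs b1; have [W [q [hW q0 es]]] := psd_udiagP ds.1.
pose p x := complex.Re (dent W rho x).
have hp x : dent W rho x = (p x)%:C by rewrite ge0_ReK//; exact: dent_psd dr.1.
have p0 := dent_ge0 dr.1 hp.
have p1 := sum_dent hW dr.2 hp.
have pq := supp_sub_dent hs hW es hp.
apply: lt_le_trans (sandQ_lower b1 dr.1 hW q0 es hp).
have [x px] : exists x, 0 < p x.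
  apply/existsP; apply: contraT; rewrite negb_exists => /forallP h.
  move: p1; rewrite big1 => [/esym/eqP|x _]; first by rewrite oner_eq0.
  by apply/eqP; rewrite eq_le p0 leNgt h.
have qx : 0 < q x.
  rewrite lt_neqAle q0 andbT; apply/eqP => /esym/pq e; by rewrite e ltxx in px.
rewrite (bigD1 x)//= ltr_pwDl ?mulr_gt0 ?powR_gt0//.
by apply: sumr_ge0 => y _; rewrite mulr_ge0 ?powR_ge0.
Qed.

(* [sc_term b] is the bracket of the variational formula, times [ln 2], for [rho2] pure. *)
Definition sc_term (R : realType) d1 d2 (rho1 sigma1 : 'M[R[i]]_d1)
  (V : 'M[R[i]]_d2) (l : 'I_d2 -> R) (psi : 'cV[R[i]]_d2) (r b : R) : R :=
  - (r * ln (\sum_j pure_weight V psi j * l j `^ (1 - b^-1)))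
  - b^-1 * ln (sandQ b rho1 sigma1).

Lemma formula_term_finite (R : realType) d1 d2 (rho1 sigma1 : 'M[R[i]]_d1)
  (V : 'M[R[i]]_d2) (l : 'I_d2 -> R) (psi : 'cV[R[i]]_d2) (r b : R) :
  V \is unitarymx -> qf 1%:M psi = 1 -> (forall j, 0 <= l j) -> 1 < b ->
  supp_sub rho1 sigma1 -> (exists j, 0 < pure_weight V psi j * l j) ->
  (((b - 1) / b)%:E * (r%:E * petz b^-1 (psi *m dag psi) (udiag V l)
      - sandwiched b rho1 sigma1))%E =
  (sc_term rho1 sigma1 V l psi r b / ln 2)%:E.
Proof.
move=> hV psi1 l0 b1 hs [j hj]; rewrite petz_pure// sandwichedE// hs.
rewrite asboolF => [|h]; last by rewrite h ltxx in hj.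
have efin (u v w x : R) : (u%:E * (v%:E * w%:E - x%:E))%E = (u * (v * w - x))%:E by [].
rewrite /= efin; congr (_%:E); rewrite /sc_term /log2.
have b0 : b != 0 by rewrite gt_eqF//; lra.
have b10 : b - 1 != 0 by rewrite gt_eqF//; lra.
have b11 : 1 - b != 0 by rewrite lt_eqF//; lra.
have l2 := ln2_gt0 R.
(* The prefactor [(b - 1) / b] thus turns the Petz coefficient into -1 and the sandwiched one into
   [b^-1]. *)
have -> : (b^-1 - 1)^-1 = - (b / (b - 1)).
  rewrite -[X in _ - X](mulfV b0) -[X in X - _]mul1r -mulrBl invf_div.
  by rewrite -[1 - b]opprB invrN mulrN.
by field; rewrite b0 b10 gt_eqF.
Qed.

Lemma sum_weight_powR_gt0 (R : realType) d (a l : 'I_d -> R) (s : R) :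
  (forall j, 0 <= a j) -> (forall j, 0 <= l j) -> (exists j, 0 < a j * l j) ->
  0 < \sum_j a j * l j `^ s.
Proof.
move=> a0 l0 [j hj].
have aj : 0 < a j.
  by rewrite lt_neqAle a0 andbT; apply/eqP => e; rewrite -e mul0r ltxx in hj.
have lj : 0 < l j by rewrite pmulr_rgt0 in hj.
rewrite (bigD1 j)//= ltr_pwDl ?mulr_gt0 ?powR_gt0//.
by apply: sumr_ge0 => k _; rewrite mulr_ge0 ?powR_ge0.
Qed.

Lemma near_nat_gt0 : \forall n \near \oo, (0 < n)%N.
Proof. by exists 1%N => // n. Qed.

(** The condition on [c] is required only when [psi] meets the support of the target. Otherwise
    [A = 0], the one-shot bound is 0 as soon as the output has at least one copy, and every [c] is
    reached. *)
Lemma converse_asymptotic (R : realType) d1 d2 (rho1 sigma1 : 'M[R[i]]_d1)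
  (V : 'M[R[i]]_d2) (l : 'I_d2 -> R) (psi : 'cV[R[i]]_d2) (r b c : R) :
  density rho1 -> density sigma1 -> density (udiag V l) ->
  V \is unitarymx -> (forall j, 0 <= l j) -> qf 1%:M psi = 1 -> 0 < r -> 1 < b ->
  supp_sub rho1 sigma1 ->
  ((exists j, 0 < pure_weight V psi j * l j) -> c * ln 2 < sc_term rho1 sigma1 V l psi r b) ->
  \forall n \near \oo,
    (c%:E <= sc_rate rho1 sigma1 (psi *m dag psi) (udiag V l) r n)%E.
Proof.
move=> dr ds ds' hV l0 psi1 r0 b1 hs hc.
set A := \sum_j pure_weight V psi j * l j `^ (1 - b^-1).
pose B n := 2 * (n.+1 ^ d1)%:R * ((nr r n).+1 ^ d2)%:R *
  (sandQ b rho1 sigma1 ^+ n) `^ (b^-1) * A ^+ (nr r n).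
suff : \forall n \near \oo, B n <= expR (- (n%:R * (c * ln 2))).
  apply: filterS2 near_nat_gt0 => n n0 hB; apply: sc_rate_ge => //.
  have [_ _ h] := eps_dr_bounds r n dr ds (density_outer psi1) ds'.
  apply: le_trans (h (B n) _) hB => E cE hE.
  exact: converse_bound.
have [hj|hj] := pselect (exists j, 0 < pure_weight V psi j * l j); last first.
  have A0 : A = 0.
    apply: big1 => j _.
    have : pure_weight V psi j * l j == 0.
      rewrite eq_le mulr_ge0 ?pure_weight_ge0// andbT leNgt; apply/negP => h.
      by apply: hj; exists j.
    rewrite mulf_eq0 => /orP[/eqP ->|/eqP ->]; first by rewrite mul0r.
    by rewrite powR0 ?mulr0// subr_eq0 eq_sym invr_eq1 gt_eqF.
  have := near_scaled_infty 1 r0; apply: filterS => n hn.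
  have m0 : (0 < nr r n)%N.
    by rewrite -(ltr0n R); have /andP[h _] := nr_bounds n r0; lra.
  by rewrite /B A0 expr0n gtn_eqF//= mulr0 expR_ge0.
have A0 : 0 < A by apply: sum_weight_powR_gt0 => // j; exact: pure_weight_ge0.
have Q0 := sandQ_gt0 dr ds hs b1.
have {hc} := hc hj; rewrite /sc_term -/A; set Q := sandQ _ _ _ in Q0 *; move=> hc.
pose d := - (r * ln A) - b^-1 * ln Q - c * ln 2.
have d0 : 0 < d by rewrite subr_gt0.
(* Half of the gap [d] pays for the linear bounds on the logarithms of the two polynomial factors,
   the other half for the constants in [K]. *)
pose eps := d / (2 * (d1%:R + d2%:R * r + 1)).
have den0 : 0 < d1%:R + d2%:R * r + 1.
  have := mulr_ge0 (ler0n R d2) (ltW r0); have := ler0n R d1; lra.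
have eps0 : 0 < eps by rewrite divr_gt0// mulr_gt0.
have eps_e : eps * (d1%:R + d2%:R * r + 1) = d / 2.
  by rewrite /eps; field; rewrite gt_eqF.
pose K := ln 2 + d1%:R * (eps - ln eps) + d2%:R * (eps - ln eps) + `|ln A|.
have d20 : 0 < d / 2 by rewrite divr_gt0.
have hK := near_scaled_infty K d20.
apply: filterS2 near_nat_gt0 hK => n n0 hK.
have /andP[m1 m2] := nr_bounds n r0.
rewrite /B; set m := nr r n in m1 m2 *.
have -> : 2 * (n.+1 ^ d1)%:R * (m.+1 ^ d2)%:R * (Q ^+ n) `^ b^-1 * A ^+ m =
  expR (ln 2 + d1%:R * ln n.+1%:R + d2%:R * ln m.+1%:R + b^-1 * (n%:R * ln Q) + m%:R * ln A).
  rewrite !expRD !natrX lnK ?posrE// !expRM_natl !lnK ?posrE ?ltr0n//.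
  congr (_ * _ * _); rewrite /powR gt_eqF ?exprn_gt0//.
  by rewrite lnXn// mulr_natl.
rewrite ler_expR.
have h1 : d1%:R * ln n.+1%:R <= d1%:R * (eps * (n%:R + 1) - ln eps).
  by rewrite natr1 ler_wpM2l ?ler0n// ln_le_linear ?ltr0n.
have h2 : d2%:R * ln m.+1%:R <= d2%:R * (eps * (n%:R * r + 1) - ln eps).
  rewrite ler_wpM2l ?ler0n//; apply: le_trans (ln_le_linear eps0 _) _; first by rewrite ltr0n.
  by rewrite lerB// ler_pM2l// -natr1 lerD2r.
have h3 : m%:R * ln A <= n%:R * r * ln A + `|ln A|.
  rewrite -lerBlDl -mulrBl; apply: le_trans (ler_norm _) _.
  rewrite normrM ler_piMl// ler_norml; apply/andP; split; lra.
have h4 : n%:R * (eps * (d1%:R + d2%:R * r + 1)) = n%:R * (d / 2) by rewrite eps_e.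
have h5 : 0 <= n%:R * eps by rewrite mulr_ge0 ?ler0n// ltW.
rewrite /K in hK.
have -> : - (n%:R * (c * ln 2)) = n%:R * d + n%:R * (r * ln A) + n%:R * (b^-1 * ln Q).
  rewrite /d; ring.
clearbody d eps; lra.
Qed.

Lemma tilt_in_sumE (R : realType) (X : finType) (p q : X -> R) (b : R) : 1 < b ->
  (forall x, 0 <= p x) -> (forall x, 0 < p x -> 0 < q x) ->
  \sum_x tilt_in p q b x = \sum_x p x `^ b * q x `^ (1 - b).
Proof.
move=> b1 p0 pq; apply: eq_bigr => x _; rewrite /tilt_in.
have := p0 x; rewrite le_eqVlt => /orP[/eqP <-|px].
  by rewrite ltxx powR0 ?mul0r// gt_eqF//; lra.
by rewrite px expRD /powR !gt_eqF// pq.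
Qed.

Lemma tilt_out_sumE (R : realType) (J : finType) (a l : J -> R) (s : R) : s != 0 ->
  (forall j, 0 <= a j) -> (forall j, 0 <= l j) ->
  \sum_j tilt_out a l s j = \sum_j a j * l j `^ s.
Proof.
move=> s0 a0 l0; apply: eq_bigr => j _; rewrite /tilt_out.
have := a0 j; rewrite le_eqVlt => /orP[/eqP <-|aj]; first by rewrite !mul0r ltxx.
rewrite pmulr_rgt0//; have := l0 j; rewrite le_eqVlt => /orP[/eqP <-|lj].
  by rewrite ltxx powR0 ?mulr0.
by rewrite lj /powR gt_eqF.
Qed.

(** One input letter is now a block of [k] copies, whence [r * k]. In [sandQ_upper] the pinching
    factor carries the power b, and [b^-1] in the rate reduces its logarithm to
    [d1 * ln (k + 1)]. *)
Lemma pinched_tilt_rate (R : realType) d1 d2 (rho1 sigma1 : 'M[R[i]]_d1)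
  (V : 'M[R[i]]_d2) (l : 'I_d2 -> R) (psi : 'cV[R[i]]_d2) (r b : R) k
  (W : 'M[R[i]]_(d1 ^ k)) (p q : 'I_(d1 ^ k) -> R) :
  density rho1 -> density sigma1 -> (forall j, 0 <= l j) -> supp_sub rho1 sigma1 ->
  1 < b -> W \is unitarymx -> ntensmx sigma1 k = udiag W q -> (forall x, 0 <= q x) ->
  (forall x, dent W (ntensmx rho1 k) x = (p x)%:C) -> (forall x, 0 < p x -> 0 < q x) ->
  (forall x, qf (ntensmx rho1 k) x <= ((k.+1 ^ d1)%:R : R)%:C * qf (udiag W p) x) ->
  (exists x, 0 < p x) ->
  tilt_rate p q (pure_weight V psi) l (r * k%:R) b <=
    k%:R * sc_term rho1 sigma1 V l psi r b + d1%:R * ln k.+1%:R.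
Proof.
move=> dr ds l0 hs b1 hW es q0 hp pq hle px.
have p0 := dent_ge0 (psd_ntensmx k dr.1) hp.
have v0 : 0 < (k.+1 ^ d1)%:R :> R by rewrite ltr0n expn_gt0.
have := sandQ_upper b1 (ltW v0) (psd_ntensmx k dr.1) hW q0 es hp hle.
rewrite sandQ_ntensmx; [|exact: dr.1|exact: ds.1].
have s0 : 1 - b^-1 != 0 by rewrite subr_eq0 eq_sym invr_eq1 gt_eqF.
have Z0 := tilt_in_sum_gt0 q b px.
rewrite /tilt_rate /sc_term tilt_out_sumE//; last by move=> j; exact: pure_weight_ge0.
rewrite -tilt_in_sumE//; set Z := \sum_x _ in Z0 *.
have Q0 := sandQ_gt0 dr ds hs b1; set Q := sandQ _ _ _ in Q0 *.
have bp : 0 < b by lra.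
move=> h; have : ln (Q ^+ k) <= ln ((k.+1 ^ d1)%:R `^ b * Z).
  by rewrite ler_ln ?posrE ?exprn_gt0// mulr_gt0// powR_gt0.
rewrite lnXn// lnM ?posrE ?powR_gt0// ln_powR natrX lnXn ?ltr0n// -[ln Q *+ k]mulr_natl -[ln k.+1%:R *+ d1]mulr_natl => h'.
have h2 : b^-1 * (k%:R * ln Q) <= d1%:R * ln k.+1%:R + b^-1 * ln Z.
  by rewrite ler_pdivrMl// mulrDr mulVKf ?gt_eqF.
lra.
Qed.

Lemma sum1_exists_gt0 (R : realType) (I : finType) (p : I -> R) :
  (forall i, 0 <= p i) -> \sum_i p i = 1 -> exists i, 0 < p i.
Proof.
move=> p0 p1; apply/existsP; apply: contraT; rewrite negb_exists => /forallP h.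
move: p1; rewrite big1 => [/esym/eqP|x _]; first by rewrite oner_eq0.
by apply/eqP; rewrite eq_le p0 leNgt h.
Qed.

Lemma block_length (R : realType) (d : nat) (delta : R) : 0 < delta ->
  exists2 k, (0 < k)%N & d%:R * ln k.+1%:R <= k%:R * delta.
Proof.
move=> d0; pose eps := delta / (2 * (d%:R + 1)).
have dd : 0 < d%:R + 1 :> R by rewrite ltr_wpDl.
have eps0 : 0 < eps by rewrite divr_gt0// mulr_gt0.
have ee : (d%:R + 1) * eps = delta / 2 by rewrite /eps; field; rewrite gt_eqF.
have d20 : 0 < delta / 2 by rewrite divr_gt0.
have [N _ hN] := near_scaled_infty (d%:R * (eps - ln eps)) d20.
exists (maxn 1 N); first by rewrite leq_max.
set k := maxn 1 N; have := hN k (leq_maxr 1 N); rewrite /= => hk.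
have h1 : d%:R * ln k.+1%:R <= d%:R * (eps * (k%:R + 1) - ln eps).
  by rewrite natr1 ler_wpM2l ?ler0n// ln_le_linear ?ltr0n.
have h2 : k%:R * ((d%:R + 1) * eps) = k%:R * (delta / 2) by rewrite ee.
have h3 : 0 <= k%:R * eps by rewrite mulr_ge0 ?ler0n// ltW.
clearbody eps k; lra.
Qed.

(** The block length [k], and with it the pinched distributions and [b], is fixed before [n] grows;
    [n] is then written as [N] blocks plus a remainder. *)
Lemma achievability_asymptotic (R : realType) d1 d2 (rho1 sigma1 : 'M[R[i]]_d1)
  (V : 'M[R[i]]_d2) (l : 'I_d2 -> R) (psi : 'cV[R[i]]_d2) (r E delta : R) :
  density rho1 -> density sigma1 -> density (udiag V l) ->
  V \is unitarymx -> (forall j, 0 <= l j) -> qf 1%:M psi = 1 -> 0 < r ->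
  supp_sub rho1 sigma1 -> (exists j, 0 < pure_weight V psi j * l j) ->
  0 <= E -> (forall b, 1 < b -> sc_term rho1 sigma1 V l psi r b <= E) -> 0 < delta ->
  \forall n \near \oo, expR (- (n%:R * (E + delta))) <=
    1 - eps_dr rho1 sigma1 (psi *m dag psi) (udiag V l) r n.
Proof.
move=> dr ds ds' hV l0 psi1 r0 hs hj E0 hE delta0.
(* One quarter each for the pinching penalty, for the loss in [iid_test_lower_bound] and for the
   factor 2; the last one is spare. *)
pose d := delta / 4; have d0 : 0 < d by rewrite divr_gt0.
have de : delta = 4 * d by rewrite /d; field.
clearbody d.
have [k k0 hk] := block_length d1 d0.
have [W [p [q [hW es q0 hp hle]]]] := pinched_power k dr ds.
have prk := psd_ntensmx k dr.1.
have p0 := dent_ge0 prk hp.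
have p1 := sum_dent hW (density_ntensmx k dr).2 hp.
have hq x : dent W (ntensmx sigma1 k) x = (q x)%:C by rewrite es dent_udiag.
have q1 := sum_dent hW (density_ntensmx k ds).2 hq.
have pq x : 0 < p x -> 0 < q x.
  move=> px; rewrite lt_neqAle q0 andbT; apply/eqP => e.
  by move: px; rewrite (supp_sub_dent (supp_sub_ntensmx k hs) hW es hp (esym e)) ltxx.
have px := sum1_exists_gt0 p0 p1.
have l1 : \sum_j l j = 1 by apply: complexI; rewrite -(trace_udiag l hV) ds'.2.
have l01 j : 0 <= l j <= 1.
  by rewrite l0/= -l1 (bigD1 j)//= lerDl sumr_ge0.
have kR : 0 < k%:R :> R by rewrite ltr0n.
have rk0 : 0 < r * k%:R by rewrite mulr_gt0.
have rk1 : 0 <= r * k%:R + 1 by lra.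
have q1' : \sum_x q x <= 1 by rewrite q1.
have [b b1 [N0 _ hN]] := iid_test_lower_bound px p0 q0 q1' pq
  (pure_weight_ge0 V psi) l01 hj rk0 rk1 d0.
have hg := pinched_tilt_rate V psi r dr ds l0 hs b1 hW es q0 hp pq hle px.
set g := tilt_rate _ _ _ _ _ _ in hg hN.
have hgE : g <= k%:R * (E + d).
  apply: le_trans hg _; rewrite [leRHS]mulrDr lerD//.
  by rewrite ler_pM2l// hE.
have big_n : \forall n \near \oo, (N0 * k <= n)%N by exists (N0 * k)%N.
apply: filterS2 big_n (near_scaled_infty (ln 2) d0) => n hn hln.
pose N := (n %/ k)%N.
have NN0 : (N0 <= N)%N by rewrite leq_divRL.
have nE := divn_eq n k; rewrite -/N in nE.
have nR : n%:R = N%:R * k%:R + (n %% k)%:R :> R by rewrite {1}nE natrD natrM.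
have modk : (n %% k)%:R <= k%:R :> R by rewrite ler_nat ltnW// ltn_mod.
have mod0 : 0 <= (n %% k)%:R :> R by rewrite ler0n.
(* The remainder [n %% k] shifts the output length by at most [r * k], and rounding down in [nr] by
   at most 1. *)
have hm : `|(nr r n)%:R - r * k%:R * N%:R| <= r * k%:R + 1.
  have /andP[m1 m2] := nr_bounds n r0.
  have c1 : (n %% k)%:R * r <= k%:R * r by rewrite ler_pM2r.
  have c2 : 0 <= (n %% k)%:R * r by rewrite mulr_ge0// ltW.
  rewrite nR in m1 m2.
  rewrite ler_norml; apply/andP; split; lra.
have [f [T [L [f01 L0 hT hfq hfp]]]] := hN N NN0 (nr r n) hm.
have hpovm := povm_iid (n %% k) N dr ds (povm_basis hW hp hq).
rewrite -nE in hpovm.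
have A0 : 0 < \sum_(y | T y) \prod_k0 pure_weight V psi (y k0).
  have P0 : 0 <= \sum_(y | T y) \prod_k0 pure_weight V psi (y k0).
    by apply: sumr_ge0 => y _; apply: prodr_ge0 => i _; exact: pure_weight_ge0.
  rewrite lt_neqAle P0 andbT; apply/eqP => e.
  by move: hfp; rewrite -e mulr0 leNgt expR_gt0.
have [Ch cE [hEs hEd]] :=
  achievability_bound dr ds ds' hV l0 psi1 hpovm f01 (ltW L0) hT hfq A0.
have [_ heps _] := eps_dr_bounds r n dr ds (density_outer psi1) ds'.
have {}heps := heps Ch cE hEs.
have h2 : expR (- (N%:R * (g + d))) <=
   2 * (1 - eps_dr rho1 sigma1 (psi *m dag psi) (udiag V l) r n).
  apply: le_trans hfp (le_trans hEd _).
  by rewrite ler_pM2l// lerB.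
rewrite -ler_pdivrMl// in h2; apply: le_trans h2.
rewrite -[X in X^-1 * _](@lnK R) ?posrE// -expRN -expRD ler_expR.
have c3 : N%:R * g <= N%:R * (k%:R * (E + d)) by rewrite ler_wpM2l ?ler0n.
have c4 : N%:R * d <= n%:R * d.
  by rewrite ler_pM2r// ler_nat /N leq_div.
have c5 : N%:R * k%:R * (E + d) <= n%:R * (E + d).
  by rewrite ler_wpM2r ?addr_ge0// ?(ltW d0)// nR lerDl.
have c6 : 0 <= n%:R * d by rewrite mulr_ge0 ?ler0n// ltW.
rewrite de; clearbody g; lra.
Qed.

(** A vanishing diagonal entry of a positive operator kills the whole row, so [A] is [B] times its
    pseudo-inverse times [A]. *)
Lemma dent_supp_sub (R : realType) n (W A B : 'M[R[i]]_n) (p q : 'I_n -> R) :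
  psd A -> W \is unitarymx -> B = udiag W q ->
  (forall x, dent W A x = (p x)%:C) -> (forall x, q x = 0 -> p x = 0) ->
  supp_sub A B.
Proof.
move=> /psd_gramP[G eA] /unitaryP hW eB hp pq; apply/supp_subP.
exists (udiag W (fun x => (q x)^-1) *m A).
have hrow : cdiag (fun x => q x * (q x)^-1) *m (W *m A) = W *m A.
  apply/matrixP => x j; rewrite mul_diag_mx [LHS]mxE [X in X * _]mxE.
  have [qx|qx] := eqVneq (q x) 0; last by rewrite divff// mul1r.
  have : qf A (dag (row x W)) = 0 by rewrite -dentE hp pq.
  rewrite eA qf_gram qf1 => /eqP; rewrite psumr_eq0 => [/allP h|i _]; last by rewrite exprn_ge0.
  have G0 : G *m dag (row x W) = 0.
    apply/matrixP => i k; rewrite (ord1 k) [RHS]mxE.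
    have := h i; rewrite mem_index_enum => /(_ isT).
    by rewrite expf_eq0 normr_eq0 => /eqP.
  have : row x (W *m (dag G *m G)) = 0.
    by rewrite row_mul mulmxA -[row x W]dagK -dagM G0 dag0 mul0mx.
  by move=> /matrixP/(_ 0 j); rewrite !mxE => ->; rewrite mulr0.
rewrite eB mulmxA /udiag !mulmxA -(mulmxA _ W (dag W)) hW mulmx1 -(mulmxA _ (cdiag q)) cdiagM.
by rewrite -!mulmxA hrow !mulmxA hW mul1mx.
Qed.

(** Some outcome [x] on a single copy has [q x = 0 < p x]. Testing for it is free under [sigma1], so
    [L = 0] is allowed and the full target can be prepared; success has probability [p x], whatever
    [n] is. *)
Lemma unsupported_bound (R : realType) d1 d2 (rho1 sigma1 : 'M[R[i]]_d1)
  (V : 'M[R[i]]_d2) (l : 'I_d2 -> R) (psi : 'cV[R[i]]_d2) (r : R) :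
  density rho1 -> density sigma1 -> density (udiag V l) ->
  V \is unitarymx -> (forall j, 0 <= l j) -> qf 1%:M psi = 1 ->
  ~~ supp_sub rho1 sigma1 ->
  exists2 K : R, 0 < K & forall n, (0 < n)%N ->
    K <= 1 - eps_dr rho1 sigma1 (psi *m dag psi) (udiag V l) r n.
Proof.
move=> dr ds ds' hV l0 psi1 hs.
have [W [p [q [hW es q0 hp hle]]]] := pinched_power 1 dr ds.
have p0 := dent_ge0 (psd_ntensmx 1 dr.1) hp.
have hq x : dent W (ntensmx sigma1 1) x = (q x)%:C by rewrite es dent_udiag.
have [x [qx px]] : exists x, q x = 0 /\ 0 < p x.
  apply: contrapT => h; move/negP: hs; apply.
  (* [ntensmx A 1] reduces to [A], so the inclusion for first powers is the one wanted. *)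
  apply: (@dent_supp_sub R _ W (ntensmx rho1 1) (ntensmx sigma1 1) p q) => //.
    exact: psd_ntensmx dr.1.
  move=> x qx; apply/eqP; rewrite eq_le p0 andbT leNgt; apply/negP => px.
  by apply: h; exists x.
exists (p x / 2); first by rewrite divr_gt0.
case=> // n _.
pose g (z : 'I_(d1 ^ 1) * unit) := z.
have bg : bijective g by exists g.
have hM := povm_prod bg (povm_basis hW hp hq) (povm_trivial n dr ds card_unit).
pose f (z : 'I_(d1 ^ 1) * unit) : R := (z.1 == x)%:R.
have f01 z : 0 <= f z <= 1 by rewrite /f ler0n lern1 leq_b1.
have hT y : predT y -> (0 : R) <= \prod_(k < nr r n.+1) l (y k) by move=> _; apply: prodr_ge0.
have sf (w : 'I_(d1 ^ 1) -> R) : \sum_z f z * (w (g z).1 * 1) = w x.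
  transitivity (\sum_i \sum_(u : unit) f (i, u) * (w i * 1)).
    by rewrite pair_big /=; apply: eq_bigr => -[].
  rewrite (bigD1 x)//= [X in _ + X]big1 ?addr0; last first.
    by move=> i ix; apply: big1 => u _; rewrite /f /= (negbTE ix) mul0r.
  by rewrite (bigD1 tt)//= big1 ?addr0 /f /= ?eqxx ?mul1r ?mulr1//; case.
have hfq : \sum_z f z * (q (g z).1 * 1) <= 0 by rewrite sf qx.
have A1 : \sum_(y : {ffun 'I_(nr r n.+1) -> 'I_d2} | predT y) \prod_k pure_weight V psi (y k) = 1.
  rewrite (sum_prod_ffun (pure_weight V psi)).
  have -> : \sum_j pure_weight V psi j = 1.
    by apply: complexI; rewrite -(qf1_weight _ hV) psi1.
  by rewrite expr1n.
have A0 : 0 < \sum_(y : {ffun 'I_(nr r n.+1) -> 'I_d2} | predT y) \prod_k pure_weight V psi (y k).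
  by rewrite A1.
have [Ch cE [hEs hEd]] :=
  achievability_bound dr ds ds' hV l0 psi1 hM f01 (lexx 0) hT hfq A0.
rewrite A1 mulr1 sf in hEd.
have [_ heps _] := eps_dr_bounds r n.+1 dr ds (density_outer psi1) ds'.
have {}heps := heps Ch cE hEs.
rewrite ler_pdivrMr// mulrC; apply: le_trans hEd _.
by rewrite ler_pM2l// lerB.
Qed.

Lemma ereal_two_sided_cvg (R : realType) (f : nat -> \bar R) (E : R) :
  (forall eps, 0 < eps -> \forall n \near \oo, ((E - eps)%:E <= f n)%E) ->
  (forall eps, 0 < eps -> \forall n \near \oo, (f n <= (E + eps)%:E)%E) ->
  f n @[n --> \oo] --> E%:E.
Proof.
move=> hlo hhi; apply/fine_cvgP; split.
  apply: filterS2 (hlo 1 ltr01) (hhi 1 ltr01) => n h1 h2.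
  by rewrite fin_numE; case: (f n) h1 h2.
apply/cvgrPdist_le => eps eps0.
apply: filterS2 (hlo eps eps0) (hhi eps eps0) => n /=.
case: (f n) => [x||]//=; rewrite !lee_fin => h1 h2.
by rewrite ler_norml; apply/andP; split; lra.
Qed.

Lemma sc_formula_ub (R : realType) d1 d2 (rho1 sigma1 : 'M[R[i]]_d1)
  (rho2 sigma2 : 'M[R[i]]_d2) (r b : R) : 1 <= b ->
  (((b - 1) / b)%:E * (r%:E * petz b^-1 rho2 sigma2 - sandwiched b rho1 sigma1)
    <= sc_formula rho1 sigma1 rho2 sigma2 r)%E.
Proof. by move=> b1; apply: ereal_sup_ubound; exists b. Qed.

Lemma sc_formula_ge0 (R : realType) d1 d2 (rho1 sigma1 : 'M[R[i]]_d1)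
  (rho2 sigma2 : 'M[R[i]]_d2) (r : R) :
  (0 <= sc_formula rho1 sigma1 rho2 sigma2 r)%E.
Proof.
by have := sc_formula_ub rho1 sigma1 rho2 sigma2 r (lexx 1); rewrite subrr mul0r mul0e.
Qed.

Lemma sc_rate_lower (R : realType) d1 d2 (rho1 sigma1 : 'M[R[i]]_d1)
  (V : 'M[R[i]]_d2) (l : 'I_d2 -> R) (psi : 'cV[R[i]]_d2) (r c : R) :
  density rho1 -> density sigma1 -> density (udiag V l) ->
  V \is unitarymx -> (forall j, 0 <= l j) -> qf 1%:M psi = 1 -> 0 < r ->
  (c%:E < sc_formula rho1 sigma1 (psi *m dag psi) (udiag V l) r)%E ->
  \forall n \near \oo,
    (c%:E <= sc_rate rho1 sigma1 (psi *m dag psi) (udiag V l) r n)%E.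
Proof.
move=> dr ds ds' hV l0 psi1 r0 /ereal_sup_gt[_ [b b1 <-]].
(* At [b = 1] the term is 0, since 0 times any extended real is 0. Then [c] is negative and
   [eps_dr >= 0] is enough. *)
have [->|bn] := eqVneq b 1.
  rewrite subrr mul0r mul0e lte_fin => c0.
  apply: filterS near_nat_gt0 => n n0; apply: sc_rate_ge => //.
  have [e0 _ _] := eps_dr_bounds r n dr ds (density_outer psi1) ds'.
  apply: (@le_trans _ _ 1); first by rewrite gerBl.
  apply: le_trans (expR_ge1Dx _); rewrite lerDl oppr_ge0 mulr_ge0_le0 ?ler0n//.
  by rewrite mulr_le0_ge0 ?(ltW c0)// ltW// ln2_gt0.
have {bn}b1 : 1 < b by rewrite lt_neqAle eq_sym bn.
have [hs|hs] := boolP (supp_sub rho1 sigma1); last first.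
  (* Adding [-oo] gives [-oo] even when the Petz term is [+oo], so this term exceeds no [c]. *)
  rewrite sandwichedE// (negbTE hs) /= addeNy gt0_muleNy ?lte_fin ?divr_gt0 ?subr_gt0//.
  by lra.
move=> hc; apply: (converse_asymptotic dr ds ds' hV l0 psi1 r0 b1 hs) => hj.
move: hc; rewrite formula_term_finite// lte_fin.
by rewrite ltr_pdivlMr// ln2_gt0.
Qed.

Lemma sc_formula_pinfty (R : realType) d1 d2 (rho1 sigma1 : 'M[R[i]]_d1)
  (V : 'M[R[i]]_d2) (l : 'I_d2 -> R) (psi : 'cV[R[i]]_d2) (r : R) :
  V \is unitarymx -> (forall j, 0 <= l j) -> qf 1%:M psi = 1 -> 0 < r ->
  supp_sub rho1 sigma1 -> ~ (exists j, 0 < pure_weight V psi j * l j) ->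
  sc_formula rho1 sigma1 (psi *m dag psi) (udiag V l) r = +oo%E.
Proof.
move=> hV l0 psi1 r0 hs hj; apply/eqP; rewrite -leye_eq.
(* Any [b > 1] would do: the Petz term is [+oo] and the sandwiched one finite. *)
have b2 : 1 < 2 :> R by lra.
apply: le_trans (sc_formula_ub rho1 sigma1 (psi *m dag psi) (udiag V l) r (ltW b2)).
rewrite petz_pure// sandwichedE// hs asboolT => [|j].
  by rewrite gt0_muley ?lte_fin// addye// gt0_muley ?lte_fin// divr_gt0//.
apply/eqP; rewrite eq_le mulr_ge0 ?pure_weight_ge0// andbT leNgt.
by apply/negP => h; apply: hj; exists j.
Qed.

Lemma sc_rate_upper (R : realType) d1 d2 (rho1 sigma1 : 'M[R[i]]_d1)
  (V : 'M[R[i]]_d2) (l : 'I_d2 -> R) (psi : 'cV[R[i]]_d2) (r E eps : R) :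
  density rho1 -> density sigma1 -> density (udiag V l) ->
  V \is unitarymx -> (forall j, 0 <= l j) -> qf 1%:M psi = 1 -> 0 < r ->
  sc_formula rho1 sigma1 (psi *m dag psi) (udiag V l) r = E%:E -> 0 < eps ->
  \forall n \near \oo,
    (sc_rate rho1 sigma1 (psi *m dag psi) (udiag V l) r n <= (E + eps)%:E)%E.
Proof.
move=> dr ds ds' hV l0 psi1 r0 hE eps0.
have E0 : 0 <= E.
  by have := sc_formula_ge0 rho1 sigma1 (psi *m dag psi) (udiag V l) r; rewrite hE lee_fin.
have l2 := ln2_gt0 R.
have [hs|hs] := boolP (supp_sub rho1 sigma1).
  have [hj|hj] := pselect (exists j, 0 < pure_weight V psi j * l j); last first.
    by move: hE; rewrite sc_formula_pinfty.
  have hT b : 1 < b -> sc_term rho1 sigma1 V l psi r b <= E * ln 2.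
    move=> b1.
    have := sc_formula_ub rho1 sigma1 (psi *m dag psi) (udiag V l) r (ltW b1).
    by rewrite hE formula_term_finite// lee_fin ler_pdivrMr.
  have El : 0 <= E * ln 2 by rewrite mulr_ge0// ltW.
  have el : 0 < eps * ln 2 by rewrite mulr_gt0.
  have := achievability_asymptotic dr ds ds' hV l0 psi1 r0 hs hj El hT el.
  apply: filterS2 near_nat_gt0 => n n0 h; apply: sc_rate_le => //.
  by rewrite mulrDl.
(* Here [1 - eps_dr] stays above a constant, so the rate is eventually below [eps], and [E >= 0]. *)
have [K K0 hK] := unsupported_bound r dr ds ds' hV l0 psi1 hs.
have el : 0 < eps * ln 2 by rewrite mulr_gt0.
apply: filterS2 near_nat_gt0 (near_scaled_infty (- ln K) el) => n n0 hn.
apply: sc_rate_le => //; apply: le_trans (hK n n0).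
rewrite -[leRHS]lnK ?posrE// ler_expR lerNl; apply: le_trans hn _.
rewrite mulrC ler_wpM2l ?ler0n// ler_pM2r//; lra.
Qed.

Theorem mainTheorem2 (R : realType) (d1 d2 : nat)
  (rho1 sigma1 : 'M[R[i]]_d1) (rho2 sigma2 : 'M[R[i]]_d2) (r : R) :
  density rho1 -> density sigma1 -> density rho2 -> density sigma2 ->
  (supp_sub rho1 sigma1 \/ supp_sub rho2 sigma2) ->
  0 < r ->
  pure rho2 ->
  sc_rate rho1 sigma1 rho2 sigma2 r n @[n --> \oo] -->
    sc_formula rho1 sigma1 rho2 sigma2 r.
Proof.
move=> dr ds [_ t2] ds2 _ r0 [psi e2]; rewrite {rho2}e2 in t2 *.
have [V [l [hV l0 es]]] := psd_udiagP ds2.1; rewrite {sigma2}es in ds2 *.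
have psi1 : qf 1%:M psi = 1 by rewrite -trace_outer1.
have hlo c := @sc_rate_lower R d1 d2 rho1 sigma1 V l psi r c dr ds ds2 hV l0 psi1 r0.
(* For a finite value both bounds are used; for [+oo] the lower bound alone suffices; [-oo] is
   impossible because the term at [b = 1] is 0. *)
case hF : (sc_formula rho1 sigma1 (psi *m dag psi) (udiag V l) r) => [E||].
- apply: ereal_two_sided_cvg => eps eps0; last exact: sc_rate_upper hF eps0.
  by apply: hlo; rewrite hF lte_fin; lra.
- by apply/cvgeyPge => c; apply: hlo; rewrite hF ltry.
- by have := sc_formula_ge0 rho1 sigma1 (psi *m dag psi) (udiag V l) r; rewrite hF.
Qed.
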